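(* Let $a>1$ and $c>-1$, and for $N\in\mathbb{N}$ let $Q(z)=|z|^2-\frac{2c}{N}\log|z-a|$. Let $p_j\equiv p_{j,N}$ be the orthonormal polynomials of degree $j$ with respect to $e^{-NQ(z)}\,dA(z)$, $dA(z)=\frac{d^2z}{\pi}$, and let $K_N(z,w)=e^{-\frac N2(Q(z)+Q(w))}\sum_{j=0}^{N-1}p_j(z)\overline{p_j(w)}$. Let $p$ be a point with $|p|=1$. Then, as $N\to\infty$, up to cocycles (i.e. after multiplication by $g_N(z)\overline{g_N(w)}$ for suitable continuous unimodular functions $g_N$), $$\frac1N K_N\Big(p+\frac{p\,z}{\sqrt N},\,p+\frac{p\,w}{\sqrt N}\Big)\to G(z,w)\,\frac12\operatorname{erfc}\Big(\frac{z+\bar w}{\sqrt2}\Big),\qquad G(z,w)=e^{z\bar w-\frac{|z|^2}{2}-\frac{|w|^2}{2}},$$ uniformly for $z,w$ in compact subsets of $\mathbb{C}$.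
   Context: A correlation kernel of a determinantal point process is only determined up to a cocycle $g_N(z)\overline{g_N(w)}$ with $g_N$ continuous and unimodular, since such factors do not change the correlation functions $\det[K_N(z_j,z_l)]$. *)

(* Defs.v *)
From HB Require Import structures.
From mathcomp Require Import all_boot all_order all_algebra.
From mathcomp Require Import complex.
From mathcomp Require Import all_classical all_reals all_analysis.

Set Implicit Arguments.
Unset Strict Implicit.
Unset Printing Implicit Defensive.

Import Order.TTheory GRing.Theory Num.Theory.
Local Open Scope ring_scope.
Local Open Scope complex_scope.

Section Defs.
Variable R : realType.

Definition cnorm (z : R[i]) : R :=
  Num.sqrt (complex.Re z ^+ 2 + complex.Im z ^+ 2).

Definition cplx (xy : R * R) : R[i] := xy.1 +i* xy.2.

Definition cexp (z : R[i]) : R[i] :=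
  (expR (complex.Re z) * cos (complex.Im z)) +i* (expR (complex.Re z) * sin (complex.Im z)).

Definition cRint d (T : measurableType d) (mu : {measure set T -> \bar R})
  (D : set T) (f : T -> R[i]) : R[i] :=
  (Rintegral mu D (fun t => complex.Re (f t))) +i* (Rintegral mu D (fun t => complex.Im (f t))).

Definition leb2 := ((@lebesgue_measure R) \x (@lebesgue_measure R))%E.

Definition intdA (f : R[i] -> R[i]) : R[i] :=
  cRint leb2 setT (fun xy => f (cplx xy)) / (pi : R)%:C.

(* erf(zeta) = 2/sqrt(pi) int_0^zeta e^{-t^2} dt, along the segment [0, zeta]
   (t = s zeta, s in [0,1]); erfc = 1 - erf  (entire functions) *)
Definition erf (zeta : R[i]) : R[i] :=
  (2 / Num.sqrt pi)%:C *
  cRint (@lebesgue_measure R) `[0, 1]%classic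
        (fun s : R => zeta * cexp (- (s%:C * zeta) ^+ 2)).
Definition erfc (zeta : R[i]) : R[i] := 1 - erf zeta.

Definition Qpot (a c : R) (N : nat) (z : R[i]) : R :=
  cnorm z ^+ 2 - (2 * c / N%:R) * ln (cnorm (z - a%:C)).

Definition weight (a c : R) (N : nat) (z : R[i]) : R :=
  expR (- (N%:R * Qpot a c N z)).

Definition orthonormal_polys (a c : R) (N : nat) (P : nat -> {poly R[i]}) : Prop :=
  (forall j, size (P j) = j.+1) /\
  (forall j k, intdA (fun z => (P j).[z] * conjc (P k).[z] * (weight a c N z)%:C)
               = (j == k)%:R).

Definition kernelN (a c : R) (N : nat) (P : nat -> {poly R[i]}) (z w : R[i]) : R[i] :=
  (expR (- (N%:R / 2) * (Qpot a c N z + Qpot a c N w)))%:C *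
  \sum_(j < N) (P j).[z] * conjc (P j).[w].

Definition Gker (z w : R[i]) : R[i] :=
  cexp (z * conjc w - (cnorm z ^+ 2 / 2)%:C - (cnorm w ^+ 2 / 2)%:C).

Definition cont_unimodular (g : R[i] -> R[i]) : Prop :=
  (forall z, cnorm (g z) = 1) /\
  (forall z (eps : R), 0 < eps -> exists2 delta : R, 0 < delta &
     forall w, cnorm (w - z) < delta -> cnorm (g w - g z) < eps).

End Defs.

(* Main.v *)
(* On a disc of radius [rho] with [1 < rho < a], the functions [(a - z) ^ c] and
   [(a - z) ^ (- c)] are modelled in modulus by fixed polynomials [h1] and [h2].
   Multiplication by [h1] then sends polynomials of degree [< N], with the norm of
   the weight [|z - a| ^ (2 c) exp (- N |z| ^ 2)], almost contractively to
   polynomials of degree [< N + d] with the Gaussian norm, and [h2] does the same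
   from degree [< N - d] in the opposite direction: outside the disc polynomials
   have exponentially small mass.  As reproducing kernels are monotone, the kernel
   [|z - a| ^ c K_N(z, w) |w - a| ^ c] is squeezed, as a positive semidefinite form,
   between the Ginibre kernels of sizes [N - d] and [N + d].  At the edge both have
   the same limit: up to the cocycle [exp (- i sqrt N Im z)] they are [G(z, w)] times
   [exp (- X) sum_(j < n) X ^ j / j!] with
   [X = N + sqrt N (z + conj w) + z conj w], whose derivative along segments is
   Gaussian by Stirling-type estimates, and the constants are pinned down by
   Chebyshev's inequality for the Poisson distribution.  No phase has to be tracked
   for [h1], which is nearly constant at the scale [1 / sqrt N]. *)
Require Import Defs.
From HB Require Import structures.
From mathcomp Require Import all_boot all_order all_algebra.
From mathcomp Require Import complex.
From mathcomp Require Import all_classical all_reals all_analysis.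
From mathcomp Require Import measurable_realfun.
From mathcomp Require Import ring lra.

Set Implicit Arguments.
Unset Strict Implicit.
Unset Printing Implicit Defensive.

Import Order.TTheory GRing.Theory Num.Theory.
Import numFieldNormedType.Exports.
Local Open Scope ring_scope.
Local Open Scope complex_scope.

(** For general [c] the polynomials [P N j] have no usable formula, so nothing about them is
    computed. They enter only through the extremal property of reproducing kernels, which needs
    nothing but norm inequalities between [q] and [h * q]; the price is a fixed number [d] of
    degrees on either side, invisible at the scale [sqrt N]. The condition [a > 1] leaves room for a
    disc of radius larger than 1 that avoids the charge, where [log (1 - z / a)] is a convergent
    power series. As an order between quadratic forms only the upper one is needed; from below only
    diagonal entries are compared, because a positive semidefinite difference with a small diagonal
    has small off-diagonal entries. The upper form carries the factor [|z - a| ^ c / h1(z)], of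
    modulus near 1 and unknown phase. At two points at distance [O(1 / sqrt N)] these phases cancel,
    which is why the cocycle is [edge_phase], the same for all [a], [c] and [p]. *)

Local Notation Re := complex.Re.
Local Notation Im := complex.Im.

(** * Real and imaginary parts, conjugation and modulus *)

Section ComplexNumbers.
Context {R : realType}.
Implicit Types (x y : R) (z w : R[i]).

Lemma cnormE z : cnorm z = ComplexField.Normc.normc z.
Proof. by case: z. Qed.

Lemma ReD z w : Re (z + w) = Re z + Re w. Proof. by case: z w => [? ?] [? ?]. Qed.
Lemma ImD z w : Im (z + w) = Im z + Im w. Proof. by case: z w => [? ?] [? ?]. Qed.
Lemma ReN z : Re (- z) = - Re z. Proof. by case: z. Qed.
Lemma ImN z : Im (- z) = - Im z. Proof. by case: z. Qed.
Lemma ReB z w : Re (z - w) = Re z - Re w. Proof. by rewrite ReD ReN. Qed.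
Lemma ImB z w : Im (z - w) = Im z - Im w. Proof. by rewrite ImD ImN. Qed.
Lemma ReM z w : Re (z * w) = Re z * Re w - Im z * Im w.
Proof. by case: z w => [? ?] [? ?]. Qed.
Lemma ImM z w : Im (z * w) = Re z * Im w + Im z * Re w.
Proof. by case: z w => [? ?] [? ?] /=. Qed.
Lemma Re_conj z : Re (conjc z) = Re z. Proof. by case: z. Qed.
Lemma Im_conj z : Im (conjc z) = - Im z. Proof. by case: z. Qed.
Lemma ReZ x z : Re (x%:C * z) = x * Re z.
Proof. by rewrite ReM /= mul0r subr0. Qed.
Lemma ImZ x z : Im (x%:C * z) = x * Im z.
Proof. by rewrite ImM /= mul0r addr0. Qed.
Lemma Re_sum (I : Type) (r : seq I) (P : pred I) (F : I -> R[i]) :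
  Re (\sum_(i <- r | P i) F i) = \sum_(i <- r | P i) Re (F i).
Proof. by elim/big_rec2: _ => //= i x y _ <-; rewrite ReD. Qed.

Lemma complex_ext z w : Re z = Re w -> Im z = Im w -> z = w.
Proof. by case: z w => [? ?] [? ?] /= -> ->. Qed.

Lemma conjcD z w : conjc (z + w) = conjc z + conjc w.
Proof. by case: z w => [? ?] [? ?]; apply: complex_ext => //=; rewrite opprD. Qed.
Lemma conjcM z w : conjc (z * w) = conjc z * conjc w.
Proof. by case: z w => [? ?] [? ?]; apply: complex_ext => /=; ring. Qed.
Lemma conjcX z n : conjc (z ^+ n) = conjc z ^+ n.
Proof.
elim: n => [|n IH]; last by rewrite !exprS conjcM IH.
by rewrite !expr0; apply: complex_ext => //=; rewrite oppr0.
Qed.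
Lemma conjcR x : conjc x%:C = x%:C.
Proof. by apply: complex_ext => //=; rewrite oppr0. Qed.

Definition ReImE := (ReD, ReN, ReM, ImD, ImN, ImM, Re_conj, Im_conj).

Lemma cnorm_ge0 z : 0 <= cnorm z. Proof. exact: sqrtr_ge0. Qed.
Lemma sqr_cnorm z : cnorm z ^+ 2 = Re z ^+ 2 + Im z ^+ 2.
Proof. by rewrite sqr_sqrtr// addr_ge0// sqr_ge0. Qed.
Lemma cnorm0 : cnorm 0 = 0 :> R. Proof. by rewrite cnormE ComplexField.Normc.normc0. Qed.
Lemma cnorm1 : cnorm 1 = 1 :> R. Proof. by rewrite cnormE ComplexField.Normc.normc1. Qed.
Lemma cnormM z w : cnorm (z * w) = cnorm z * cnorm w.
Proof. by rewrite !cnormE ComplexField.Normc.normcM. Qed.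
Lemma cnormX z n : cnorm (z ^+ n) = cnorm z ^+ n.
Proof. by elim: n => [|n IH]; rewrite ?expr0 ?cnorm1// !exprS cnormM IH. Qed.
Lemma cnormV z : cnorm z^-1 = (cnorm z)^-1.
Proof. by rewrite !cnormE ComplexField.Normc.normcV. Qed.
Lemma cnormN z : cnorm (- z) = cnorm z.
Proof. by rewrite /cnorm ReN ImN !sqrrN. Qed.
Lemma cnormD z w : cnorm (z + w) <= cnorm z + cnorm w.
Proof. by rewrite !cnormE le_normcD. Qed.
Lemma cnormB z w : cnorm (z - w) <= cnorm z + cnorm w.
Proof. by rewrite (le_trans (cnormD _ _))// cnormN. Qed.
Lemma cnorm_distC z w : cnorm (z - w) = cnorm (w - z).
Proof. by rewrite -cnormN opprB. Qed.
Lemma cnorm_sum (I : Type) (r : seq I) (P : pred I) (F : I -> R[i]) :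
  cnorm (\sum_(i <- r | P i) F i) <= \sum_(i <- r | P i) cnorm (F i).
Proof.
elim/big_rec2: _ => [|i x y _ h]; first by rewrite cnorm0.
by rewrite (le_trans (cnormD _ _))// lerD2l.
Qed.
Lemma cnorm_conj z : cnorm (conjc z) = cnorm z.
Proof. by rewrite /cnorm Re_conj Im_conj sqrrN. Qed.
Lemma cnorm_real x : cnorm x%:C = `|x|.
Proof. by rewrite /cnorm/= expr0n addr0 sqrtr_sqr. Qed.
Lemma cnorm_eq0 z : cnorm z = 0 -> z = 0.
Proof. by rewrite cnormE => /ComplexField.Normc.eq0_normc. Qed.
Lemma cnorm_gt0 z : z != 0 -> 0 < cnorm z.
Proof. by move=> z0; rewrite lt_neqAle cnorm_ge0 andbT eq_sym; apply: contra_neq z0 => /cnorm_eq0. Qed.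
Lemma norm_Re_le z : `|Re z| <= cnorm z.
Proof. by rewrite -sqrtr_sqr ler_wsqrtr// lerDl sqr_ge0. Qed.
Lemma norm_Im_le z : `|Im z| <= cnorm z.
Proof. by rewrite -sqrtr_sqr ler_wsqrtr// lerDr sqr_ge0. Qed.
Lemma complexReIm z : z = (Re z)%:C + 'i%C * (Im z)%:C.
Proof. exact: complexE. Qed.
Lemma cnorm_le_ReIm z : cnorm z <= `|Re z| + `|Im z|.
Proof.
rewrite {1}[z]complexReIm (le_trans (cnormD _ _))// cnormM !cnorm_real lerD2l.
by rewrite /cnorm/= expr0n expr1n add0r sqrtr1 mul1r.
Qed.
Lemma mulcJ z : z * conjc z = (cnorm z ^+ 2)%:C.
Proof. by rewrite sqr_cnorm; case: z => a b; apply: complex_ext => /=; ring. Qed.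
Lemma real_complexM x y : (x * y)%:C = x%:C * y%:C :> R[i]. Proof. exact: rmorphM. Qed.
Lemma real_complexD x y : (x + y)%:C = x%:C + y%:C :> R[i]. Proof. exact: rmorphD. Qed.
Lemma real_complexB x y : (x - y)%:C = x%:C - y%:C :> R[i]. Proof. exact: rmorphB. Qed.
Lemma real_complexN x : (- x)%:C = - x%:C :> R[i]. Proof. exact: rmorphN. Qed.
Lemma real_complexV x : (x^-1)%:C = x%:C^-1 :> R[i]. Proof. exact: fmorphV. Qed.
Lemma real_complexX x n : (x ^+ n)%:C = x%:C ^+ n :> R[i]. Proof. exact: rmorphXn. Qed.
Lemma real_complex_nat n : (n%:R)%:C = n%:R :> R[i]. Proof. exact: rmorph_nat. Qed.
Lemma real_complex_neq0 x : x != 0 -> x%:C != 0 :> R[i].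
Proof. by move=> x0; rewrite fmorph_eq0. Qed.
Lemma cnorm_nat n : cnorm (n%:R : R[i]) = n%:R.
Proof. by rewrite -real_complex_nat cnorm_real normr_nat. Qed.

Lemma cnorm_subX z w n (M : R) : cnorm z <= M -> cnorm w <= M ->
  cnorm (z ^+ n - w ^+ n) <= n%:R * M ^+ n.-1 * cnorm (z - w).
Proof.
move=> zM wM; rewrite subrXX cnormM [leLHS]mulrC.
apply: ler_wpM2r; first exact: cnorm_ge0.
apply: le_trans (cnorm_sum _ _ _) _.
have M0 : 0 <= M by apply: le_trans zM; exact: cnorm_ge0.
rewrite (_ : n%:R * _ = \sum_(i < n) M ^+ n.-1); last first.
  by rewrite sumr_const card_ord mulr_natl.
apply: ler_sum => i _; rewrite cnormM !cnormX.
apply: le_trans (_ : M ^+ (n.-1 - i) * M ^+ i <= _).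
  by apply: ler_pM; rewrite ?exprn_ge0 ?cnorm_ge0 ?lerXn2r ?nnegrE ?cnorm_ge0.
by rewrite -exprD subnK// -ltnS prednK// (leq_ltn_trans _ (ltn_ord i)).
Qed.

(** * Complex exponential *)

Lemma cexpD z w : cexp (z + w) = cexp z * cexp w.
Proof.
by rewrite /cexp ReD ImD expRD cosD sinD; apply: complex_ext => /=; ring.
Qed.
Lemma cexp0 : cexp 0 = 1 :> R[i].
Proof. by rewrite /cexp /= expR0 cos0 sin0 mulr1 mulr0. Qed.
Lemma cexp_real x : cexp x%:C = (expR x)%:C.
Proof. by rewrite /cexp /= cos0 sin0 mulr1 mulr0. Qed.
Lemma cnorm_cexp z : cnorm (cexp z) = expR (Re z).
Proof.
rewrite /cnorm /= !exprMn -mulrDr cos2Dsin2 mulr1 sqrtr_sqr ger0_norm//.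

Qed.
Lemma cexp_nat z n : cexp (n%:R * z) = cexp z ^+ n.
Proof.
elim: n => [|n IH]; first by rewrite mul0r cexp0 expr0.
by rewrite -natr1 mulrDl mul1r cexpD IH exprSr.
Qed.
Lemma conj_cexp z : conjc (cexp z) = cexp (conjc z).
Proof.
rewrite /cexp Re_conj Im_conj cosN sinN mulrN //.
Qed.
Lemma cnorm_cexp_le z : cnorm (cexp z) <= expR (cnorm z).
Proof. by rewrite cnorm_cexp ler_expR (le_trans (ler_norm _))// norm_Re_le. Qed.

End ComplexNumbers.

(** * Calculus along real segments *)

Section SegmentCalculus.
Context {R : realType}.
Implicit Types (f g F : R -> R[i]).

(** Complex functions are differentiated componentwise along real lines: every holomorphic estimate
    below is reduced to a segment, where the real mean value theorem and the real fundamental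
    theorem of calculus apply. *)
Definition cderiv f f' : Prop := forall t : R,
  is_derive t 1 (fun s => Re (f s)) (Re (f' t)) /\
  is_derive t 1 (fun s => Im (f s)) (Im (f' t)).

Lemma cderiv_eq f f1 f2 : cderiv f f1 -> f1 =1 f2 -> cderiv f f2.
Proof. by move=> h e t; rewrite -e. Qed.

Lemma cderiv_ext f g f' : cderiv f f' -> f =1 g -> cderiv g f'.
Proof. by move=> h /funext <-. Qed.

Lemma cderiv_cst (v : R[i]) : cderiv (fun=> v) (fun=> 0).
Proof. by move=> t; split; exact: is_derive_cst. Qed.

Lemma cderivD f g f' g' : cderiv f f' -> cderiv g g' ->
  cderiv (fun t => f t + g t) (fun t => f' t + g' t).
Proof.
move=> hf hg t; have [f1 f2] := hf t; have [g1 g2] := hg t; rewrite ReD ImD; split.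
- by under eq_fun do rewrite ReD; exact: is_deriveD.
- by under eq_fun do rewrite ImD; exact: is_deriveD.
Qed.

Lemma cderivN f f' : cderiv f f' -> cderiv (fun t => - f t) (fun t => - f' t).
Proof.
move=> hf t; have [f1 f2] := hf t; rewrite ReN ImN; split.
- by under eq_fun do rewrite ReN; exact: is_deriveN.
- by under eq_fun do rewrite ImN; exact: is_deriveN.
Qed.

Lemma cderivM f g f' g' : cderiv f f' -> cderiv g g' ->
  cderiv (fun t => f t * g t) (fun t => f' t * g t + f t * g' t).
Proof.
move=> hf hg t; have [f1 f2] := hf t; have [g1 g2] := hg t; split.
- under eq_fun do rewrite ReM; apply: is_derive_eq.
  by rewrite !ReImE /GRing.scale /=; ring.
- under eq_fun do rewrite ImM; apply: is_derive_eq.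
  by rewrite !ReImE /GRing.scale /=; ring.
Qed.

Lemma cderivZ (v : R[i]) f f' : cderiv f f' ->
  cderiv (fun t => v * f t) (fun t => v * f' t).
Proof.
move=> hf; apply: cderiv_eq; first exact: cderivM (cderiv_cst v) hf.
by move=> t /=; rewrite mul0r add0r.
Qed.

Lemma cderiv_id : cderiv (fun t => t%:C) (fun=> 1).
Proof. by move=> t; split => /=; [exact: is_derive_id | exact: is_derive_cst]. Qed.

Lemma cderiv_affine (v w : R[i]) : cderiv (fun t => v + t%:C * w) (fun=> w).
Proof.
apply: cderiv_eq; first exact: cderivD (cderiv_cst v) (cderivM cderiv_id (cderiv_cst w)).
by move=> t /=; rewrite mulr0 addr0 add0r mul1r.
Qed.

Lemma cderivX f f' n : cderiv f f' ->
  cderiv (fun t => f t ^+ n) (fun t => n%:R * f t ^+ n.-1 * f' t).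
Proof.
move=> hf; elim: n => [|n IH].
  apply: cderiv_eq; first exact: (cderiv_cst 1).
  by move=> t /=; rewrite !mul0r.
apply: cderiv_ext; last by move=> t; rewrite exprSr; reflexivity.
apply: cderiv_eq; first exact: cderivM IH hf.
move=> t /=; case: n {IH} => [|n] /=; first by rewrite expr0; ring.
by rewrite -[n.+2%:R]natr1 exprSr; ring.
Qed.

Lemma cderiv_cexp f f' : cderiv f f' ->
  cderiv (fun t => cexp (f t)) (fun t => f' t * cexp (f t)).
Proof.
move=> hf t; have [f1 f2] := hf t.
have de := is_derive1_comp (is_derive_expR (Re (f t))) f1.
have dc := is_derive1_comp (is_derive_cos (Im (f t))) f2.
have ds := is_derive1_comp (is_derive_sin (Im (f t))) f2.
split.
- apply: (is_derive_eq (is_deriveM de dc)).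
  by rewrite ReM /= /GRing.scale /=; ring.
- apply: (is_derive_eq (is_deriveM de ds)).
  by rewrite ImM /= /GRing.scale /=; ring.
Qed.

Definition ccont f := continuous (fun t => Re (f t)) /\ continuous (fun t => Im (f t)).

Lemma cderiv_cont f f' : cderiv f f' -> ccont f.
Proof.
move=> hf; split => t; have [[f1 _] [f2 _]] := hf t.
- exact/differentiable_continuous/derivable1_diffP.
- exact/differentiable_continuous/derivable1_diffP.
Qed.

(** The mean value theorem fails for complex values, so both components are treated separately; this
    costs the factor 2, which is harmless throughout. *)
Lemma cderiv_mean_le f f' (M : R) : cderiv f f' ->
  (forall t : R, 0 <= t <= 1 -> cnorm (f' t) <= M) -> cnorm (f 1 - f 0) <= 2 * M.
Proof.
move=> hf hM; have [cR cI] := cderiv_cont hf.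
have key (h h' : R -> R) : (forall t : R, is_derive t 1 h (h' t)) -> continuous h ->
    (forall t : R, 0 <= t <= 1 -> `|h' t| <= M) -> `|h 1 - h 0| <= M.
  move=> dh ch hb; have [c] := @MVT_segment R h h' 0 1 ler01 (fun x _ => dh x) (continuous_subspaceT ch).
  by rewrite in_itv /= => c01 ->; rewrite subr0 mulr1; exact: hb.
apply: le_trans (cnorm_le_ReIm _) _; rewrite mulrDl mul1r ReB ImB.
apply: lerD.
- apply: (key (fun t => Re (f t)) (fun t => Re (f' t))) => // [t|t t01]; first by case: (hf t).
  exact: le_trans (norm_Re_le _) (hM _ t01).
- apply: (key (fun t => Im (f t)) (fun t => Im (f' t))) => // [t|t t01]; first by case: (hf t).
  exact: le_trans (norm_Im_le _) (hM _ t01).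
Qed.

Let mu := @lebesgue_measure R.
Local Open Scope classical_set_scope.

Definition segint f : R[i] := cRint mu `[0, 1] f.

Lemma continuous_integrable01 (h : R -> R) : continuous h ->
  mu.-integrable `[0, 1] (EFin \o h).
Proof.
move=> ch; apply: continuous_compact_integrable; first exact: segment_compact.
exact: continuous_subspaceT.
Qed.

Lemma segint_deriv F f : cderiv F f -> ccont f -> segint f = F 1 - F 0.
Proof.
move=> dF [cR cI]; have [CR CI] := cderiv_cont dF.
have key (h h' : R -> R) : (forall t : R, is_derive t 1 h (h' t)) -> continuous h ->
    continuous h' -> (\int[mu]_(t in `[0, 1]) h' t)%R = h 1 - h 0.
  move=> dh ch ch'; rewrite /Rintegral (@continuous_FTC2 R h' h)//.
  - exact: continuous_subspaceT.
  - split; first by move=> x _; have [] := dh x.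
    + exact/cvg_at_right_filter/ch.
    + exact/cvg_at_left_filter/ch.
  - by move=> x _; rewrite derive1E; have [_ ->] := dh x.
apply: complex_ext => /=; rewrite ?ReB ?ImB.
- by apply: (key (fun t => Re (F t)) (fun t => Re (f t))) => // t; case: (dF t).
- by apply: (key (fun t => Im (F t)) (fun t => Im (f t))) => // t; case: (dF t).
Qed.

Lemma segintZ (v : R[i]) f : ccont f -> segint (fun t => v * f t) = v * segint f.
Proof.
move=> [cR cI]; apply: complex_ext => /=; rewrite ?ReM ?ImM /=.
- under eq_Rintegral do rewrite ReM.
  have iR := continuous_integrable01 cR; have iI := continuous_integrable01 cI.
  rewrite RintegralB ?RintegralZl//.
  + exact: (integrableZl _ (Re v) iR).
  + exact: (integrableZl _ (Im v) iI).
- under eq_Rintegral do rewrite ImM.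
  have iR := continuous_integrable01 cR; have iI := continuous_integrable01 cI.
  rewrite RintegralD ?RintegralZl//.
  + exact: (integrableZl _ (Re v) iI).
  + exact: (integrableZl _ (Im v) iR).
Qed.

Lemma segint_dist f g (M : R) : ccont f -> ccont g ->
  (forall t : R, 0 <= t <= 1 -> cnorm (f t - g t) <= M) ->
  cnorm (segint f - segint g) <= 2 * M.
Proof.
move=> [fR fI] [gR gI] hM.
have key (h k : R -> R) : continuous h -> continuous k ->
    (forall t : R, 0 <= t <= 1 -> `|h t - k t| <= M) ->
    `| (\int[mu]_(t in `[0, 1]) h t)%R - (\int[mu]_(t in `[0, 1]) k t)%R | <= M.
  move=> ch ck hb.
  have ih := continuous_integrable01 ch; have ik := continuous_integrable01 ck.
  rewrite -RintegralB//.
  have ihk : mu.-integrable `[0, 1] (EFin \o (fun t => h t - k t)).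
    by apply: continuous_integrable01 => t; apply: cvgB; [exact: ch|exact: ck].
  apply: le_trans (le_normr_Rintegral _ ihk) _ => //.
  apply: (@le_trans _ _ (\int[mu]_(t in `[0, 1]) (cst M) t)%R).
    apply: le_Rintegral => //.
    - have ihk' : continuous (fun t => `|h t - k t|).
        by move=> t; apply: cvg_norm; apply: cvgB; [exact: ch|exact: ck].
      exact: (continuous_integrable01 ihk').
    - by apply: continuous_integrable01; exact: cst_continuous.
  rewrite Rintegral_cst//= lebesgue_measure_itv /= lte_fin ltr01.
  by rewrite -EFinB /= subr0 mulr1.
apply: le_trans (cnorm_le_ReIm _) _; rewrite mulrDl mul1r ReB ImB; apply: lerD.
- apply: (key (fun t => Re (f t)) (fun t => Re (g t))) => // t t01; rewrite -ReB; exact: le_trans (norm_Re_le _) (hM _ t01).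
- apply: (key (fun t => Im (f t)) (fun t => Im (g t))) => // t t01; rewrite -ImB; exact: le_trans (norm_Im_le _) (hM _ t01).
Qed.

End SegmentCalculus.

(** * Truncated exponentials *)

Section TruncatedExponential.
Context {R : realType}.
Implicit Types (f g : R -> R[i]) (u v s : R[i]).

Definition cexps n v : R[i] := \sum_(k < n) v ^+ k / (k`!)%:R.

Lemma cexpsS n v : cexps n.+1 v = cexps n v + v ^+ n / (n`!)%:R.
Proof. by rewrite /cexps big_ord_recr. Qed.

Lemma cexps1 v : cexps 1 v = 1.
Proof. by rewrite cexpsS /cexps big_ord0 add0r expr0 fact0 divr1. Qed.

Lemma cexps2 v : cexps 2 v = 1 + v.
Proof. by rewrite cexpsS cexps1 expr1 divr1. Qed.

Lemma cexps3 v : cexps 3 v = 1 + v + v ^+ 2 / 2.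
Proof. by rewrite cexpsS cexps2. Qed.

Lemma factC_neq0 n : (n`!)%:R != 0 :> R[i].
Proof. by rewrite pnatr_eq0 -lt0n fact_gt0. Qed.

Lemma cderiv_cexps f f' n : cderiv f f' ->
  cderiv (fun t => cexps n.+1 (f t)) (fun t => f' t * cexps n (f t)).
Proof.
move=> hf; elim: n => [|n IH].
  apply: cderiv_ext; last by move=> t; rewrite cexps1; reflexivity.
  apply: cderiv_eq; first exact: cderiv_cst.
  by move=> t; rewrite /cexps big_ord0 mulr0.
apply: cderiv_ext; last by move=> t; rewrite cexpsS; reflexivity.
apply: cderiv_eq.
  exact: cderivD IH (cderivM (cderivX n.+1 hf) (cderiv_cst _)).
move=> t /=; rewrite mulr0 addr0 cexpsS factS natrM.
by field; rewrite factC_neq0 nat1r pnatr_eq0.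
Qed.

(** The remainder of order [n + 1] along the segment has as derivative [v] times the remainder of
    order [n]. Iterating the mean value bound with its factor 2 gives [2 ^ n] instead of a
    factorial. *)
Lemma cexp_taylor n v :
  cnorm (cexp v - cexps n v) <= (2 * cnorm v) ^+ n * expR (cnorm v).
Proof.
elim: n v => [|n IH] v.
  by rewrite /cexps big_ord0 subr0 expr0 mul1r cnorm_cexp_le.
have d1 := cderiv_affine 0 v.
have dT : cderiv (fun t => cexp (0 + t%:C * v) - cexps n.+1 (0 + t%:C * v))
    (fun t => v * (cexp (0 + t%:C * v) - cexps n (0 + t%:C * v))).
  apply: cderiv_eq; first exact: cderivD (cderiv_cexp d1) (cderivN (cderiv_cexps n d1)).
  by move=> t; rewrite /= mulrBr.
have := @cderiv_mean_le _ _ _ (cnorm v * ((2 * cnorm v) ^+ n * expR (cnorm v))) dT.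
have -> : cexps n.+1 (0 + 0%:C * v) = 1.
  rewrite mul0r addr0 /cexps big_ord_recl expr0 fact0 divr1 big1 ?addr0// => i _.
  by rewrite expr0n mul0r.
rewrite !mul1r mul0r !add0r cexp0 subrr subr0 => h.
apply: le_trans (h _) _; last by rewrite exprS !mulrA.
move=> t /andP[t0 t1]; rewrite add0r cnormM ler_wpM2l ?cnorm_ge0//.
have tv : cnorm (t%:C * v) <= cnorm v.
  by rewrite cnormM cnorm_real ger0_norm// ler_piMl ?cnorm_ge0.
apply: le_trans (IH _) _; apply: ler_pM; rewrite ?expR_ge0 ?ler_expR//.
  by rewrite exprn_ge0// mulr_ge0// cnorm_ge0.
by rewrite lerXn2r ?nnegrE ?mulr_ge0 ?cnorm_ge0 ?ler_wpM2l.
Qed.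

Lemma cexp_sub1 v : cnorm (cexp v - 1) <= 2 * cnorm v * expR (cnorm v).
Proof. by have := cexp_taylor 1 v; rewrite cexps1 expr1. Qed.

Lemma cexp_lip u v (M : R) : cnorm u <= M -> cnorm v <= M ->
  cnorm (cexp u - cexp v) <= 2 * expR (3 * M) * cnorm (u - v).
Proof.
move=> uM vM; rewrite (_ : cexp u - cexp v = cexp v * (cexp (u - v) - 1)); last first.
  by rewrite mulrBr -cexpD mulr1 addrCA subrr addr0.
rewrite cnormM (_ : 3 * M = M + (M + M)); last by ring.
apply: (@le_trans _ _ (expR M * (2 * cnorm (u - v) * expR (M + M)))).
  apply: ler_pM; rewrite ?cnorm_ge0//.
    by rewrite (le_trans (cnorm_cexp_le _))// ler_expR.
  apply: le_trans (cexp_sub1 _) _; rewrite ler_wpM2l ?mulr_ge0 ?cnorm_ge0//.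
  by rewrite ler_expR (le_trans (cnormB _ _))// lerD.
by rewrite [expR (M + (M + M))]expRD le_eqVlt; apply/orP; left; apply/eqP; ring.
Qed.

(* For real [v >= 0] this is the probability that a Poisson variable of mean
   [v] is smaller than [n]. *)
Definition gammaQ n v : R[i] := cexp (- v) * cexps n v.

(** The derivative of the truncated series cancels against the series itself except for the top
    term, which leaves the density of a gamma distribution. *)
Lemma cderiv_gammaQ f f' n : cderiv f f' ->
  cderiv (fun t => gammaQ n.+1 (f t))
         (fun t => - (f' t * cexp (- f t) * f t ^+ n / (n`!)%:R)).
Proof.
move=> hf; apply: cderiv_eq.
  exact: cderivM (cderiv_cexp (cderivN hf)) (cderiv_cexps n hf).
by move=> t /=; rewrite cexpsS; field; rewrite factC_neq0.
Qed.

(** The gamma density [exp (- v) v ^ n / n!] at [v = n + 1], rescaled by the standard deviation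
    [sqrt (n + 1)]. By Stirling it tends to [1 / sqrt (2 pi)], which [stirling_median] proves. *)
Definition stirlingA n : R :=
  Num.sqrt n.+1%:R * expR (- n.+1%:R) * n.+1%:R ^+ n / (n`!)%:R.

(** The gamma density at [n + 1 + sqrt (n + 1) u] divided by its value at [n + 1]; its limit is
    [exp (- u ^ 2 / 2)]. *)
Definition gauss_approx n u : R[i] :=
  cexp (- ((Num.sqrt n.+1%:R)%:C * u)) * (1 + u / (Num.sqrt n.+1%:R)%:C) ^+ n.

(** The integral of [exp (- u ^ 2 / 2)] from [0] to [s] along the segment; it is [erf (s / sqrt 2)]
    up to the factor [sqrt (pi / 2)]. *)
Definition gaussE s : R[i] := segint (fun t => s * cexp (- (t%:C * s) ^+ 2 / 2)).

Lemma cont_gaussE s : ccont (fun t => s * cexp (- (t%:C * s) ^+ 2 / 2)).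
Proof.
have d1 := cderivM cderiv_id (cderiv_cst s).
by have := cderiv_cont (cderivZ s (cderiv_cexp (cderivM (cderivN (cderivX 2 d1)) (cderiv_cst 2^-1)))).
Qed.

Lemma cont_gauss_approx n s : ccont (fun t => s * gauss_approx n (t%:C * s)).
Proof.
have d1 := cderivM cderiv_id (cderiv_cst s).
have := cderiv_cont (cderivZ s (cderivM (cderiv_cexp (cderivN (cderivZ (Num.sqrt n.+1%:R)%:C d1)))
  (cderivX n (cderivD (cderiv_cst 1) (cderivM d1 (cderiv_cst (Num.sqrt n.+1%:R)%:C^-1)))))).
exact.
Qed.

Lemma sqrtS_gt0 n : 0 < Num.sqrt (n.+1%:R : R).
Proof. by rewrite sqrtr_gt0 ltr0Sn. Qed.

Lemma sqr_sqrtS n : Num.sqrt (n.+1%:R : R) * Num.sqrt (n.+1%:R : R) = n.+1%:R.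
Proof. by rewrite -expr2 sqr_sqrtr// ler0n. Qed.

(** An exact identity: integrate the gamma density along the segment from [n + 1]. What remains to
    be found is the limit of the value at [n + 1] and of the constant [stirlingA n]. *)
Lemma gammaQ_segint n s :
  gammaQ n.+1 (n.+1%:R + (Num.sqrt n.+1%:R)%:C * s) = gammaQ n.+1 n.+1%:R -
  (stirlingA n)%:C * segint (fun t => s * gauss_approx n (t%:C * s)).
Proof.
set q : R := Num.sqrt n.+1%:R.
have q0 : q%:C != 0 by rewrite real_complex_neq0 ?gt_eqF ?sqrtS_gt0.
have qq : q%:C * q%:C = n.+1%:R by rewrite -real_complexM sqr_sqrtS real_complex_nat.
have d1 := cderiv_affine n.+1%:R (q%:C * s).
have dF : cderiv (fun t => gammaQ n.+1 (n.+1%:R + t%:C * (q%:C * s)))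
    (fun t => (- (stirlingA n)%:C) * (s * gauss_approx n (t%:C * s))).
  apply: cderiv_eq; first exact: cderiv_gammaQ n d1.
  move=> t /=.
  have -> : n.+1%:R + t%:C * (q%:C * s) = n.+1%:R * (1 + t%:C * s / q%:C).
    by rewrite -qq; field.
  rewrite /gauss_approx /stirlingA -/q exprMn.
  have -> : cexp (- (n.+1%:R * (1 + t%:C * s / q%:C))) =
      (expR (- n.+1%:R))%:C * cexp (- (q%:C * (t%:C * s))).
    rewrite -cexp_real -cexpD real_complexN real_complex_nat; congr cexp.
    by rewrite -qq; field.
  rewrite !real_complexM real_complexV real_complexX !real_complex_nat.
  by field; rewrite factC_neq0.
have dg : ccont (fun t => - (stirlingA n)%:C * (s * gauss_approx n (t%:C * s))).
  have d2 := cderivM cderiv_id (cderiv_cst s).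
  have := cderiv_cont (cderivZ (- (stirlingA n)%:C) (cderivZ s (cderivM (cderiv_cexp (cderivN (cderivZ (Num.sqrt n.+1%:R)%:C d2)))
  (cderivX n (cderivD (cderiv_cst 1) (cderivM d2 (cderiv_cst (Num.sqrt n.+1%:R)%:C^-1))))))).
  exact.
have := segint_deriv dF dg.
rewrite (segintZ _ (cont_gauss_approx n s)).
rewrite mulNr mul1r mul0r addr0 => h.
by rewrite -[LHS](subrK (gammaQ n.+1 n.+1%:R)) -h addrC.
Qed.

(** One factor of the Gaussian approximation: [(1 + x) (1 - x + x ^ 2 / 2) = 1 - x ^ 2 / 2 + x ^ 3 /
    2], so the two sides agree to third order. The errors add up to [16 + 1 + 1], rounded to 20. *)
Lemma gauss_factor_near (x : R[i]) : cnorm x <= 1 ->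
  cnorm ((1 + x) * cexp (- x) - cexp (- x ^+ 2 / 2)) <= 20 * expR 1 * cnorm x ^+ 3.
Proof.
move=> x1; set a := cnorm x in x1 *; have a0 : 0 <= a := cnorm_ge0 _.
have h1 := cexp_taylor 3 (- x); have h2 := cexp_taylor 2 (- x ^+ 2 / 2).
have n2 : cnorm (- x ^+ 2 / 2) = a ^+ 2 / 2.
  by rewrite cnormM cnormN cnormV cnormX cnorm_nat.
rewrite n2 in h2; rewrite cnormN -/a in h1.
set e1 := cexp (- x) in h1 *; set e2 := cexp _ in h2 *.
have -> : (1 + x) * e1 - e2 = (1 + x) * (e1 - cexps 3 (- x)) -
    (e2 - cexps 2 (- x ^+ 2 / 2)) + x ^+ 3 / 2.
  by rewrite cexps3 cexps2; field.
have ea : expR a <= expR 1 by rewrite ler_expR.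
have ea2 : expR (a ^+ 2 / 2) <= expR 1.
  by rewrite ler_expR; nra.
have e11 : 1 <= expR 1 :> R by have := expR_ge1Dx (1 : R); lra.
have a3 : 0 <= a ^+ 3 by rewrite exprn_ge0.
have b1 : cnorm ((1 + x) * (e1 - cexps 3 (- x))) <= 2 * (8 * a ^+ 3 * expR 1).
  rewrite cnormM; apply: ler_pM; rewrite ?cnorm_ge0//.
    by rewrite (le_trans (cnormD _ _))// cnorm1 -/a; lra.
  apply: le_trans h1 _; rewrite exprMn (_ : 2 ^+ 3 = 8); last by ring.
  by apply: ler_wpM2l => //; rewrite mulr_ge0.
have b2 : cnorm (e2 - cexps 2 (- x ^+ 2 / 2)) <= a ^+ 3 * expR 1.
  apply: le_trans h2 _; apply: ler_pM; rewrite ?expR_ge0//; first exact: sqr_ge0.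
  have -> : (2 * (a ^+ 2 / 2)) ^+ 2 = a ^+ 3 * a by field.
  by rewrite ler_piMr.
have b3 : cnorm (x ^+ 3 / 2) <= a ^+ 3 * expR 1.
  rewrite cnormM cnormX cnormV cnorm_nat -/a ler_wpM2l//; lra.
apply: le_trans (cnormD _ _) _; apply: le_trans (lerD (cnormB _ _) b3) _.
apply: le_trans (lerD (lerD b1 b2) (lexx _)) _.
have : 0 <= a ^+ 3 * expR 1 by rewrite mulr_ge0 ?expR_ge0.
lra.
Qed.

(** With [x = u / sqrt (n + 1)] both functions are essentially [n]-th powers of numbers of modulus
    at most [exp (L / (n + 1))], so the powers stay bounded and [n] errors of order
    [(n + 1) ^ (- 3 / 2)] add up to [O(1 / sqrt (n + 1))]. The condition on [M] gives [|x| <= 1]. *)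
Lemma gauss_approx_near (M : R) : 0 <= M -> exists2 C : R, 0 <= C &
  forall n u, M <= Num.sqrt n.+1%:R -> cnorm u <= M ->
  cnorm (gauss_approx n u - cexp (- u ^+ 2 / 2)) <= C / Num.sqrt n.+1%:R.
Proof.
move=> M0; set K : R := 20 * expR 1.
have K0 : 0 <= K by rewrite mulr_ge0 ?expR_ge0.
pose L := M ^+ 2 + K * M ^+ 3.
have L0 : 0 <= L by rewrite addr_ge0 ?mulr_ge0 ?exprn_ge0.
exists (expR L * K * M ^+ 3 * expR 1 + expR L * (4 * expR 1 * M)).
  by rewrite addr_ge0 ?mulr_ge0 ?expR_ge0 ?exprn_ge0 ?mulr_ge0 ?expR_ge0.
move=> n u; set q : R := Num.sqrt n.+1%:R => Mq uM.
have q0 : 0 < q := sqrtS_gt0 n.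
have qq : q * q = n.+1%:R := sqr_sqrtS n.
have qC0 : q%:C != 0 by rewrite real_complex_neq0 ?gt_eqF.
have qqC : q%:C * q%:C = n.+1%:R by rewrite -real_complexM qq real_complex_nat.
have q1 : 1 <= q.
  by rewrite -(sqrtr1 R) ler_sqrt ?ler1n// ?ler0n.
pose x := u / q%:C; set A := (1 + x) * cexp (- x); set B := cexp (- x ^+ 2 / 2).
have ux : u = q%:C * x by rewrite /x mulrC divfK.
have xn : cnorm x = cnorm u / q.
  by rewrite /x cnormM cnormV cnorm_real gtr0_norm.
have xM : cnorm x <= M / q by rewrite xn ler_pM2r ?invr_gt0.
have Mq1 : M / q <= 1 by rewrite ler_pdivrMr// mul1r.
have x1 : cnorm x <= 1 := le_trans xM Mq1.
have x0 := cnorm_ge0 x.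
(* Since [sqrt (n + 1) u = (n + 1) x], there are [n + 1] exponential factors against [n] factors
   [1 + x]. The unpaired [cexp (- x)] is the second summand of the constant. *)
have -> : gauss_approx n u = A ^+ n * cexp (- x).
  rewrite /gauss_approx /A exprMn -/q -/x -cexp_nat mulrC -mulrA -cexpD.
  congr (_ * cexp _); rewrite {1}ux mulrA qqC -[n.+1%:R]natr1; ring.
have -> : cexp (- u ^+ 2 / 2) = B ^+ n * B.
  rewrite /B -exprSr -cexp_nat; congr cexp; rewrite ux -qqC; ring.
have nB : cnorm B <= expR (M ^+ 2 / n.+1%:R).
  apply: le_trans (cnorm_cexp_le _) _; rewrite ler_expR.
  rewrite cnormM cnormN cnormV cnormX cnorm_nat -qq.
  have : cnorm x ^+ 2 <= (M / q) ^+ 2 by rewrite lerXn2r ?nnegrE// divr_ge0// ltW.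
  rewrite exprMn exprVn [q ^+ 2]expr2 => h; apply: le_trans h.
  by rewrite ler_pdivrMr//; have := sqr_ge0 (cnorm x); lra.
have dAB : cnorm (A - B) <= K * M ^+ 3 / (q * n.+1%:R).
  apply: le_trans (gauss_factor_near x1) _; rewrite -/K -mulrA ler_wpM2l//.
  have : cnorm x ^+ 3 <= (M / q) ^+ 3 by rewrite lerXn2r ?nnegrE// divr_ge0// ltW.
  by rewrite exprMn exprVn -qq (_ : q ^+ 3 = q * (q * q)) //; ring.
have nS : (0 : R) < n.+1%:R by rewrite ltr0Sn.
have nA : cnorm A <= expR (L / n.+1%:R).
  rewrite -[A](subrK B); apply: le_trans (cnormD _ _) _.
  apply: (@le_trans _ _ (expR (M ^+ 2 / n.+1%:R) * (1 + K * M ^+ 3 / n.+1%:R))).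
    rewrite mulrDr mulr1 addrC lerD//; apply: le_trans dAB _.
    have k0 : 0 <= K * M ^+ 3 by rewrite mulr_ge0 ?exprn_ge0.
    apply: (@le_trans _ _ (1 * (K * M ^+ 3 / n.+1%:R))).
      rewrite mul1r ler_wpM2l// lef_pV2 ?posrE ?mulr_gt0//.
      by rewrite ler_peMl// ltW.
    apply: ler_wpM2r; first by rewrite divr_ge0// ltW.
    by apply: le_trans (expR_ge1Dx _); rewrite lerDl divr_ge0 ?exprn_ge0 // ltW.
  by rewrite /L mulrDl expRD ler_wpM2l ?expR_ge0// expR_ge1Dx.
have nB' : cnorm B <= expR (L / n.+1%:R).
  apply: le_trans nB _; rewrite ler_expR ler_pM2r ?invr_gt0// lerDl.
  by rewrite mulr_ge0 ?exprn_ge0.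
have pow k : (k <= n.+1)%N -> expR (L / n.+1%:R) ^+ k <= expR L.
  move=> kn; rewrite -expRM_natl ler_expR mulrCA ler_piMr//.
  by rewrite ler_pdivrMr// mul1r ler_nat.
have -> : A ^+ n * cexp (- x) - B ^+ n * B =
    (A ^+ n - B ^+ n) * cexp (- x) + B ^+ n * (cexp (- x) - B) by ring.
apply: le_trans (cnormD _ _) _; rewrite [leRHS]mulrDl !cnormM; apply: lerD.
  have nx : cnorm (cexp (- x)) <= expR 1.
    by rewrite (le_trans (cnorm_cexp_le _))// ler_expR cnormN.
  rewrite [leRHS](_ : _ = (expR L * K * M ^+ 3 / q) * expR 1); last by ring.
  apply: ler_pM; rewrite ?cnorm_ge0//.
  apply: le_trans (cnorm_subX n nA nB') _.
  apply: (@le_trans _ _ (n%:R * expR L * (K * M ^+ 3 / (q * n.+1%:R)))).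
    apply: ler_pM; rewrite ?cnorm_ge0 ?mulr_ge0 ?exprn_ge0 ?expR_ge0 ?ler0n//.
    rewrite ler_wpM2l ?ler0n// pow// (leq_trans (leq_pred _))//.
  rewrite [leLHS](_ : _ = (expR L * K * M ^+ 3 / q) * (n%:R / n.+1%:R)); last first.
    by field; rewrite nat1r pnatr_eq0 /= gt_eqF.
  apply: ler_piMr.
    by rewrite divr_ge0 ?mulr_ge0 ?expR_ge0 ?exprn_ge0// ltW.
  by rewrite ler_pdivrMr// mul1r ler_nat.
rewrite -mulrA; apply: ler_pM; rewrite ?cnorm_ge0//.
  rewrite cnormX; apply: le_trans (pow n _) => //.
  by rewrite lerXn2r ?nnegrE ?cnorm_ge0 ?expR_ge0.
have -> : cexp (- x) - B = (cexp (- x) - 1) - (B - 1) by ring.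
apply: le_trans (cnormB _ _) _.
have c1 := cexp_sub1 (- x); have c2 := cexp_sub1 (- x ^+ 2 / 2).
rewrite cnormM cnormN cnormV cnormX cnorm_nat in c2; rewrite cnormN in c1.
apply: le_trans (lerD c1 c2) _.
have e1 : expR (cnorm x) <= expR 1 by rewrite ler_expR.
have xx : cnorm x ^+ 2 <= cnorm x by rewrite expr2 ler_piMl.
have e2 : expR (cnorm x ^+ 2 / 2) <= expR 1.
  by rewrite ler_expR; lra.
apply: (@le_trans _ _ (4 * expR 1 * cnorm x)); last first.
  by rewrite -[leRHS]mulrA ler_wpM2l// mulr_ge0// expR_ge0.
have l1 : 2 * cnorm x * expR (cnorm x) <= 2 * cnorm x * expR 1.
  by rewrite ler_wpM2l// mulr_ge0.
have l2 : 2 * (cnorm x ^+ 2 / 2) * expR (cnorm x ^+ 2 / 2) <= 2 * cnorm x * expR 1.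
  by apply: ler_pM; rewrite ?expR_ge0//; have := sqr_ge0 (cnorm x); lra.
lra.
Qed.

Lemma gauss_integral_near (M : R) : 0 <= M -> exists2 C : R, 0 <= C &
  forall n s, M <= Num.sqrt n.+1%:R -> cnorm s <= M ->
  cnorm (segint (fun t => s * gauss_approx n (t%:C * s)) - gaussE s) <=
  C / Num.sqrt n.+1%:R.
Proof.
move=> M0; have [C C0 hC] := gauss_approx_near M0.
exists (2 * (M * C)) => [|n s Mn sM]; first by rewrite !mulr_ge0.
rewrite -mulrA; apply: segint_dist; [exact: cont_gauss_approx|exact: cont_gaussE|].
move=> t /andP[t0 t1]; rewrite -mulrBr cnormM -mulrA.
apply: ler_pM; rewrite ?cnorm_ge0//; apply: hC => //.
rewrite cnormM cnorm_real ger0_norm//; apply: le_trans sM.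
by rewrite ler_piMl ?cnorm_ge0.
Qed.

Lemma gaussE_lip (M : R) : 0 <= M -> exists2 C : R, 0 <= C &
  forall s u, cnorm s <= M -> cnorm u <= M ->
  cnorm (gaussE s - gaussE u) <= C * cnorm (s - u).
Proof.
move=> M0; pose e := expR (3 * M ^+ 2).
exists (2 * (e + M * (2 * e * M))) => [|s u sM uM].
  by rewrite !(mulr_ge0, addr_ge0) ?expR_ge0.
rewrite -mulrA; apply: segint_dist; [exact: cont_gaussE|exact: cont_gaussE|].
move=> t /andP[t0 t1].
have tM v : cnorm v <= M -> cnorm (t%:C * v) <= M.
  move=> vM; rewrite cnormM cnorm_real ger0_norm//; apply: le_trans vM.
  by rewrite ler_piMl ?cnorm_ge0.
have t2 v : cnorm v <= M -> cnorm (- (t%:C * v) ^+ 2 / 2) <= M ^+ 2.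
  move=> /tM vM; rewrite cnormM cnormN cnormV cnormX cnorm_nat.
  have : cnorm (t%:C * v) ^+ 2 <= M ^+ 2 by rewrite lerXn2r ?nnegrE ?cnorm_ge0.
  by have := sqr_ge0 (cnorm (t%:C * v)); lra.
set E1 := cexp _; set E2 := cexp _.
have -> : s * E1 - u * E2 = (s - u) * E1 + u * (E1 - E2) by ring.
apply: le_trans (cnormD _ _) _; rewrite [leRHS]mulrDl !cnormM; apply: lerD.
  rewrite mulrC ler_wpM2r ?cnorm_ge0// (le_trans (cnorm_cexp_le _))// ler_expR.
  by apply: le_trans (t2 _ sM) _; have := sqr_ge0 M; lra.
rewrite -mulrA; apply: ler_pM; rewrite ?cnorm_ge0//.
apply: le_trans (cexp_lip (t2 _ sM) (t2 _ uM)) _.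
rewrite -/e -[leRHS]mulrA ler_wpM2l ?mulr_ge0 ?expR_ge0//.
have -> : - (t%:C * s) ^+ 2 / 2 - - (t%:C * u) ^+ 2 / 2 =
    - ((t%:C * s) ^+ 2 - (t%:C * u) ^+ 2) / 2 by ring.
rewrite cnormM cnormN cnormV cnorm_nat.
have := cnorm_subX 2 (tM _ sM) (tM _ uM).
rewrite -mulrBr cnormM cnorm_real ger0_norm//= expr1 => h.
rewrite ler_pdivrMr//; apply: le_trans h _.
rewrite [leRHS](_ : _ = 2 * M * cnorm (s - u)); last by ring.
by rewrite ler_wpM2l ?mulr_ge0// ler_piMl ?cnorm_ge0.
Qed.

Lemma erf_gaussE s : erf (s / (Num.sqrt 2)%:C) = (Num.sqrt (2 / pi))%:C * gaussE s.
Proof.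
have p0 : 0 < (pi : R) := pi_gt0 R.
have s2 : (Num.sqrt 2 : R) != 0 by rewrite gt_eqF// sqrtr_gt0.
have s22 : (Num.sqrt 2)%:C ^+ 2 = 2 :> R[i].
  by rewrite -real_complexX sqr_sqrtr// real_complex_nat.
rewrite /erf -/(segint _) (_ : segint _ = (Num.sqrt 2)%:C^-1 * gaussE s).
  rewrite mulrA -real_complexV -real_complexM; congr (_%:C * _).
  rewrite sqrtrM// sqrtrV ?ltW//.
  have : Num.sqrt 2 * Num.sqrt 2 = 2 :> R by rewrite -expr2 sqr_sqrtr.
  move: s2; set r := Num.sqrt 2 => r0 <-.
  by field; rewrite r0 gt_eqF// sqrtr_gt0.
rewrite -segintZ; last exact: cont_gaussE.
congr segint; apply/funext => t; rewrite [RHS]mulrA [_^-1 * s]mulrC; congr (_ * cexp _).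
by rewrite mulrA exprMn exprVn s22 mulNr.
Qed.

End TruncatedExponential.

(** * Poisson tails *)

Section PoissonTails.
Context {R : realType}.
Implicit Types (x : R).

Definition poisson_mass x k : R := expR (- x) * (x ^+ k / (k`!)%:R).
Definition poisson_cdf n x : R := \sum_(k < n) poisson_mass x k.

Lemma gammaQ_real n x : gammaQ n x%:C = (poisson_cdf n x)%:C.
Proof.
rewrite /gammaQ /poisson_cdf /poisson_mass -real_complexN cexp_real -mulr_sumr [RHS]real_complexM.
congr (_ * _); rewrite /cexps (rmorph_sum (real_complex R)); apply: eq_bigr => k _ /=.
by rewrite real_complexM real_complexV real_complexX real_complex_nat.
Qed.

Lemma poisson_mass_ge0 x k : 0 <= x -> 0 <= poisson_mass x k.
Proof. by move=> x0; rewrite mulr_ge0 ?expR_ge0// divr_ge0// exprn_ge0. Qed.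

Lemma poisson_massS x k : k.+1%:R * poisson_mass x k.+1 = x * poisson_mass x k.
Proof.
rewrite /poisson_mass factS natrM exprS; field.
by rewrite nat1r !pnatr_eq0 -lt0n fact_gt0.
Qed.

Lemma poisson_cdfS n x : poisson_cdf n.+1 x = poisson_cdf n x + poisson_mass x n.
Proof. by rewrite /poisson_cdf big_ord_recr. Qed.

Lemma poisson_cdf_le x : 0 <= x -> {homo poisson_cdf ^~ x : m n / (m <= n)%N >-> m <= n}.
Proof.
move=> x0; apply: homo_leq => [?|? ? ?|n]; [exact: lexx|exact: le_trans|].
by rewrite poisson_cdfS lerDl poisson_mass_ge0.
Qed.

(** The variance sum is truncated to avoid infinite series: the recursion of the masses telescopes
    it exactly, and the boundary term has a favourable sign once [x <= n]. *)
Lemma poisson_variance n x :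
  \sum_(k < n) (k%:R - x) ^+ 2 * poisson_mass x k =
  x * poisson_cdf n x - (n%:R - x) * (n%:R * poisson_mass x n).
Proof.
elim: n => [|n IH]; first by rewrite big_ord0 /poisson_cdf big_ord0; ring.
rewrite big_ord_recr /= IH poisson_cdfS poisson_massS -natr1; ring.
Qed.

Local Open Scope classical_set_scope.

Lemma poisson_cdf_cvg x : poisson_cdf n x @[n --> \oo] --> (1 : R).
Proof.
have -> : (fun n => poisson_cdf n x) = (fun n => expR (- x) * series (exp_coeff x) n).
  apply/funext => n; rewrite /poisson_cdf /series /= mulr_sumr big_mkord.
  by apply: eq_bigr.
rewrite -(@expRxMexpNx_1 _ x) mulrC.
by apply: cvgM; [exact: cvg_cst|exact: is_cvg_series_exp_coeff].
Qed.

Lemma poisson_cdf_le1 n x : 0 <= x -> poisson_cdf n x <= 1.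
Proof.
move=> x0; rewrite -(cvg_lim _ (poisson_cdf_cvg x))//.
apply: limr_ge; first by apply/cvg_ex; exists 1; exact: poisson_cdf_cvg.
by exists n => // m /= nm; exact: poisson_cdf_le.
Qed.

Lemma poisson_mass_le1 x k : 0 <= x -> poisson_mass x k <= 1.
Proof.
move=> x0; apply: le_trans (poisson_cdf_le1 k.+1 x0); rewrite poisson_cdfS lerDr.
by rewrite sumr_ge0// => i _; exact: poisson_mass_ge0.
Qed.

Lemma poisson_variance_le n x : 0 <= x -> x <= n%:R ->
  \sum_(k < n) (k%:R - x) ^+ 2 * poisson_mass x k <= x.
Proof.
move=> x0 xn; rewrite poisson_variance.
have := poisson_cdf_le1 n x0; have := poisson_mass_ge0 n x0 => m0 c1.
have h : 0 <= (n%:R - x) * (n%:R * poisson_mass x n).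
  apply: mulr_ge0; rewrite ?subr_ge0//; exact: mulr_ge0.
have : x * poisson_cdf n x <= x by rewrite ler_piMr.
lra.
Qed.

Lemma poisson_lower_tail n x : n%:R <= x ->
  (x - n%:R) ^+ 2 * poisson_cdf n x <= x.
Proof.
move=> nx; have x0 : 0 <= x by rewrite (le_trans _ nx).
(* The variance bound requires a truncation beyond the mean [x], so the sum is first extended from
   [n] to [m]. *)
pose m := (Num.truncn x).+1.
have xm : x <= m%:R by rewrite ltW// truncnS_gt.
have nm : (n <= m)%N by rewrite -(ler_nat R) (le_trans nx).
apply: le_trans (poisson_variance_le x0 xm).
rewrite -(subnKC nm) big_split_ord /=.
apply: (@le_trans _ _ (\sum_(k < n) (k%:R - x) ^+ 2 * poisson_mass x k)); last first.
  rewrite lerDl sumr_ge0// => k _.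
  by rewrite mulr_ge0 ?sqr_ge0 ?poisson_mass_ge0.
rewrite /poisson_cdf mulr_sumr; apply: ler_sum => k _.
have kn : k%:R <= n%:R :> R by rewrite ler_nat ltnW.
rewrite ler_wpM2r ?poisson_mass_ge0// -[leRHS]sqrrN opprB.
rewrite lerXn2r ?nnegrE ?subr_ge0 ?(le_trans kn)//.
by rewrite lerB.
Qed.

(** Chebyshev on the finite window from [n] to [m], then [m] tends to infinity. *)
Lemma poisson_upper_tail n x : 0 <= x -> x <= n%:R ->
  (n%:R - x) ^+ 2 * (1 - poisson_cdf n x) <= x.
Proof.
move=> x0 xn.
have h m : (n <= m)%N -> (n%:R - x) ^+ 2 * (poisson_cdf m x - poisson_cdf n x) <= x.
  move=> nm.
  have xm : x <= m%:R by rewrite (le_trans xn)// ler_nat.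
  apply: le_trans (poisson_variance_le x0 xm).
  rewrite /poisson_cdf -(subnKC nm) !big_split_ord /= addrAC subrr add0r.
  apply: (@le_trans _ _ (\sum_(k < m - n) ((n + k)%:R - x) ^+ 2 * poisson_mass x (n + k))).
    rewrite mulr_sumr; apply: ler_sum => k _.
    rewrite ler_wpM2r ?poisson_mass_ge0// lerXn2r ?nnegrE ?subr_ge0//.
      by rewrite natrD (le_trans xn)// lerDl.
    by rewrite natrD lerD2r lerDl.
  rewrite lerDr sumr_ge0// => k _.
  by rewrite mulr_ge0 ?sqr_ge0 ?poisson_mass_ge0.
have c : (n%:R - x) ^+ 2 * (poisson_cdf m x - poisson_cdf n x) @[m --> \oo] -->
    (n%:R - x) ^+ 2 * (1 - poisson_cdf n x).
  by apply: cvgM; [exact: cvg_cst|apply: cvgB; [exact: poisson_cdf_cvg|exact: cvg_cst]].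
rewrite -(cvg_lim _ c)//; apply: limr_le; first by apply/cvg_ex; eexists; exact: c.
by exists n => // m /= nm; exact: h.
Qed.

End PoissonTails.

(** * The Gaussian integral on long segments *)

Section GaussianSegments.
Context {R : realType}.
Local Open Scope classical_set_scope.
Let mu := @lebesgue_measure R.

Lemma gaussEN (s : R[i]) : gaussE (- s) = - gaussE s.
Proof.
rewrite -[RHS]mulN1r -segintZ; last exact: cont_gaussE.
by congr segint; apply/funext => t; rewrite mulrN sqrrN mulrA mulN1r.
Qed.

Lemma gaussE_real (T : R) : 0 < T -> gaussE T%:C =
  (Num.sqrt 2 * gauss_integral_proof.integral0_gauss (T / Num.sqrt 2))%:C.
Proof.
move=> T0; have s2 : 0 < Num.sqrt 2 :> R by rewrite sqrtr_gt0.
have s22 : Num.sqrt 2 ^+ 2 = 2 :> R by rewrite sqr_sqrtr.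
pose c := T / Num.sqrt 2; have c0 : 0 < c by rewrite divr_gt0.
have E t : T%:C * cexp (- (t%:C * T%:C) ^+ 2 / 2) =
    (Num.sqrt 2 * (gauss_fun (t * c) * c))%:C.
  rewrite (_ : - (t%:C * T%:C) ^+ 2 / 2 = (- (t * c) ^+ 2)%:C); last first.
    rewrite /c mulrA expr_div_n s22 real_complexN mulNr; congr (- _).
    by rewrite real_complexM real_complexV real_complexX real_complexM real_complex_nat.
  rewrite cexp_real -real_complexM; congr (_%:C); rewrite /gauss_fun /c.
  by field; rewrite gt_eqF.
have I : (\int[mu]_(t in `[0, 1]) (gauss_fun (t * c) * c))%R =
    gauss_integral_proof.integral0_gauss c.
  rewrite /gauss_integral_proof.integral0_gauss /Rintegral.
  pose F (t : R) := t * c.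
  have dF (t : R) : is_derive t 1 F c.
    by apply: is_derive_eq; rewrite /GRing.scale /= mulr1 mulr0 add0r.
  have dF' : F^`() = cst c.
    by apply/funext => t; rewrite derive1E; have [_ ->] := dF t.
  have cF : continuous F.
    by move=> t; apply/differentiable_continuous/derivable1_diffP; have [] := dF t.
  have F0 : F 0 = 0 by rewrite /F mul0r.
  have F1 : F 1 = c by rewrite /F mul1r.
  transitivity (fine (\int[mu]_(x in `[F 0%R, F 1%R]) (gauss_fun x)%:E)%E); last by rewrite F0 F1.
  rewrite (@integration_by_substitution_increasing R F gauss_fun 0 1 ler01).
  - by rewrite dF'.
  - by move=> x y _ _ xy; rewrite ltr_pM2r.
  - by rewrite dF' => x _; exact: cst_continuous.
  - by rewrite dF'; exact: is_cvg_cst.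
  - by rewrite dF'; exact: is_cvg_cst.
  - split; first by move=> x _; have [] := dF x.
    + exact/cvg_at_right_filter/cF.
    + exact/cvg_at_left_filter/cF.
  - apply: continuous_subspaceT; exact: continuous_gauss_fun.
have ig : mu.-integrable `[0, 1] (EFin \o (fun t => gauss_fun (t * c) * c)).
  apply: continuous_integrable01 => t; apply: cvgM; last exact: cvg_cst.
  apply: (@continuous_comp _ _ _ (fun t : R => t * c) gauss_fun).
    by apply: cvgM; [exact: cvg_id|exact: cvg_cst].
  exact: continuous_gauss_fun.
rewrite -/c -I -RintegralZl//.
rewrite /gaussE /segint /cRint.
under eq_Rintegral do rewrite E /=.
under [X in _ +i* X]eq_Rintegral do rewrite E /=.
by rewrite Rintegral_cst// mul0r.
Qed.

(** The known limit is that of the square of the Gaussian integral, namely [pi / 4]. The square is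
    removed by factoring a difference of squares whose second factor is at least [sqrt pi / 2]. *)
Lemma gaussE_near_limit (eps : R) : 0 < eps -> exists2 T0 : R, 0 < T0 &
  forall T, T0 <= T -> cnorm (gaussE T%:C - (Num.sqrt (pi / 2))%:C) <= eps.
Proof.
move=> e0; have p0 := pi_gt0 R; have s2 : 0 < Num.sqrt 2 :> R by rewrite sqrtr_gt0.
set sp : R := Num.sqrt pi; have sp0 : 0 < sp by rewrite sqrtr_gt0.
have spp : sp * sp = pi by rewrite -expr2 sqr_sqrtr// ltW.
pose d := eps / Num.sqrt 2 * (sp / 2); have d0 : 0 < d by rewrite mulr_gt0 ?divr_gt0.
have /cvgrPdist_le/(_ _ d0) [B [_ hB]] := @gauss_integral_proof.cvg_integral0_gauss_sqr R.
exists ((`|B| + 1) * Num.sqrt 2) => [|T TT]; first by rewrite mulr_gt0// ltr_wpDl.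
have T0 : 0 < T by rewrite (lt_le_trans _ TT)// mulr_gt0// ltr_wpDl.
have BT : B < T / Num.sqrt 2.
  rewrite (lt_le_trans _ (_ : `|B| + 1 <= _))// ?ler_pdivlMr//.
  by rewrite (le_lt_trans (ler_norm _))// ltrDl.
have := hB _ BT; rewrite gaussE_real//=.
set I := gauss_integral_proof.integral0_gauss _.
have I0 : 0 <= I by exact: gauss_integral_proof.integral0_gauss_ge0.
have -> : pi / 4 - I ^+ 2 = (sp / 2 - I) * (sp / 2 + I) by rewrite -spp; field.
rewrite normrM [X in _ * X]ger0_norm ?addr_ge0 ?divr_ge0 ?(ltW sp0)// => h.
have {}h : `|sp / 2 - I| <= eps / Num.sqrt 2.
  rewrite -(@ler_pM2r _ (sp / 2)) ?divr_gt0//; apply: le_trans h.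
  by rewrite ler_wpM2l// lerDl.
rewrite -real_complexB cnorm_real.
have -> : Num.sqrt (pi / 2) = Num.sqrt 2 * (sp / 2) :> R.
  rewrite sqrtrM ?ltW// -/sp sqrtrV//.
  have : Num.sqrt 2 * Num.sqrt 2 = 2 :> R by rewrite -expr2 sqr_sqrtr.
  move: s2; set r := Num.sqrt 2 => r0 <-.
  by field; rewrite gt_eqF.
rewrite -mulrBr normrM gtr0_norm// distrC mulrC -ler_pdivlMr//.
Qed.

End GaussianSegments.

(** * Convergence of the normalised incomplete gamma function *)

Section IncompleteGamma.
Context {R : realType}.
Implicit Types (s : R[i]) (eps M : R).

Lemma sqrtS_ge_near (B : R) : exists n0 : nat, forall n, (n0 <= n)%N ->
  B <= Num.sqrt (n.+1%:R : R).
Proof.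
exists (Num.truncn (B ^+ 2)) => n nn.
apply: le_trans (ler_norm B) _; rewrite -sqrtr_sqr ler_sqrt//.
by apply/ltW/(lt_le_trans (truncnS_gt _)); rewrite ler_nat.
Qed.

(* Chebyshev at [n + 1 -+ T sqrt (n + 1)] makes the Poisson distribution
   function run from nearly [1] to nearly [0]; by [gammaQ_segint] and oddness of
   [gaussE], this forces both Stirling's constant and the median. *)
Lemma stirling_median eps : 0 < eps -> exists n0 : nat, forall n, (n0 <= n)%N ->
  `|stirlingA n * (2 * Num.sqrt (pi / 2)) - 1| <= eps /\
  `|poisson_cdf n.+1 (n.+1%:R : R) - 2^-1| <= eps.
Proof.
move=> eps0; set I : R := Num.sqrt (pi / 2).
have I1 : 1 <= I by rewrite -[1]sqrtr1 ler_sqrt ?pihalf_ge1// (le_trans ler01) ?pihalf_ge1.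
pose d := Num.min (eps / 8) (8^-1); have d0 : 0 < d by rewrite lt_min divr_gt0//= invr_gt0.
have d8 : d <= 8^-1 by rewrite ge_min lexx orbT.
have de : d <= eps / 8 by rewrite ge_min lexx.
have [T0 T00 hT] := @gaussE_near_limit R d d0.
(* [T0] brings [gaussE T] within [d] of [I]; [2 / d] makes the Chebyshev bound [2 / T ^ 2] at most
   [d]. *)
pose T := Num.max T0 (2 / d).
have T0T : T0 <= T by rewrite le_max lexx.
have dT : 2 / d <= T by rewrite le_max lexx orbT.
have Tp : 0 < T := lt_le_trans T00 T0T.
have T2 : 2 / T ^+ 2 <= d.
  have T1 : 1 <= T by apply: le_trans dT; rewrite ler_pdivlMr// mul1r; lra.
  rewrite ler_pdivrMr ?exprn_gt0// expr2 mulrA.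
  rewrite ler_pdivrMr// in dT; rewrite [d * T]mulrC.
  by apply: (le_trans dT); rewrite ler_peMr// mulr_ge0// ltW.
have [C C0 hC] := @gauss_integral_near R T (ltW Tp).
have [n0 hn0] := sqrtS_ge_near (Num.max T (C / d)).
exists n0 => n nn; have := hn0 n nn; set q : R := Num.sqrt n.+1%:R.
rewrite ge_max => /andP[Tq Cq]; have q0 : 0 < q := sqrtS_gt0 n.
have qq : q * q = n.+1%:R := sqr_sqrtS n.
have Cq' : C / q <= d by rewrite ler_pdivrMr// mulrC -ler_pdivrMr.
set A := stirlingA n; have A0 : 0 <= A.
  by rewrite divr_ge0 ?mulr_ge0 ?expR_ge0 ?exprn_ge0 ?sqrtr_ge0.
set h := poisson_cdf n.+1 n.+1%:R.
pose D (s : R[i]) := segint (fun t => s * gauss_approx n (t%:C * s)).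
have nT : cnorm (T%:C : R[i]) <= T by rewrite cnorm_real gtr0_norm.
have nT' : cnorm (- T%:C : R[i]) <= T by rewrite cnormN.
have D1 : `|Re (D T%:C) - I| <= 2 * d.
  have h1 := hC n _ Tq nT; have h2 := hT T T0T.
  rewrite (_ : _ - I = Re (D T%:C - gaussE T%:C) + Re (gaussE T%:C - I%:C)); last by rewrite !ReB /=; ring.
  apply: le_trans (ler_normD _ _) _; rewrite mulrDl mul1r; apply: lerD; apply: le_trans (norm_Re_le _) _ => //.
  exact: le_trans h1 Cq'.
have D2 : `|Re (D (- T%:C)) + I| <= 2 * d.
  have h1 := hC n _ Tq nT'; have h2 := hT T T0T.
  rewrite (_ : _ + I = Re (D (- T%:C) - gaussE (- T%:C)) - Re (gaussE T%:C - I%:C)); last by rewrite gaussEN !ReB ReN /=; ring.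
  apply: le_trans (ler_normB _ _) _; rewrite mulrDl mul1r; apply: lerD; apply: le_trans (norm_Re_le _) _ => //.
  exact: le_trans h1 Cq'.
have G x : poisson_cdf n.+1 (n.+1%:R + q * x) = h - A * Re (D x%:C).
  have := gammaQ_segint n x%:C; rewrite -/q -/A -/(D _) -{1 2}real_complex_nat.
  rewrite -real_complexM -real_complexD !gammaQ_real => /(congr1 (@complex.Re R)).
  by rewrite ReB ReZ.
have qT0 : 0 <= (q * T) ^+ 2 by rewrite sqr_ge0.
have qTp : 0 < (q * T) ^+ 2 by rewrite exprn_gt0// mulr_gt0.
have qTn : q * T <= n.+1%:R by rewrite -qq ler_wpM2l// ltW.
have qT00 : 0 <= q * T by rewrite mulr_ge0 ?ltW.
have bnd x : (q * T) ^+ 2 * x <= 2 * n.+1%:R -> x <= d.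
  move=> hx; apply: le_trans T2; rewrite -(ler_pM2l qTp); apply: (le_trans hx).
  by rewrite exprMn expr2 qq -mulrA [T ^+ 2 * _]mulrC divfK ?expf_neq0 ?gt_eqF// mulrC.
have F1 : poisson_cdf n.+1 (n.+1%:R + q * T) <= d.
  apply: bnd; have := @poisson_lower_tail R n.+1 (n.+1%:R + q * T).
  rewrite lerDl qT00 => /(_ isT); rewrite addrAC subrr add0r => hl.
  by apply: (le_trans hl); lra.
have F2 : 1 - poisson_cdf n.+1 (n.+1%:R + q * (- T)) <= d.
  apply: bnd; have := @poisson_upper_tail R n.+1 (n.+1%:R + q * (- T)).
  rewrite mulrN subr_ge0 qTn gerDl oppr_le0 qT00 => /(_ isT isT).
  rewrite opprD addrA subrr add0r opprK => hl.
  by apply: (le_trans hl); have : (0 : R) <= n.+1%:R by []; lra.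
have F1' : 0 <= poisson_cdf n.+1 (n.+1%:R + q * T).
  by rewrite sumr_ge0// => k _; rewrite poisson_mass_ge0// addr_ge0.
have F2' : poisson_cdf n.+1 (n.+1%:R + q * (- T)) <= 1.
  by rewrite poisson_cdf_le1// mulrN subr_ge0.
rewrite !G real_complexN in F1 F2 F1' F2'.
move: D1 D2 F1 F2 F1' F2'; set x := Re _; set y := Re (D _).
rewrite !ler_norml => /andP[x1 x2] /andP[y1 y2] F1 F2 F1' F2'.
(* What is left is linear: [x] is near [I], [y] near [- I], [h - A x] lies in [[0, d]] and [h - A y]
   in [[1 - d, 1]]. The difference yields [2 A I], the sum yields [2 h]. First [A <= 1], because
   [d <= 1/8] keeps [x - y] above 1; this controls the errors multiplied by [A]. *)
clearbody x y h A d I; clear -I1 d0 d8 de A0 x1 x2 y1 y2 F1 F2 F1' F2'.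
have A1 : A <= 1.
  have : A * (x - y) <= 1 by lra.
  have : A * 1 <= A * (x - y) by rewrite ler_wpM2l//; lra.
  lra.
have Ax1 : A * (- (2 * d)) <= A * (x - I) by rewrite ler_wpM2l.
have Ax2 : A * (x - I) <= A * (2 * d) by rewrite ler_wpM2l.
have Ay1 : A * (- (2 * d)) <= A * (y + I) by rewrite ler_wpM2l.
have Ay2 : A * (y + I) <= A * (2 * d) by rewrite ler_wpM2l.
have Ad : A * (2 * d) <= 2 * d by rewrite ler_piMl// mulr_ge0// ltW.
rewrite mulrN in Ax1 Ay1.
rewrite mulrBr in Ax1 Ax2; rewrite mulrDr in Ay1 Ay2.
have -> : A * (2 * I) = 2 * (A * I) by ring.
by split; apply/andP; split; lra.
Qed.

Lemma gaussE0 : gaussE 0 = 0 :> R[i].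
Proof.
have c0 : ccont (fun=> 0 : R[i]) by split; exact: cst_continuous.
rewrite -[RHS](mul0r (segint (fun=> 0))) -(segintZ _ c0).
by congr segint; apply/funext => t; rewrite !mul0r.
Qed.

Lemma gammaQ_erfc M eps : 0 <= M -> 0 < eps -> exists n0 : nat, forall n s,
  (n0 <= n)%N -> cnorm s <= M ->
  cnorm (gammaQ n (n%:R + (Num.sqrt n%:R)%:C * s) -
         erfc (s / (Num.sqrt 2)%:C) / 2) <= eps.
Proof.
move=> M0 eps0; set I : R := Num.sqrt (pi / 2).
have I1 : 1 <= I by rewrite -[1]sqrtr1 ler_sqrt ?pihalf_ge1// (le_trans ler01) ?pihalf_ge1.
have [L L0 hL] := gaussE_lip M0; have [C C0 hC] := gauss_integral_near M0.
pose K := L * M + C + 1; have K0 : 0 < K by rewrite ltr_wpDl// addr_ge0// mulr_ge0.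
have K1 : 1 <= K by rewrite lerDr addr_ge0// mulr_ge0.
pose d := eps / (3 * K); have d0 : 0 < d by rewrite divr_gt0// mulr_gt0.
have [n1 h1] := stirling_median d0.
have [n2 h2] := sqrtS_ge_near (Num.max (Num.max M 1) (C / d)).
exists (maxn n1 n2).+1 => -[//|n] s; rewrite ltnS geq_max => /andP[/h1 [hA hh] /h2].
rewrite !ge_max -andbA; set q : R := Num.sqrt _ => /and3P[Mq q1 Cq] sM.
have q0 : 0 < q := sqrtS_gt0 n.
have Cq' : C / q <= d by rewrite ler_pdivrMr// mulrC -ler_pdivrMr.
rewrite gammaQ_segint -(real_complex_nat n.+1) gammaQ_real /erfc erf_gaussE.
set A := stirlingA n in hA *; set h := poisson_cdf _ _ in hh *.
set D := segint _; have hD : cnorm (D - gaussE s) <= C / q by exact: hC.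
have hE : cnorm (gaussE s) <= L * M.
  have := hL s 0 sM; rewrite cnorm0 gaussE0 !subr0 => /(_ M0) hE.
  by apply: (le_trans hE); rewrite ler_wpM2l.
have -> : Num.sqrt (2 / pi) = I^-1 :> R by rewrite -sqrtrV ?divr_ge0 ?pi_ge0// invf_div.
have I0 : I != 0 by rewrite gt_eqF// (lt_le_trans ltr01).
(* The three errors are those of the median, of Stirling's constant and of the integrand; each is at
   most [d * K]. *)
have -> : h%:C - A%:C * D - (1 - I^-1%:C * gaussE s) / 2 =
    (h - 2^-1)%:C - ((A * (2 * I) - 1) / (2 * I))%:C * D - ((2 * I)^-1)%:C * (D - gaussE s).
  rewrite real_complexB !(real_complexM, real_complexV, real_complexB, real_complex_nat).
  by field; rewrite real_complex_neq0// factC_neq0.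
have DK : cnorm D <= K.
  rewrite -(subrK (gaussE s) D); apply: le_trans (cnormD _ _) _.
  have : C / q <= C by rewrite ler_pdivrMr// ler_peMr.
  rewrite /K; lra.
apply: le_trans (cnormB _ _) _; apply: le_trans (lerD (cnormB _ _) (lexx _)) _.
rewrite !cnormM !cnorm_real.
have ii : `|(2 * I)^-1| <= 1 by rewrite ger0_norm ?invr_ge0 ?invf_le1; lra.
have -> : eps = d * K + d * K + d * K by rewrite /d; field; rewrite gt_eqF.
apply: lerD; first apply: lerD.
- by apply: (le_trans hh); rewrite ler_peMr// ltW.
- apply: ler_pM; rewrite ?cnorm_ge0// normrM -[leRHS]mulr1.
  by apply: ler_pM.
- rewrite mulrC; apply: ler_pM; rewrite ?cnorm_ge0//; last exact: le_trans K1.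
  exact: le_trans hD Cq'.
Qed.

End IncompleteGamma.

(** * Gaussian moments *)

Section GaussianLine.
Context {R : realType}.
Local Open Scope classical_set_scope.
Let mu := @lebesgue_measure R.

Lemma measurable_gaussian (b : R) : measurable_fun setT (fun x : R => expR (- (b * x ^+ 2))).
Proof.
apply: measurableT_comp => //; apply: measurableT_comp => //.
by apply: measurable_funM => //; exact: measurable_funX.
Qed.

(** Read off from the total mass of the normal density of variance [1 / (2 b)]. *)
Lemma gaussian_integral (b : R) : 0 < b ->
  (\int[mu]_x (expR (- (b * x ^+ 2)))%:E)%E = (Num.sqrt (pi / b))%:E.
Proof.
move=> b0; pose s := Num.sqrt (2 * b)^-1.
have b2 : 0 < 2 * b by rewrite mulr_gt0.
have s0 : s != 0 by rewrite gt_eqF// sqrtr_gt0 invr_gt0.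
have ss : s ^+ 2 = (2 * b)^-1 by rewrite sqr_sqrtr// invr_ge0 ltW.
have p0 := pi_gt0 R.
have q0 : 0 < Num.sqrt (pi / b) by rewrite sqrtr_gt0 divr_gt0.
have := @integral_normal_pdf R 0 s.
have -> : (fun x => (normal_pdf 0 s x)%:E) =
    (fun x => ((Num.sqrt (pi / b))^-1)%:E * (expR (- (b * x ^+ 2)))%:E)%E.
  apply/funext => x; rewrite normal_pdfE// /normal_peak /normal_fun subr0 ss -EFinM.
  congr (((Num.sqrt _)^-1 * expR _)%:E); rewrite -mulr_natr; field; exact: lt0r_neq0.
rewrite ge0_integralZl//.
- by move=> h; rewrite -[LHS]mul1e -(divff (lt0r_neq0 q0)) EFinM -muleA h mule1.
- by apply/measurable_EFinP; exact: measurable_gaussian.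
Qed.

Lemma integrable_gaussian (b : R) : 0 < b ->
  mu.-integrable setT (fun x => (expR (- (b * x ^+ 2)))%:E).
Proof.
move=> b0; apply/integrableP; split.
  by apply/measurable_EFinP; exact: measurable_gaussian.
under eq_integral do rewrite gee0_abs ?lee_fin ?expR_ge0//.
by rewrite gaussian_integral// ltry.
Qed.

(** Integration by parts on the line: the boundary values on growing intervals vanish by the decay
    of [F], and the decay of [f] dominates the truncated integrals. *)
Lemma integral_derivative0 (F f : R -> R) (b C : R) : 0 < b ->
  (forall t : R, is_derive t 1 F (f t)) -> continuous f ->
  (forall t, `|f t| <= C * expR (- (b * t ^+ 2))) ->
  (forall t, `|F t| <= C * expR (- (b * t ^+ 2))) ->
  (\int[mu]_t (f t)%:E = 0)%E.
Proof.
move=> b0 dF cf fC FC.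
have cF : continuous F.
  by move=> t; apply/differentiable_continuous/derivable1_diffP; have [] := dF t.
have C0 : 0 <= C.
  have := le_trans (normr_ge0 _) (FC 0).
  by rewrite pmulr_lge0// expR_gt0.
have mf : measurable_fun setT f by exact: continuous_measurable_fun.
pose fn (n : nat) := (EFin \o f) \_ `[- n.+1%:R, n.+1%:R].
have FTC n : (\int[mu]_t fn n t)%E = (F n.+1%:R - F (- n.+1%:R))%:E.
  rewrite /fn -integral_mkcond (@continuous_FTC2 R f F)//.
  - by rewrite (@lt_trans _ _ 0) ?oppr_lt0 ?ltr0Sn.
  - exact: continuous_subspaceT.
  - split; first by move=> x _; have [] := dF x.
    + exact/cvg_at_right_filter/cF.
    + exact/cvg_at_left_filter/cF.
  - by move=> x _; rewrite derive1E; have [_ ->] := dF x.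
have lim1 : (\int[mu]_t fn n t)%E @[n --> \oo] --> (\int[mu]_t (f t)%:E)%E.
  apply: (@dominated_cvg _ _ _ mu setT measurableT fn (EFin \o f)
    (fun t => (C * expR (- (b * t ^+ 2)))%:E)).
  - move=> n; apply/(measurable_restrictT _ _).1 => //.
    by apply/measurable_EFinP; exact: measurable_funTS.
  - move=> t _; apply: cvg_near_cst; exists (Num.truncn `|t|) => // n /= nn.
    rewrite /fn patchE mem_set//= in_itv /= -ler_norml.
    by rewrite ltW// (lt_le_trans (truncnS_gt _))// ler_nat.
  - by [].
  - by under eq_fun do rewrite EFinM; apply: integrableZl => //; exact: integrable_gaussian.
  - move=> n t _; rewrite /fn patchE; case: ifP => _; first by rewrite /= lee_fin.
    by rewrite abse0 lee_fin mulr_ge0 ?expR_ge0.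
have lim2 : (\int[mu]_t fn n t)%E @[n --> \oo] --> (0 : \bar R)%E.
  rewrite (funext FTC); apply: cvg_EFin; first by near=> n.
  apply/cvgrPdist_le => e e0; rewrite /= .
  exists (Num.truncn (2 * C / (e * b))) => // n /= nn; rewrite sub0r normrN.
  have n0 : (0 : R) < n.+1%:R by [].
  have h : C * expR (- (b * n.+1%:R ^+ 2)) <= e / 2.
    rewrite expRN ler_pdivrMr ?expR_gt0//.
    have e1 : b * n.+1%:R <= expR (b * n.+1%:R ^+ 2).
      apply: le_trans (expR_ge1Dx _); rewrite expr2 mulrA.
      apply: (@le_trans _ _ (b * n.+1%:R * n.+1%:R)); last by rewrite lerDr.
      by apply: ler_peMr; [rewrite mulr_ge0// ltW|rewrite ler1n].
    have e2 : 2 * C / (e * b) <= n.+1%:R.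
      by rewrite ltW// (lt_le_trans (truncnS_gt _))// ler_nat.
    apply: (@le_trans _ _ (e / 2 * (b * n.+1%:R))); last by rewrite ler_wpM2l// divr_ge0 ?ltW.
    move: e2; rewrite ler_pdivrMr ?mulr_gt0//; nra.
  apply: le_trans (ler_normB _ _) _; rewrite [leRHS]splitr; apply: lerD.
    exact: le_trans (FC _) h.
  by apply: le_trans (FC _) _; rewrite sqrrN.
exact: (cvg_unique _ lim1 lim2).
Unshelve. all: end_near. Qed.

End GaussianLine.

(** * Integration of complex functions over the plane *)

Section PlaneIntegral.
Context {R : realType}.
Local Open Scope classical_set_scope.
Implicit Types (f g : R[i] -> R[i]) (h : R[i] -> R).

Definition plane_integrable h : Prop :=
  (@leb2 R).-integrable setT (EFin \o (fun xy => h (cplx xy))).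

Definition plane_meas h : Prop := measurable_fun setT (fun xy : R * R => h (cplx xy)).

Lemma le_plane_integrable h1 h2 : plane_meas h1 -> (forall z, `|h1 z| <= h2 z) ->
  plane_integrable h2 -> plane_integrable h1.
Proof.
move=> m1 h12; apply: le_integrable => //; first exact/measurable_EFinP.
by move=> x _; rewrite /= lee_fin (le_trans (h12 _))// ler_norm.
Qed.

Lemma plane_integrableD h1 h2 : plane_integrable h1 -> plane_integrable h2 ->
  plane_integrable (fun z => h1 z + h2 z).
Proof. by move=> i1 i2; exact: (integrableD measurableT i1 i2). Qed.

Lemma plane_integrableZ (k : R) h : plane_integrable h ->
  plane_integrable (fun z => k * h z).
Proof. by move=> i1; exact: (integrableZl measurableT k i1). Qed.

Definition plane_integral h : R := Rintegral (@leb2 R) setT (fun xy => h (cplx xy)) / pi.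

Lemma plane_integralD h1 h2 : plane_integrable h1 -> plane_integrable h2 ->
  plane_integral (fun z => h1 z + h2 z) = plane_integral h1 + plane_integral h2.
Proof. by move=> i1 i2; rewrite /plane_integral RintegralD// mulrDl. Qed.

Lemma plane_integralZ (k : R) h : plane_integrable h ->
  plane_integral (fun z => k * h z) = k * plane_integral h.
Proof. by move=> i1; rewrite /plane_integral RintegralZl// mulrA. Qed.

Lemma le_plane_integral h1 h2 : plane_integrable h1 -> plane_integrable h2 ->
  (forall z, h1 z <= h2 z) -> plane_integral h1 <= plane_integral h2.
Proof.
move=> i1 i2 h12; rewrite ler_pM2r ?invr_gt0 ?pi_gt0//.
by apply: le_Rintegral => // x _; exact: h12.
Qed.

Lemma plane_integral_ge0 h : (forall z, 0 <= h z) -> 0 <= plane_integral h.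
Proof.
by move=> h0; rewrite divr_ge0 ?pi_ge0// Rintegral_ge0.
Qed.

Definition cplane_integrable f : Prop :=
  plane_integrable (fun z => Re (f z)) /\ plane_integrable (fun z => Im (f z)).

Definition cplane_meas f : Prop :=
  plane_meas (fun z => Re (f z)) /\ plane_meas (fun z => Im (f z)).

Lemma intdAE f : intdA f =
  plane_integral (fun z => Re (f z)) +i* plane_integral (fun z => Im (f z)).
Proof.
rewrite /intdA /cRint -real_complexV mulrC.
by apply: complex_ext; rewrite ?ReZ ?ImZ /= mulrC.
Qed.

Lemma intdAD f g : cplane_integrable f -> cplane_integrable g ->
  intdA (fun z => f z + g z) = intdA f + intdA g.
Proof.
move=> [f1 f2] [g1 g2]; rewrite !intdAE; apply: complex_ext => /=.
- by rewrite -plane_integralD//; congr plane_integral; apply/funext => z; rewrite ReD.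
- by rewrite -plane_integralD//; congr plane_integral; apply/funext => z; rewrite ImD.
Qed.

Lemma cplane_integrableD f g : cplane_integrable f -> cplane_integrable g ->
  cplane_integrable (fun z => f z + g z).
Proof.
move=> [f1 f2] [g1 g2]; split.
- by under eq_fun do rewrite ReD; exact: plane_integrableD.
- by under eq_fun do rewrite ImD; exact: plane_integrableD.
Qed.

Lemma cplane_integrableZ (k : R[i]) f : cplane_integrable f ->
  cplane_integrable (fun z => k * f z).
Proof.
move=> [f1 f2]; split.
- under eq_fun do rewrite ReM -mulNr.
  by apply: plane_integrableD; exact: plane_integrableZ.
- under eq_fun do rewrite ImM.
  by apply: plane_integrableD; exact: plane_integrableZ.
Qed.

Lemma intdAZ (k : R[i]) f : cplane_integrable f ->
  intdA (fun z => k * f z) = k * intdA f.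
Proof.
move=> [f1 f2]; rewrite !intdAE; apply: complex_ext; rewrite ?ReM ?ImM /=.
- under eq_fun do rewrite ReM -mulNr.
  by rewrite plane_integralD ?plane_integralZ ?mulNr//; exact: plane_integrableZ.
- under eq_fun do rewrite ImM.
  by rewrite plane_integralD ?plane_integralZ//; exact: plane_integrableZ.
Qed.

Lemma intdA_real h : intdA (fun z => (h z)%:C) = (plane_integral h)%:C.
Proof.
rewrite intdAE /=; congr (_ +i* _).
by rewrite /plane_integral Rintegral_cst// mul0r mul0r.
Qed.

Lemma cplane_measD f g : cplane_meas f -> cplane_meas g ->
  cplane_meas (fun z => f z + g z).
Proof.
move=> [f1 f2] [g1 g2]; split; rewrite /plane_meas.
- by under eq_fun do rewrite ReD; exact: measurable_funD.
- by under eq_fun do rewrite ImD; exact: measurable_funD.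
Qed.

Lemma cplane_measM f g : cplane_meas f -> cplane_meas g ->
  cplane_meas (fun z => f z * g z).
Proof.
move=> [f1 f2] [g1 g2]; split; rewrite /plane_meas.
- under eq_fun do rewrite ReM.
  by apply: measurable_funB; exact: measurable_funM.
- under eq_fun do rewrite ImM.
  by apply: measurable_funD; exact: measurable_funM.
Qed.

Lemma cplane_meas_cst (k : R[i]) : cplane_meas (fun=> k).
Proof. by split; exact: measurable_cst. Qed.

Lemma cplane_meas_id : cplane_meas id.
Proof. by split; [exact: measurable_fst | exact: measurable_snd]. Qed.

Lemma cplane_meas_conj f : cplane_meas f -> cplane_meas (fun z => conjc (f z)).
Proof.
move=> [f1 f2]; split; rewrite /plane_meas.
- by under eq_fun do rewrite Re_conj.
- by under eq_fun do rewrite Im_conj; exact: measurable_funN.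
Qed.

Lemma cplane_meas_real h : plane_meas h -> cplane_meas (fun z => (h z)%:C).
Proof. by move=> mh; split => //; exact: measurable_cst. Qed.

Lemma cplane_measX f n : cplane_meas f -> cplane_meas (fun z => f z ^+ n).
Proof.
move=> mf; elim: n => [|n IH].
  by under eq_fun do rewrite expr0; exact: cplane_meas_cst.
by under eq_fun do rewrite exprS; exact: cplane_measM.
Qed.

Lemma cplane_meas_poly (q : {poly R[i]}) : cplane_meas (fun z => q.[z]).
Proof.
elim/poly_ind: q => [|q k IH].
  by under eq_fun do rewrite horner0; exact: cplane_meas_cst.
under eq_fun do rewrite hornerMXaddC.
by apply: cplane_measD; [apply: cplane_measM => //; exact: cplane_meas_id | exact: cplane_meas_cst].
Qed.

Lemma plane_meas_cnorm f : cplane_meas f -> plane_meas (fun z => cnorm (f z)).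
Proof.
move=> [f1 f2].
have ms : measurable_fun setT (@Num.sqrt R).
  exact: (continuous_measurable_fun (@sqrt_continuous R)).
apply: (measurableT_comp ms).
by apply: measurable_funD; exact: measurable_funX.
Qed.

Lemma le_cplane_integrable f h : cplane_meas f -> plane_integrable h ->
  (forall z, cnorm (f z) <= h z) -> cplane_integrable f.
Proof.
move=> [m1 m2] ih fh; split; apply: le_plane_integrable ih => // z.
- exact: le_trans (norm_Re_le _) (fh z).
- exact: le_trans (norm_Im_le _) (fh z).
Qed.

(* [Rintegral] sends an infinite integral to [0], so a nonzero value forces
   integrability. *)
Lemma cplane_integrable_norm_sqr (F : R[i] -> R[i]) h : cplane_meas F -> plane_meas h ->
  (forall z, 0 <= h z) -> plane_integral (fun z => cnorm (F z) ^+ 2 * h z) != 0 ->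
  plane_integrable (fun z => cnorm (F z) ^+ 2 * h z).
Proof.
move=> mF mh h0 i0; have m : plane_meas (fun z => cnorm (F z) ^+ 2 * h z).
  by apply: measurable_funM => //; apply: measurable_funX; exact: plane_meas_cnorm.
apply/integrableP; split; first exact/measurable_EFinP.
rewrite ltey; apply: contra_neq i0 => e; rewrite /plane_integral /Rintegral.
suff -> : (\int[@leb2 R]_x (cnorm (F (cplx x)) ^+ 2 * h (cplx x))%:E = +oo)%E.
  by rewrite /= mul0r.
rewrite -e; apply: eq_integral => x _ /=.
by rewrite ger0_norm// mulr_ge0// ?sqr_ge0.
Qed.

End PlaneIntegral.

(** * The total mass of the planar Gaussian *)

Section GaussianPlane.
Context {R : realType}.
Local Open Scope classical_set_scope.
Let mu := @lebesgue_measure R.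
Variables (b : R) (b0 : 0 < b).

Definition gaussian (c : R) (z : R[i]) : R := expR (- (c * cnorm z ^+ 2)).

Lemma gaussianE c x y : gaussian c (cplx (x, y)) = expR (- (c * x ^+ 2)) * expR (- (c * y ^+ 2)).
Proof. by rewrite /gaussian sqr_cnorm /= mulrDr opprD expRD. Qed.

Lemma plane_meas_gaussian c : plane_meas (gaussian c).
Proof.
apply: measurableT_comp => //; apply: measurableT_comp => //.
apply: measurable_funM => //; apply: measurable_funX.
by apply: (@plane_meas_cnorm R id); exact: cplane_meas_id.
Qed.

Lemma integral_gaussian_plane : (\int[@leb2 R]_xy (gaussian b (cplx xy))%:E)%E = (pi / b)%:E.
Proof.
have p0 := pi_gt0 R.
have Z (k : R) : 0 <= k ->
    (\int[mu]_x (k * expR (- (b * x ^+ 2)))%:E)%E = (k * Num.sqrt (pi / b))%:E.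
  move=> k0; under eq_integral do rewrite EFinM.
  rewrite ge0_integralZl ?gaussian_integral ?EFinM ?lee_fin//.
  by apply/measurable_EFinP; exact: measurable_gaussian.
rewrite /leb2 fubini_tonelli1; last 2 first.
- by apply/measurable_EFinP; exact: plane_meas_gaussian.
- by move=> x; rewrite lee_fin expR_ge0.
transitivity (\int[mu]_x (Num.sqrt (pi / b) * expR (- (b * x ^+ 2)))%:E)%E.
  apply: eq_integral => x _; rewrite /fubini_F mulrC -Z ?expR_ge0//.
  by apply: eq_integral => y _; rewrite gaussianE.
rewrite Z ?sqrtr_ge0// -expr2 sqr_sqrtr// divr_ge0// ltW//.
Qed.

Lemma plane_integrable_gaussian : plane_integrable (gaussian b).
Proof.
apply/integrableP; split; first by apply/measurable_EFinP; exact: plane_meas_gaussian.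
under eq_integral do rewrite /= ger0_norm ?expR_ge0//.
by rewrite integral_gaussian_plane ltry.
Qed.

Lemma plane_integral_gaussian : plane_integral (gaussian b) = b^-1.
Proof.
rewrite /plane_integral /Rintegral integral_gaussian_plane /=.
by move: (pi_gt0 R); generalize (pi : R) => p p0; field; rewrite !gt_eqF.
Qed.

End GaussianPlane.

(** * Mixed moments of the planar Gaussian, by integration by parts rather than polar coordinates *)

Section GaussianMoments.
Context {R : realType}.
Local Open Scope classical_set_scope.
Let mu := @lebesgue_measure R.

(** Half of the exponent is spent on the power: [r ^ m <= 1 + r ^ (2 m)], and
    [r ^ (2 m) exp (- b r ^ 2 / 2)] is a multiple of a Poisson mass, hence bounded. *)
Lemma pow_gaussian_le (b : R) (m : nat) : 0 < b -> exists2 C : R, 0 <= C &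
  forall r, 0 <= r -> r ^+ m * expR (- (b * r ^+ 2)) <= C * expR (- (b / 2 * r ^+ 2)).
Proof.
move=> b0; have b2 : 0 < b / 2 by rewrite divr_gt0.
exists (1 + (m`!)%:R / (b / 2) ^+ m) => [|r r0].
  by rewrite addr_ge0// divr_ge0// exprn_ge0// ltW.
have -> : b * r ^+ 2 = b / 2 * r ^+ 2 + b / 2 * r ^+ 2 by field.
set X := b / 2 * r ^+ 2; have X0 : 0 <= X by rewrite mulr_ge0 ?sqr_ge0// ltW.
rewrite opprD expRD mulrA ler_wpM2r ?expR_ge0//.
have p1 := poisson_mass_le1 m X0.
have rm : r ^+ m <= 1 + (r ^+ m) ^+ 2.
  by have := sqr_ge0 (r ^+ m - 1); rewrite sqrrB1; have := exprn_ge0 m r0; lra.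
have e1 : expR (- X) <= 1 by rewrite -expR0 ler_expR oppr_le0.
apply: le_trans (ler_wpM2r (expR_ge0 _) rm) _; rewrite mulrDl mul1r lerD//.
have -> : (r ^+ m) ^+ 2 * expR (- X) = (m`!)%:R / (b / 2) ^+ m * poisson_mass X m.
  have XE : X ^+ m = (b / 2) ^+ m * (r ^+ m) ^+ 2 by rewrite /X exprMn -!exprM mulnC.
  have B0 : (b / 2) ^+ m != 0 by rewrite expf_neq0// gt_eqF.
  have F0 : (m`!)%:R != 0 :> R by rewrite pnatr_eq0 -lt0n fact_gt0.
  rewrite /poisson_mass XE; move: B0 F0; move: ((b / 2) ^+ m) ((m`!)%:R : R) => B F B0 F0.
  by field; rewrite B0 F0.
by rewrite ler_piMr// divr_ge0// exprn_ge0// ltW.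
Qed.

Variables (b : R) (b0 : 0 < b).

Definition gaussian_monomial (j k : nat) (z : R[i]) : R[i] :=
  z ^+ j * conjc z ^+ k * (gaussian b z)%:C.

Lemma cplane_meas_gaussian_monomial j k : cplane_meas (gaussian_monomial j k).
Proof.
apply: cplane_measM; last by apply: cplane_meas_real; exact: plane_meas_gaussian.
apply: cplane_measM; apply: cplane_measX; first exact: cplane_meas_id.
by apply: cplane_meas_conj; exact: cplane_meas_id.
Qed.

Lemma gaussian_monomial_le j k : exists2 C : R, 0 <= C &
  forall z, cnorm (gaussian_monomial j k z) <= C * gaussian (b / 2) z.
Proof.
have [C C0 hC] := pow_gaussian_le (j + k) b0; exists C => // z.
rewrite !cnormM !cnormX cnorm_conj -exprD cnorm_real ger0_norm ?expR_ge0//.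
exact: hC (cnorm_ge0 z).
Qed.

Lemma cplane_integrable_gaussian_monomial j k : cplane_integrable (gaussian_monomial j k).
Proof.
have [C C0 hC] := gaussian_monomial_le j k.
apply: le_cplane_integrable hC; first exact: cplane_meas_gaussian_monomial.
by apply: plane_integrableZ; apply: plane_integrable_gaussian; rewrite divr_gt0.
Qed.

(* Wirtinger derivatives of [gaussian_monomial j k]; for [j = 0] (resp. [k = 0])
   the truncated predecessor is harmless as its coefficient vanishes. *)
Definition gm_dz j k z : R[i] :=
  j%:R * gaussian_monomial j.-1 k z - b%:C * gaussian_monomial j k.+1 z.
Definition gm_dzbar j k z : R[i] :=
  k%:R * gaussian_monomial j k.-1 z - b%:C * gaussian_monomial j.+1 k z.

(** The directional derivative is [u] times one Wirtinger derivative plus [conjc u] times the other.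
    The directions [1] and [i] then give the two partial derivatives. *)
Lemma cderiv_gaussian_monomial (v u : R[i]) j k :
  cderiv (fun t => gaussian_monomial j k (v + t%:C * u))
         (fun t => u * gm_dz j k (v + t%:C * u) + conjc u * gm_dzbar j k (v + t%:C * u)).
Proof.
have dz := cderiv_affine v u; have dw := cderiv_affine (conjc v) (conjc u).
have E t : conjc (v + t%:C * u) = conjc v + t%:C * conjc u.
  by rewrite rmorphD rmorphM; congr (_ + _ * _); exact: conjc_real.
have G t : (gaussian b (v + t%:C * u))%:C =
    cexp (- (b%:C * ((v + t%:C * u) * (conjc v + t%:C * conjc u)))).
  by rewrite -E mulcJ -real_complexM -real_complexN cexp_real.
have D := cderivM (cderivM (cderivX j dz) (cderivX k dw))
    (cderiv_cexp (cderivN (cderivZ b%:C (cderivM dz dw)))).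
apply: (cderiv_ext (cderiv_eq D _)) => t; last by rewrite /gaussian_monomial E G.
by rewrite /gm_dz /gm_dzbar /gaussian_monomial E -G !exprS /=; ring.
Qed.

Lemma gm_deriv_le u j k : exists2 C : R, 0 <= C &
  forall z, cnorm (u * gm_dz j k z + conjc u * gm_dzbar j k z) <= C * gaussian (b / 2) z.
Proof.
have [C1 C10 h1] := gaussian_monomial_le j.-1 k.
have [C2 C20 h2] := gaussian_monomial_le j k.+1.
have [C3 C30 h3] := gaussian_monomial_le j k.-1.
have [C4 C40 h4] := gaussian_monomial_le j.+1 k.
exists (cnorm u * (j%:R * C1 + b * C2) + cnorm u * (k%:R * C3 + b * C4)) => [|z].
  by rewrite !(addr_ge0, mulr_ge0) ?cnorm_ge0// ltW.
apply: le_trans (cnormD _ _) _; rewrite !cnormM cnorm_conj mulrDl -!mulrA.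
have bb : `|b| = b by rewrite gtr0_norm.
apply: lerD; rewrite ler_wpM2l ?cnorm_ge0// mulrDl; apply: le_trans (cnormB _ _) _;
  rewrite [cnorm (_%:R * _)]cnormM [cnorm (b%:C * _)]cnormM cnorm_nat (cnorm_real b) bb -!mulrA; apply: lerD;
  by rewrite ler_wpM2l// ltW.
Qed.

Lemma cplane_integrable_gm_deriv u j k :
  cplane_integrable (fun z => u * gm_dz j k z + conjc u * gm_dzbar j k z).
Proof.
have I := cplane_integrable_gaussian_monomial.
rewrite /gm_dz /gm_dzbar; apply: cplane_integrableD; apply: cplane_integrableZ;
  under eq_fun do rewrite -mulNr; apply: cplane_integrableD; exact: cplane_integrableZ.
Qed.

Lemma cderiv_gm_deriv (v u : R[i]) j k :
  ccont (fun t => u * gm_dz j k (v + t%:C * u) + conjc u * gm_dzbar j k (v + t%:C * u)).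
Proof.
have D := cderiv_gaussian_monomial v u.
exact: cderiv_cont (cderivD
  (cderivZ u (cderivD (cderivZ j%:R (D j.-1 k)) (cderivN (cderivZ b%:C (D j k.+1)))))
  (cderivZ (conjc u) (cderivD (cderivZ k%:R (D j k.-1)) (cderivN (cderivZ b%:C (D j.+1 k)))))).
Qed.

(** The hypothesis on [v + t u] holds on horizontal and vertical lines parametrised by the moving
    coordinate; it gives Gaussian decay in [t], uniformly in the other coordinate. *)
Lemma line_integral_gm_deriv (v u : R[i]) j k :
  (forall t : R, t ^+ 2 <= cnorm (v + t%:C * u) ^+ 2) ->
  let f t := u * gm_dz j k (v + t%:C * u) + conjc u * gm_dzbar j k (v + t%:C * u) in
  (\int[mu]_t (Re (f t))%:E = 0)%E /\ (\int[mu]_t (Im (f t))%:E = 0)%E.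
Proof.
move=> tv f; have [C1 C10 h1] := gaussian_monomial_le j k.
have [C2 C20 h2] := gm_deriv_le u j k.
have b2 : 0 < b / 2 by rewrite divr_gt0.
have [cR cI] := cderiv_gm_deriv v u j k.
have g t : gaussian (b / 2) (v + t%:C * u) <= expR (- (b / 2 * t ^+ 2)).
  by rewrite ler_expR lerN2 ler_pM2l.
have B1 t : cnorm (gaussian_monomial j k (v + t%:C * u)) <=
    (C1 + C2) * expR (- (b / 2 * t ^+ 2)).
  apply: le_trans (h1 _) _; apply: ler_pM; rewrite ?expR_ge0// lerDl//.
have B2 t : cnorm (f t) <= (C1 + C2) * expR (- (b / 2 * t ^+ 2)).
  apply: le_trans (h2 _) _; apply: ler_pM; rewrite ?expR_ge0// lerDr//.
have D := cderiv_gaussian_monomial v u j k.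
split.
- apply: (@integral_derivative0 R
    (fun t => Re (gaussian_monomial j k (v + t%:C * u))) _ _ (C1 + C2) b2) => // t.
  + by case: (D t).
  + exact: le_trans (norm_Re_le _) (B2 t).
  + exact: le_trans (norm_Re_le _) (B1 t).
- apply: (@integral_derivative0 R
    (fun t => Im (gaussian_monomial j k (v + t%:C * u))) _ _ (C1 + C2) b2) => // t.
  + by case: (D t).
  + exact: le_trans (norm_Im_le _) (B2 t).
  + exact: le_trans (norm_Im_le _) (B1 t).
Qed.

Lemma cplx_horizontal (t y : R) : cplx (t, y) = (0 +i* y) + t%:C * 1.
Proof. by apply: complex_ext; rewrite ?ReD ?ImD /=; ring. Qed.

Lemma cplx_vertical (x t : R) : cplx (x, t) = x%:C + t%:C * 'i%C.
Proof. by apply: complex_ext; rewrite ?ReD ?ImD /=; ring. Qed.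

Lemma intdA_dx j k : intdA (fun z => 1 * gm_dz j k z + conjc 1 * gm_dzbar j k z) = 0.
Proof.
have [iR iI] := cplane_integrable_gm_deriv 1 j k.
have tv y (t : R) : t ^+ 2 <= cnorm (0 +i* y + t%:C * 1) ^+ 2.
  by rewrite -cplx_horizontal sqr_cnorm /= lerDl sqr_ge0.
rewrite intdAE; apply: complex_ext; rewrite /= /plane_integral /Rintegral.
- rewrite -[X in fine X](integral21_prod_meas1 iR) integral0_eq ?mul0r// => y _.
  by rewrite /fubini_G /=; under eq_integral do rewrite cplx_horizontal;
    have [] := line_integral_gm_deriv j k (tv y).
- rewrite -[X in fine X](integral21_prod_meas1 iI) integral0_eq ?mul0r// => y _.
  by rewrite /fubini_G /=; under eq_integral do rewrite cplx_horizontal;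
    have [] := line_integral_gm_deriv j k (tv y).
Qed.

Lemma intdA_dy j k : intdA (fun z => 'i%C * gm_dz j k z + conjc 'i%C * gm_dzbar j k z) = 0.
Proof.
have [iR iI] := cplane_integrable_gm_deriv 'i%C j k.
have tv x (t : R) : t ^+ 2 <= cnorm (x%:C + t%:C * 'i%C) ^+ 2.
  by rewrite -cplx_vertical sqr_cnorm /= lerDr sqr_ge0.
rewrite intdAE; apply: complex_ext; rewrite /= /plane_integral /Rintegral.
- rewrite -[X in fine X](integral12_prod_meas1 iR) integral0_eq ?mul0r// => x _.
  by rewrite /fubini_F /=; under eq_integral do rewrite cplx_vertical;
    have [] := line_integral_gm_deriv j k (tv x).
- rewrite -[X in fine X](integral12_prod_meas1 iI) integral0_eq ?mul0r// => x _.
  by rewrite /fubini_F /=; under eq_integral do rewrite cplx_vertical;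
    have [] := line_integral_gm_deriv j k (tv x).
Qed.

Definition gaussian_moment j k := intdA (gaussian_monomial j k).

(** The integrals of the [x] and [y] derivatives vanish by Fubini. As these derivatives are the sum,
    and [i] times the difference, of the Wirtinger derivatives, both Wirtinger integrals vanish, and
    writing them out gives the recursions. *)
Lemma gaussian_moment_rec j k :
  b%:C * gaussian_moment j k.+1 = j%:R * gaussian_moment j.-1 k /\
  b%:C * gaussian_moment j.+1 k = k%:R * gaussian_moment j k.-1.
Proof.
have I := cplane_integrable_gaussian_monomial.
have ID1 : cplane_integrable (gm_dz j k).
  by rewrite /gm_dz; under eq_fun do rewrite -mulNr;
    apply: cplane_integrableD; exact: cplane_integrableZ.
have ID2 : cplane_integrable (gm_dzbar j k).
  by rewrite /gm_dzbar; under eq_fun do rewrite -mulNr;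
    apply: cplane_integrableD; exact: cplane_integrableZ.
have := intdA_dx j k; have := intdA_dy j k.
rewrite !intdAD; try exact: cplane_integrableZ.
rewrite !intdAZ//.
have -> : conjc 'i%C = - 'i%C :> R[i] by apply: complex_ext => /=; ring.
rewrite rmorph1 !mul1r mulNr -mulrBr => /eqP; rewrite mulf_eq0 => /orP[|/eqP h1 h2].
  by rewrite eq_complex /= oner_eq0 andbF.
have A0 : intdA (gm_dz j k) = 0.
  have two0 : (2 : R[i]) != 0 by rewrite pnatr_eq0.
  apply: (mulfI two0); rewrite mulr0 -[RHS](addr0 0) -{1}h1 -h2; ring.
have B0 : intdA (gm_dzbar j k) = 0 by rewrite -h2 A0 add0r.
move: A0 B0; rewrite /gm_dz /gm_dzbar.
under eq_fun do rewrite -mulNr; rewrite intdAD; try exact: cplane_integrableZ.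
rewrite !intdAZ// mulNr => /eqP; rewrite subr_eq0 => /eqP ->.
under eq_fun do rewrite -mulNr; rewrite intdAD; try exact: cplane_integrableZ.
by rewrite !intdAZ// mulNr => /eqP; rewrite subr_eq0 => /eqP ->.
Qed.

Lemma gaussian_momentE j k :
  gaussian_moment j k = (j == k)%:R * (j`!)%:R / b%:C ^+ j.+1.
Proof.
have bC : b%:C != 0 by rewrite real_complex_neq0// gt_eqF.
elim: j k => [|j IH] [|k].
- rewrite eqxx mul1r fact0 mul1r expr1 /gaussian_moment.
  have -> : gaussian_monomial 0 0 = fun z => (gaussian b z)%:C.
    by apply/funext => z; rewrite /gaussian_monomial !expr0 !mul1r.
  by rewrite intdA_real plane_integral_gaussian// real_complexV.
- have [h _] := gaussian_moment_rec 0 k.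
  by apply: (mulfI bC); rewrite h !mul0r mulr0.
- have [_ h] := gaussian_moment_rec j 0.
  by apply: (mulfI bC); rewrite h !mul0r mulr0.
- have [_ h] := gaussian_moment_rec j k.+1.
  apply: (mulfI bC); rewrite h /= IH eqSS; case: eqP => [->|_]; last by rewrite !mul0r !mulr0.
  rewrite /= !mul1r factS natrM [b%:C ^+ k.+2]exprS.
  by move: (b%:C ^+ k.+1) (expf_neq0 k.+1 bC) => B B0; field; rewrite bC B0.
Qed.

End GaussianMoments.

(** * Orthonormal polynomials and their kernels *)

Section OrthonormalBasis.
Context {R : realType}.
Variables (om : R[i] -> R) (E : nat -> {poly R[i]}).
Hypotheses (om0 : forall z, 0 <= om z) (omm : plane_meas om).
Hypotheses (sizeE : forall j, size (E j) = j.+1).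
Hypotheses (orthoE : forall j k,
  intdA (fun z => (E j).[z] * conjc (E k).[z] * (om z)%:C) = (j == k)%:R).
Implicit Types (p q : {poly R[i]}).

Definition wnorm2 p : R := plane_integral (fun z => cnorm p.[z] ^+ 2 * om z).
Definition winner p q : R[i] := intdA (fun z => p.[z] * conjc q.[z] * (om z)%:C).

Lemma winner_diag p : winner p p = (wnorm2 p)%:C.
Proof.
rewrite -intdA_real; congr intdA; apply/funext => z.
by rewrite mulcJ -real_complexM.
Qed.

Lemma wnorm2_basis j : wnorm2 (E j) = 1.
Proof.
apply: (@complexI R); rewrite -winner_diag /winner orthoE eqxx.
by rewrite rmorph1.
Qed.

Lemma integrable_basis j : plane_integrable (fun z => cnorm (E j).[z] ^+ 2 * om z).
Proof.
apply: cplane_integrable_norm_sqr => //; first exact: cplane_meas_poly.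
by rewrite -/(wnorm2 (E j)) wnorm2_basis oner_neq0.
Qed.

Lemma basis_span n p : (size p <= n)%N ->
  exists c : nat -> R[i], p = \sum_(j < n) c j *: E j.
Proof.
elim: n p => [|n IH] p pn.
  by exists (fun=> 0); rewrite big_ord0; apply/eqP; rewrite -size_poly_leq0.
have lE : lead_coef (E n) != 0 by rewrite lead_coef_eq0 -size_poly_eq0 sizeE.
have lEn : (E n)`_n = lead_coef (E n) by rewrite lead_coefE sizeE.
pose d := p`_n / lead_coef (E n).
have [|c hc] := IH (p - d *: E n).
  apply/leq_sizeP => j nj; rewrite coefB coefZ.
  case: (ltngtP n j) nj => // [lt _|<- _].
    rewrite (nth_default _ (leq_trans pn lt)) nth_default ?sizeE//.
    by rewrite mulr0 subrr.
  by rewrite lEn /d divfK// subrr.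
exists (fun j => if j == n then d else c j).
rewrite big_ord_recr /= eqxx -[LHS](subrK (d *: E n)) hc; congr (_ + _).
by apply: eq_bigr => j _; rewrite (ltn_eqF (ltn_ord j)).
Qed.

(** No decay of [om] is assumed. The basis elements have finite norm because it equals 1, they span
    all polynomials, and [|u + v| ^ 2 <= 2 |u| ^ 2 + 2 |v| ^ 2] passes integrability to
    combinations. *)
Lemma wnorm_integrable p : plane_integrable (fun z => cnorm p.[z] ^+ 2 * om z).
Proof.
have [c ->] := basis_span (leqnn (size p)).
elim: (size p) => [|n IH].
  under eq_fun do rewrite big_ord0 horner0 cnorm0 expr0n mul0r.
  have := plane_integrableZ 0 (integrable_basis 0).
  by under eq_fun do rewrite mul0r.
have m : plane_meas (fun z => cnorm (\sum_(j < n.+1) c j *: E j).[z] ^+ 2 * om z).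
  apply: measurable_funM => //; apply: measurable_funX.
  exact: plane_meas_cnorm (cplane_meas_poly _).
apply: le_plane_integrable m _ (plane_integrableD (plane_integrableZ 2 IH)
  (plane_integrableZ (2 * cnorm (c n) ^+ 2) (integrable_basis n))) => z.
rewrite ger0_norm ?mulr_ge0 ?sqr_ge0 ?cnorm_ge0// big_ord_recr /= hornerD hornerZ.
rewrite !mulrA -mulrDl ler_wpM2r//.
set u := (\sum_(j < n) _).[z]; set v := (E n).[z].
have : cnorm (u + c n * v) ^+ 2 <= (cnorm u + cnorm (c n * v)) ^+ 2.
  by rewrite lerXn2r ?nnegrE ?addr_ge0 ?cnorm_ge0// cnormD.
rewrite cnormM => h; apply: (le_trans h).
have := sqr_ge0 (cnorm u - cnorm (c n) * cnorm v); rewrite sqrrB sqrrD exprMn.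
lra.
Qed.

Lemma winner_integrable p q :
  cplane_integrable (fun z => p.[z] * conjc q.[z] * (om z)%:C).
Proof.
apply: (le_cplane_integrable (h := fun z => cnorm p.[z] ^+ 2 * om z + cnorm q.[z] ^+ 2 * om z)).
- apply: cplane_measM; last exact: cplane_meas_real.
  by apply: cplane_measM; [|apply: cplane_meas_conj]; exact: cplane_meas_poly.
- by apply: plane_integrableD; exact: wnorm_integrable.
- move=> z; rewrite !cnormM cnorm_conj cnorm_real ger0_norm// -mulrDl ler_wpM2r//.
  have := sqr_ge0 (cnorm p.[z] - cnorm q.[z]); rewrite sqrrB.
  have := sqr_ge0 (cnorm p.[z]); have := sqr_ge0 (cnorm q.[z]); lra.
Qed.

Lemma winner0l q : winner 0 q = 0.
Proof.
have := intdAZ 0 (winner_integrable 0 q); rewrite mul0r -/(winner 0 q) => h.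
by rewrite -[RHS]h; congr intdA; apply/funext => z; rewrite horner0 !mul0r.
Qed.

Lemma winner0r q : winner q 0 = 0.
Proof.
have := intdAZ 0 (winner_integrable q 0); rewrite mul0r -/(winner q 0) => h.
by rewrite -[RHS]h; congr intdA; apply/funext => z; rewrite horner0 rmorph0 !(mulr0, mul0r).
Qed.

Lemma winner_linearl p1 p2 (c : R[i]) q :
  winner (p1 + c *: p2) q = winner p1 q + c * winner p2 q.
Proof.
rewrite /winner -(intdAZ c (winner_integrable p2 q)).
rewrite -(intdAD (winner_integrable p1 q) (cplane_integrableZ c (winner_integrable p2 q))).
by congr intdA; apply/funext => z; rewrite hornerD hornerZ; ring.
Qed.

Lemma winner_linearr p1 p2 (c : R[i]) q :
  winner q (p1 + c *: p2) = winner q p1 + conjc c * winner q p2.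
Proof.
rewrite /winner -(intdAZ (conjc c) (winner_integrable q p2)).
rewrite -(intdAD (winner_integrable q p1) (cplane_integrableZ (conjc c) (winner_integrable q p2))).
congr intdA; apply/funext => z; rewrite hornerD hornerZ.
by rewrite (rmorphD (@conjc R)) (rmorphM (@conjc R)); ring.
Qed.

Lemma winner_suml n (c : nat -> R[i]) (F : nat -> {poly R[i]}) q :
  winner (\sum_(j < n) c j *: F j) q = \sum_(j < n) c j * winner (F j) q.
Proof.
elim: n => [|n IH]; first by rewrite !big_ord0 winner0l.
by rewrite !big_ord_recr /= -IH winner_linearl.
Qed.

Lemma winner_sumr n (c : nat -> R[i]) (F : nat -> {poly R[i]}) q :
  winner q (\sum_(j < n) c j *: F j) = \sum_(j < n) conjc (c j) * winner q (F j).
Proof.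
elim: n => [|n IH]; first by rewrite !big_ord0 winner0r.
by rewrite !big_ord_recr /= -IH winner_linearr.
Qed.

Lemma wnorm2_sum n (c : nat -> R[i]) :
  wnorm2 (\sum_(j < n) c j *: E j) = \sum_(j < n) cnorm (c j) ^+ 2.
Proof.
apply: (@complexI R); rewrite -winner_diag winner_suml (rmorph_sum (real_complex R)).
apply: eq_bigr => i _; rewrite winner_sumr (bigD1 i)//= big1 => [|j ji].
  by rewrite /winner orthoE eqxx mulr1 addr0 mulcJ.
by rewrite /winner orthoE eq_sym -val_eqE in ji *; rewrite (negbTE ji) mulr0.
Qed.

End OrthonormalBasis.

(** * Monotonicity of reproducing kernels under multiplication by a fixed polynomial *)

Section KernelComparison.
Context {R : realType}.
Variables (om1 om2 : R[i] -> R) (E F : nat -> {poly R[i]}).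
Hypotheses (om10 : forall z, 0 <= om1 z) (om1m : plane_meas om1).
Hypotheses (om20 : forall z, 0 <= om2 z) (om2m : plane_meas om2).
Hypotheses (sizeE : forall j, size (E j) = j.+1) (sizeF : forall j, size (F j) = j.+1).
Hypotheses (orthoE : forall j k,
  intdA (fun z => (E j).[z] * conjc (E k).[z] * (om1 z)%:C) = (j == k)%:R).
Hypotheses (orthoF : forall j k,
  intdA (fun z => (F j).[z] * conjc (F k).[z] * (om2 z)%:C) = (j == k)%:R).

Lemma size_basis_comb n (c : nat -> R[i]) : (size (\sum_(j < n) c j *: E j)%R <= n)%N.
Proof.
apply: (leq_trans (size_sum _ _ _)); apply/bigmax_leqP => j _.
by apply: (leq_trans (size_scale_leq _ _)); rewrite sizeE.
Qed.

(* The functional [f |-> al h(z) f(z) + be h(w) f(w)] is represented by some [q];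
   expanding [h * q] in the second basis and AM-GM compare the kernels. *)
Lemma kernel_compare n m (h : {poly R[i]}) (k : R) : 0 < k ->
  (forall q : {poly R[i]}, (size q <= n)%N -> (size (h * q)%R <= m)%N) ->
  (forall q : {poly R[i]}, (size q <= n)%N -> wnorm2 om2 (h * q) <= k * wnorm2 om1 q) ->
  forall al be z w : R[i],
  \sum_(j < n) cnorm (al * (h.[z] * (E j).[z]) + be * (h.[w] * (E j).[w])) ^+ 2 <=
  k * \sum_(j < m) cnorm (al * (F j).[z] + be * (F j).[w]) ^+ 2.
Proof.
move=> k0 hsz hn al be z w.
pose g j := al * (h.[z] * (E j).[z]) + be * (h.[w] * (E j).[w]).
pose q := \sum_(j < n) conjc (g j) *: E j.
have qn : (size q <= n)%N := size_basis_comb n (fun j => conjc (g j)).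
set S := \sum_(j < n) _; have nq : wnorm2 om1 q = S.
  rewrite (wnorm2_sum om10 om1m sizeE orthoE n (fun j => conjc (g j))).
  by apply: eq_bigr => j _; rewrite cnorm_conj.
have Sq : al * (h * q).[z] + be * (h * q).[w] = S%:C.
  rewrite (rmorph_sum (real_complex R)) !hornerM !horner_sum !mulr_sumr -big_split /=.
  apply: eq_bigr => j _; rewrite -/(g j) -mulcJ !hornerZ /g; ring.
have [f hf] := basis_span sizeF (hsz q qn).
have nf : \sum_(j < m) cnorm (f j) ^+ 2 <= k * S.
  by rewrite -(wnorm2_sum om20 om2m sizeF orthoF) -hf -nq hn.
set T := \sum_(j < m) _.
have SE : S%:C = \sum_(j < m) f j * (al * (F j).[z] + be * (F j).[w]).
  rewrite -Sq hf !horner_sum !mulr_sumr -big_split /=.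
  by apply: eq_bigr => j _; rewrite !hornerZ; ring.
have S0 : 0 <= S by rewrite sumr_ge0// => j _; rewrite sqr_ge0.
(* AM-GM is weighted by [k] so that the first half sums to at most [S / 2]; then
   [S <= S / 2 + k T / 2] gives the claim. *)
have : S <= \sum_(j < m) (cnorm (f j) ^+ 2 / k / 2 +
    k * cnorm (al * (F j).[z] + be * (F j).[w]) ^+ 2 / 2).
  rewrite -[S]ger0_norm// -cnorm_real SE; apply: le_trans (cnorm_sum _ _ _) _.
  apply: ler_sum => j _; rewrite cnormM.
  set x := cnorm (f j); set y := cnorm _.
  have : 0 <= (x - k * y) ^+ 2 / k / 2 by rewrite !divr_ge0 ?sqr_ge0// ltW.
  have -> : (x - k * y) ^+ 2 / k / 2 = x ^+ 2 / k / 2 + k * y ^+ 2 / 2 - x * y.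
    by field; rewrite gt_eqF.
  by rewrite subr_ge0.
rewrite big_split /= -!mulr_suml -mulr_sumr -/T.
have : (\sum_(j < m) cnorm (f j) ^+ 2) / k <= S by rewrite ler_pdivrMr// mulrC.
lra.
Qed.

End KernelComparison.

(** * Negligibility of polynomial mass outside the disc *)

Section GinibreTail.
Context {R : realType}.
Implicit Types (z : R[i]).

Definition ginibre_basis (N j : nat) : {poly R[i]} :=
  (Num.sqrt (N%:R ^+ j.+1 / (j`!)%:R))%:C *: 'X^j.

Lemma ginibre_coef_gt0 N j : (0 < N)%N -> 0 < (N%:R ^+ j.+1 / (j`!)%:R : R).
Proof. by move=> N0; rewrite divr_gt0 ?exprn_gt0 ?ltr0n ?fact_gt0. Qed.

Lemma size_ginibre_basis N j : (0 < N)%N -> size (ginibre_basis N j) = j.+1.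
Proof.
move=> N0; rewrite size_scale ?size_polyXn// real_complex_neq0// gt_eqF//.
by rewrite sqrtr_gt0 ginibre_coef_gt0.
Qed.

Lemma ginibre_basisE N j z :
  (ginibre_basis N j).[z] = (Num.sqrt (N%:R ^+ j.+1 / (j`!)%:R))%:C * z ^+ j.
Proof. by rewrite hornerZ hornerXn. Qed.

Lemma ortho_ginibre_basis N j k : (0 < N)%N ->
  intdA (fun z => (ginibre_basis N j).[z] * conjc (ginibre_basis N k).[z] *
    (gaussian N%:R z)%:C) = (j == k)%:R.
Proof.
move=> N0; have NR : 0 < (N%:R : R) by rewrite ltr0n.
set s := fun i => Num.sqrt (N%:R ^+ i.+1 / (i`!)%:R) : R.
transitivity (intdA (fun z => (s j)%:C * (s k)%:C * gaussian_monomial N%:R j k z)).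
  congr intdA; apply/funext => z; rewrite !ginibre_basisE conjcM conjcR.
  by rewrite conjcX /gaussian_monomial /s; ring.
rewrite intdAZ; last exact: cplane_integrable_gaussian_monomial.
rewrite -/(gaussian_moment N%:R j k) gaussian_momentE//.
case: eqP => [<-|_]; last by rewrite !mul0r mulr0.
rewrite -real_complexM -expr2 sqr_sqrtr; last exact/ltW/ginibre_coef_gt0.
rewrite real_complexM real_complexV real_complexX !real_complex_nat mul1r.
have F0 := factC_neq0 (R := R) j.
have NC : (N%:R : R[i]) ^+ j.+1 != 0 by rewrite expf_neq0// pnatr_eq0 -lt0n.
by rewrite mulrA divfK // divff.
Qed.

Lemma cnorm_ginibre_basis N j z : (0 < N)%N ->
  cnorm (ginibre_basis N j).[z] ^+ 2 * gaussian N%:R z =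
  N%:R * poisson_mass (N%:R * cnorm z ^+ 2) j.
Proof.
move=> N0; rewrite ginibre_basisE cnormM cnorm_real ger0_norm ?sqrtr_ge0//.
rewrite cnormX [in LHS]exprMn sqr_sqrtr; last exact/ltW/ginibre_coef_gt0.
by rewrite /gaussian /poisson_mass exprS exprMn -!exprM [(j * 2)%N]mulnC; ring.
Qed.

(** Consecutive masses have ratio [x / (k + 1)], which is at least 1 below the mean. *)
Lemma poisson_mass_incr (x : R) m j : 0 <= x -> m%:R <= x -> (j <= m)%N ->
  poisson_mass x j <= poisson_mass x m.
Proof.
move=> x0 mx jm; rewrite -(subnKC jm); have : (m - j + j <= m)%N by rewrite subnK.
elim: (m - j)%N => [|i IH] hi; first by rewrite addn0.
apply: (le_trans (IH (ltnW hi))); rewrite addnS.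
have i0 : 0 < ((j + i).+1%:R : R) by [].
rewrite -(ler_pM2l i0) poisson_massS ler_wpM2r ?poisson_mass_ge0//.
by apply: le_trans mx; rewrite ler_nat addnC.
Qed.

Lemma decay_le (s t : R) : 1 <= s -> s <= t -> t * expR (1 - t) <= s * expR (1 - s).
Proof.
move=> s1 st; have -> : 1 - s = (1 - t) + (t - s) by ring.
rewrite (expRD (1 - t)) mulrCA [leLHS]mulrC ler_wpM2l ?expR_ge0//.
have h := expR_ge1Dx (t - s).
apply: (@le_trans _ _ (s * (1 + (t - s)))); last by rewrite ler_wpM2l//; lra.
nra.
Qed.

Lemma decay_lt1 (s : R) : 1 < s -> s * expR (1 - s) < 1.
Proof.
move=> s1; have -> : 1 - s = - (s - 1) by ring.
rewrite expRN ltr_pdivrMr ?expR_gt0// mul1r.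
by have := @expR_gt1Dx R (s - 1); rewrite subr_eq0 gt_eqF// => /(_ isT); lra.
Qed.

(** The exponential rate at which the Poisson mass at [N] with mean [N rho ^ 2] decays in [N],
    relative to mean [N]; it is below 1 for [rho > 1]. *)
Definition decay (rho : R) := rho ^+ 2 * expR (1 - rho ^+ 2).

Lemma decay_gt0 rho : 1 < rho -> 0 < decay rho.
Proof. by move=> r1; rewrite mulr_gt0 ?expR_gt0// exprn_gt0//; lra. Qed.

(** With [t = |z| ^ 2] the left side is [N] times a Poisson mass of mean [N t]. Since [N + d] is
    below the mean, [j] may be raised to [N + d], then lowered to [N] at the cost of [t ^ d]. The
    mass at [N] is at most [(t exp (1 - t)) ^ N]: all but one factor become [decay rho], and the
    last one is kept to retain an integrable function of [z]. *)
Lemma ginibre_basis_tail N d j rho z : (0 < N)%N -> 1 < rho ->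
  (N + d)%:R <= N%:R * rho ^+ 2 -> (j <= N + d)%N -> rho <= cnorm z ->
  cnorm (ginibre_basis N j).[z] ^+ 2 * gaussian N%:R z <=
  N%:R * decay rho ^+ N.-1 * (expR 1 * ((cnorm z ^+ 2) ^+ d.+1 * gaussian 1 z)).
Proof.
move=> N0 r1 Nd jNd rz; rewrite cnorm_ginibre_basis// -mulrA ler_wpM2l//.
set t := cnorm z ^+ 2; set X := N%:R * t.
have NR : 0 < (N%:R : R) by rewrite ltr0n.
have rt : rho ^+ 2 <= t by rewrite lerXn2r ?nnegrE//; lra.
have r21 : 1 < rho ^+ 2 by rewrite expr2; nra.
have t1 : 1 < t by lra.
have X0 : 0 <= X by rewrite mulr_ge0//; lra.
have NdX : (N + d)%:R <= X by apply: (le_trans Nd); rewrite ler_wpM2l.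
apply: (le_trans (poisson_mass_incr X0 NdX jNd)).
have step i : poisson_mass X (N + i) <= t ^+ i * poisson_mass X N.
  elim: i => [|i IH]; first by rewrite addn0 expr0 mul1r.
  rewrite addnS; have i0 : 0 < ((N + i).+1%:R : R) by [].
  rewrite -(ler_pM2l i0) poisson_massS exprS.
  apply: (@le_trans _ _ (X * (t ^+ i * poisson_mass X N))); first by rewrite ler_wpM2l.
  rewrite /X -!mulrA ler_pM// ?mulr_ge0 ?exprn_ge0 ?poisson_mass_ge0//; try lra.
  by rewrite ler_nat (leq_trans (leq_addr i N)).
apply: (le_trans (step d)); rewrite exprSr /gaussian mul1r -/t.
have -> : decay rho ^+ N.-1 * (expR 1 * (t ^+ d * t * expR (- t))) =
    t ^+ d * (decay rho ^+ N.-1 * (t * expR (1 - t))) by rewrite expRD; ring.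
rewrite ler_wpM2l ?exprn_ge0//; first lra.
clearbody t.
have -> : poisson_mass X N = poisson_mass N%:R N * (t * expR (1 - t)) ^+ N.
  have XE : X ^+ N = N%:R ^+ N * t ^+ N by rewrite /X exprMn.
  rewrite /poisson_mass XE exprMn -expRM_natl.
  have -> : expR (- X) = expR (- N%:R) * expR (N%:R * (1 - t)).
    by rewrite -expRD; congr expR; rewrite /X; ring.
  ring.
have u0 : 0 <= t * expR (1 - t) by rewrite mulr_ge0 ?expR_ge0//; lra.
apply: (@le_trans _ _ ((t * expR (1 - t)) ^+ N)).
  by rewrite ler_piMl ?exprn_ge0// poisson_mass_le1.
rewrite -{1}(prednK N0) exprSr ler_wpM2r//.
by rewrite lerXn2r ?nnegrE// ?(ltW (decay_gt0 r1))// decay_le//; lra.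
Qed.

Definition tail_factor (N d : nat) (rho : R) : R :=
  (N + d)%:R ^+ 2 * (N%:R * decay rho ^+ N.-1 * expR 1).

Lemma tail_factor_ge0 N d rho : 1 < rho -> 0 <= tail_factor N d rho.
Proof.
move=> r1; rewrite mulr_ge0 ?sqr_ge0// !mulr_ge0 ?expR_ge0// exprn_ge0//.
exact/ltW/decay_gt0.
Qed.

(* The coefficients of [f] in the orthonormal basis are bounded by its norm; the
   crude factor [(N + d) ^ 2] this costs is beaten by the exponential decay. *)
Lemma poly_tail N d n rho (f : {poly R[i]}) z : (0 < N)%N -> 1 < rho ->
  (N + d)%:R <= N%:R * rho ^+ 2 -> (n <= N + d)%N -> (size f <= n)%N -> rho <= cnorm z ->
  cnorm f.[z] ^+ 2 * gaussian N%:R z <=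
  tail_factor N d rho * wnorm2 (gaussian N%:R) f *
    (cnorm ('X^(d.+1) : {poly R[i]}).[z] ^+ 2 * gaussian 1 z).
Proof.
move=> N0 r1 Nd nNd fn rz.
have NR : 0 < (N%:R : R) by rewrite ltr0n.
have gm : plane_meas (gaussian (N%:R : R)) := plane_meas_gaussian _.
have g0 b z' : 0 <= gaussian (b : R) z' := expR_ge0 _.
have sz j : size (ginibre_basis N j) = j.+1 by exact: size_ginibre_basis.
have orth j k := ortho_ginibre_basis j k N0.
have [c hc] := basis_span sz (leq_trans fn nNd).
have nf := wnorm2_sum (g0 N%:R) gm sz orth (N + d) c; rewrite -hc in nf.
set D := wnorm2 _ f in nf *.
set M := N%:R * decay rho ^+ N.-1 * (expR 1 * ((cnorm z ^+ 2) ^+ d.+1 * gaussian 1 z)).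
have D0 : 0 <= D by rewrite nf sumr_ge0// => j _; exact: sqr_ge0.
have M0 : 0 <= M.
  by rewrite !mulr_ge0 ?exprn_ge0 ?expR_ge0 ?sqr_ge0 ?(ltW (decay_gt0 r1)) ?cnorm_ge0.
have -> : tail_factor N d rho * D * (cnorm ('X^(d.+1) : {poly R[i]}).[z] ^+ 2 * gaussian 1 z) =
    ((N + d)%:R * Num.sqrt (D * M)) ^+ 2.
  rewrite exprMn (sqr_sqrtr (mulr_ge0 D0 M0)) hornerXn cnormX /tail_factor /M.
  by rewrite -!exprM [(d.+1 * 2)%N]mulnC; ring.
set s := Num.sqrt (gaussian N%:R z).
have ss : s ^+ 2 = gaussian N%:R z by rewrite sqr_sqrtr.
have s0 : 0 <= s by exact: sqrtr_ge0.
rewrite -ss -exprMn lerXn2r ?nnegrE ?mulr_ge0 ?cnorm_ge0 ?sqrtr_ge0//.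
rewrite hc horner_sum.
apply: le_trans (ler_wpM2r s0 (cnorm_sum _ _ _)) _; rewrite mulr_suml.
have -> : (N + d)%:R * Num.sqrt (D * M) = \sum_(j < N + d) Num.sqrt (D * M).
  by rewrite sumr_const card_ord mulr_natl.
apply: ler_sum => j _; rewrite hornerZ cnormM.
have u0 : 0 <= cnorm (c j) * cnorm (ginibre_basis N j).[z] * s by rewrite !mulr_ge0 ?cnorm_ge0.
rewrite -[leLHS]ger0_norm// -sqrtr_sqr ler_wsqrtr// !exprMn ss -mulrA.
apply: ler_pM; rewrite ?sqr_ge0//; first by rewrite mulr_ge0 ?sqr_ge0.
  rewrite nf (bigD1 j)//= lerDl sumr_ge0// => i _; exact: sqr_ge0.
by apply: ginibre_basis_tail => //; exact/ltnW/ltn_ord.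
Qed.

Lemma tail_factor_small (d : nat) (rho C eta : R) : 1 < rho -> 0 <= C -> 0 < eta ->
  exists N0 : nat, forall N, (N0 <= N)%N ->
    tail_factor N d rho * C <= eta /\ (N + d)%:R <= N%:R * rho ^+ 2.
Proof.
move=> r1 C0 e0; have k0 := decay_gt0 r1.
have k1 : decay rho < 1 by apply: decay_lt1; rewrite expr2; nra.
set k := decay rho in k0 k1 *; pose l := - ln k.
have l0 : 0 < l by rewrite oppr_gt0 ln_lt0// k0.
have kE : k = expR (- l) by rewrite opprK lnK.
(* [tail_factor] grows cubically apart from the power of [k]. The Poisson mass at 4 with mean [l N]
   is at most 1, so [k ^ N <= 24 / (l N) ^ 4], and the fourth power leaves [K / N]. *)
pose K := (1 + d%:R) ^+ 2 * (expR 1 / k) * (24 / l ^+ 4) : R.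
have K0 : 0 <= K by rewrite !mulr_ge0 ?invr_ge0 ?exprn_ge0 ?expR_ge0 ?addr_ge0 ?(ltW k0) ?(ltW l0).
have r2 : 0 < rho ^+ 2 - 1 by rewrite expr2; nra.
exists (maxn (Num.truncn (K * C / eta)).+1 (Num.truncn (d%:R / (rho ^+ 2 - 1))).+1) => N.
rewrite geq_max => /andP[h1 h2].
have N0 : (0 < N)%N by exact: leq_ltn_trans h1.
have NR : 0 < (N%:R : R) by rewrite ltr0n.
split; last first.
  have : d%:R / (rho ^+ 2 - 1) <= N%:R.
    by rewrite ltW// (lt_le_trans (truncnS_gt _))// ler_nat.
  by rewrite ler_pdivrMr// natrD; lra.
have hN : K * C / eta <= N%:R.
  by rewrite ltW// (lt_le_trans (truncnS_gt _))// ler_nat.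
have tK : tail_factor N d rho <= K / N%:R.
  have Nd : (N + d)%:R ^+ 2 <= (N%:R * (1 + d%:R)) ^+ 2 :> R.
    rewrite lerXn2r ?nnegrE ?mulr_ge0 ?addr_ge0// natrD mulrDr mulr1 lerD2l.
    by rewrite ler_peMl// ler1n.
  have := @poisson_mass_le1 R (l * N%:R) 4 (mulr_ge0 (ltW l0) (ltW NR)).
  have -> : poisson_mass (l * N%:R) 4 = k ^+ N * (l * N%:R) ^+ 4 / 24.
    rewrite /poisson_mass kE -expRM_natl mulrA (_ : 4`! = 24)%N//.
    by congr (expR _ * _ / _); ring.
  rewrite -(prednK N0) exprSr (prednK N0) => hp.
  have hk : k ^+ N.-1 <= 24 / k / (l * N%:R) ^+ 4.
    rewrite ler_pdivlMr ?exprn_gt0 ?mulr_gt0// ler_pdivlMr//.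
    by move: hp; rewrite ler_pdivrMr//; lra.
  apply: (@le_trans _ _ ((N%:R * (1 + d%:R)) ^+ 2 * (N%:R * (24 / k / (l * N%:R) ^+ 4) * expR 1))).
    apply: ler_pM => //.
      by rewrite !mulr_ge0 ?exprn_ge0 ?expR_ge0// ltW.
    by rewrite ler_wpM2r ?expR_ge0// ler_wpM2l.
  rewrite le_eqVlt; apply/orP; left; apply/eqP; rewrite /K; field.
  by rewrite !gt_eqF.
apply: le_trans (ler_wpM2r C0 tK) _.
clearbody K; move: hN; rewrite ler_pdivrMr// mulrAC ler_pdivrMr// [eta * _]mulrC.
exact.
Qed.

End GinibreTail.

(** * Polynomial approximation of powers of the distance to an exterior point *)

Section PowerApproximation.
Local Open Scope classical_set_scope.
Context {R : realType}.
Implicit Types (u v z w : R[i]) (p : {poly R[i]}).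

Lemma ReV w : Re w^-1 = Re w / cnorm w ^+ 2.
Proof. by rewrite sqr_cnorm; case: w. Qed.

Lemma ImV w : Im w^-1 = - (Im w / cnorm w ^+ 2).
Proof. by rewrite sqr_cnorm; case: w. Qed.

Lemma poly_bounded p (M : R) : exists2 V : R, 0 <= V &
  forall z, cnorm z <= M -> cnorm p.[z] <= V.
Proof.
elim/poly_ind: p => [|p k [V V0 IH]].
  by exists 0 => // z _; rewrite horner0 cnorm0.
exists (V * `|M| + cnorm k) => [|z zM]; first by rewrite addr_ge0 ?mulr_ge0 ?cnorm_ge0.
rewrite hornerMXaddC; apply: le_trans (cnormD _ _) _; rewrite lerD2r cnormM.
apply: ler_pM; rewrite ?cnorm_ge0// ?IH//.
exact: le_trans zM (ler_norm _).
Qed.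

Lemma poly_continuous p z (eps : R) : 0 < eps -> exists2 delta : R, 0 < delta &
  forall w, cnorm (w - z) <= delta -> cnorm (p.[w] - p.[z]) <= eps.
Proof.
elim/poly_ind: p eps => [|p k IH] eps e0.
  by exists 1 => // w _; rewrite !horner0 subrr cnorm0 ltW.
have [V V0 hV] := poly_bounded p (cnorm z + 1).
have z0 : 0 < cnorm z + 1 by rewrite ltr_wpDl ?cnorm_ge0.
have [|d d0 hd] := IH (eps / 2 / (cnorm z + 1)); first by rewrite !divr_gt0.
exists (Num.min (Num.min d 1) (eps / 2 / (V + 1))) => [|w].
  by rewrite !lt_min d0 ltr01 !divr_gt0// ltr_wpDl.
rewrite !le_min -andbA => /and3P[wd w1 wV]; rewrite !hornerMXaddC.
have -> : p.[w] * w + k - (p.[z] * z + k) = (p.[w] - p.[z]) * z + p.[w] * (w - z) by ring.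
apply: le_trans (cnormD _ _) _; rewrite [leRHS]splitr !cnormM; apply: lerD.
  have := hd w wd; rewrite ler_pdivlMr// => h; apply: le_trans h.
  by rewrite ler_wpM2l ?cnorm_ge0// lerDl.
have hw : cnorm p.[w] <= V.
  apply: hV; rewrite -(subrK z w) addrC; apply: le_trans (cnormD _ _) _.
  by rewrite lerD2l.
move: wV; rewrite ler_pdivlMr ?ltr_wpDl// mulrC => h; apply: le_trans h.
by apply: ler_pM; rewrite ?cnorm_ge0//; apply: (le_trans hw); rewrite lerDl.
Qed.

(** The Taylor polynomial of [- log (1 - v)]. *)
Definition logs d v : R[i] := \sum_(k < d) v ^+ k.+1 / (k.+1)%:R.

Lemma cderiv_logs f f' d : cderiv f f' ->
  cderiv (fun t : R => logs d (f t)) (fun t => f' t * \sum_(k < d) f t ^+ k).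
Proof.
move=> hf; elim: d => [|d IH].
  apply: (cderiv_ext (cderiv_eq (cderiv_cst 0) _)) => t; last by rewrite /logs big_ord0.
  by rewrite big_ord0 mulr0.
apply: (cderiv_ext (cderiv_eq (cderivD IH (cderivM (cderivX d.+1 hf) (cderiv_cst d.+1%:R^-1))) _)) => t.
  rewrite big_ord_recr /=.
  have d0 : (d.+1%:R : R[i]) != 0 by rewrite pnatr_eq0.
  by move: (d.+1%:R) d0 => D D0; field.
by rewrite /logs big_ord_recr.
Qed.

(** Only the modulus of [1 - u] occurs, so no branch of the logarithm is needed. Along [x = t u] the
    geometric sum collapses the derivative of the quantity to [- Re (u x ^ d / (1 - x))], which is
    bounded directly. *)
Lemma log_approx_at (th : R) d u : 0 <= th -> th < 1 -> cnorm u <= th ->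
  `|ln (cnorm (1 - u)) + Re (logs d u)| <= th ^+ d / (1 - th).
Proof.
move=> th0 th1 uth.
have tu (t : R) : 0 <= t <= 1 -> cnorm (t%:C * u) <= th.
  move=> /andP[t0 t1]; rewrite cnormM cnorm_real ger0_norm//; apply: le_trans uth.
  by rewrite ler_piMl ?cnorm_ge0.
have pos (t : R) : 0 <= t <= 1 -> 1 - th <= cnorm (1 - t%:C * u).
  move=> /tu h; have := cnormD (1 - t%:C * u) (t%:C * u); rewrite subrK cnorm1.
  by lra.
pose sq (t : R) := (1 - t * Re u) ^+ 2 + (t * Im u) ^+ 2.
have sqE t : sq t = cnorm (1 - t%:C * u) ^+ 2.
  by rewrite sqr_cnorm ReB ImB ReZ ImZ /= /sq sub0r sqrrN.
have sq0 (t : R) : 0 <= t <= 1 -> 0 < sq t.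
  by move=> /pos h; rewrite sqE exprn_gt0//; lra.
pose dsq (t : R) := - 2 * (1 - t * Re u) * Re u + 2 * (t * Im u) * Im u.
have Dsq (t : R) : is_derive t 1 sq (dsq t).
  by apply: is_derive_eq; rewrite /dsq /GRing.scale /=; ring.
have dl := cderiv_logs d (cderiv_affine 0 u).
pose G (t : R) := 2^-1 * ln (sq t) + Re (logs d (0 + t%:C * u)).
pose g (t : R) := 2^-1 * (dsq t * (sq t)^-1) + Re (u * \sum_(k < d) (0 + t%:C * u) ^+ k).
have DG (t : R) : 0 <= t <= 1 -> is_derive t 1 G (g t).
  move=> t01; have [dR _] := dl t.
  have dln := is_derive1_comp (is_derive1_ln (sq0 t t01)) (Dsq t).
  apply: (@is_deriveD _ _ _ (fun t => 2^-1 * ln (sq t)) (fun t => Re (logs d (0 + t%:C * u)))).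
  have := is_deriveZ 2^-1 dln; rewrite [_ * dsq t]mulrC; exact.
have cG : {within `[0, 1]%classic, continuous G}.
  apply: derivable_within_continuous => t; rewrite in_itv /= => t01.
  by have [] := DG t t01.
have [t|c] := @MVT_segment R G g 0 1 ler01 _ cG.
  by rewrite in_itv /= => /andP[t0 t1]; apply: DG; rewrite !ltW.
rewrite in_itv /= => c01; rewrite subr0 mulr1.
have G0 : G 0 = 0.
  rewrite /G /sq !mul0r subr0 expr1n expr0n /= addr0 ln1 mulr0 add0r add0r.
  by rewrite /logs big1// => k _; rewrite expr0n mul0r.
have G1 : G 1 = ln (cnorm (1 - u)) + Re (logs d u).
  rewrite /G sqE mul1r add0r lnXn; last first.
    by have := pos 1; rewrite ler01 lexx mul1r => /(_ isT); lra.
  by rewrite -[ln _ *+ 2]mulr_natl mulrA mulVf ?mul1r// pnatr_eq0.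
rewrite G0 G1 subr0 => ->; set x := c%:C * u; have x1 := tu c c01; have x2 := pos c c01.
rewrite -/x in x1 x2.
have xn0 : 1 - x != 0.
  by apply: contraTneq x2 => ->; rewrite cnorm0 -ltNge subr_gt0.
have -> : g c = Re (- (u * x ^+ d / (1 - x))).
  rewrite /g add0r -/x; have -> : 2^-1 * (dsq c * (sq c)^-1) = Re (- (u / (1 - x))).
    rewrite sqE -/x ReN ReM ReV ImV /dsq.
    have -> : Re (1 - x) = 1 - c * Re u by rewrite ReB ReZ.
    have -> : Im (1 - x) = - (c * Im u) by rewrite ImB ImZ /= sub0r.
    by field; rewrite gt_eqF//; lra.
  rewrite -ReD; congr complex.Re.
  have := subrX1 x d; set S := \sum_(k < d) _ => h.
  have -> : x ^+ d = 1 + (x - 1) * S by rewrite -h; ring.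
  by field.
apply: le_trans (norm_Re_le _) _; rewrite cnormN !cnormM cnormX cnormV.
have u1 : cnorm u <= 1 by lra.
apply: ler_pM.
- by rewrite mulr_ge0 ?exprn_ge0 ?cnorm_ge0.
- by rewrite invr_ge0 cnorm_ge0.
- rewrite -[leRHS]mul1r; apply: ler_pM; rewrite ?exprn_ge0 ?cnorm_ge0//.
  by rewrite lerXn2r ?nnegrE ?cnorm_ge0.
- by rewrite lef_pV2 ?posrE//; lra.
Qed.

Lemma power_small (th eps : R) : 0 <= th -> th < 1 -> 0 < eps ->
  exists d : nat, th ^+ d <= eps.
Proof.
move=> t0 t1 e0; have h : `|th| < 1 by rewrite ger0_norm.
have /cvgrPdist_le/(_ _ e0)[d _ /(_ d (leqnn d))] := cvg_expr h.
by rewrite sub0r normrN ger0_norm ?exprn_ge0//; exists d.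
Qed.

(** A polynomial replacement for the exponential, with multiplicative error. Write
    [|1 + v / m| ^ 2 = 1 + y], where [m y = 2 Re v + |v| ^ 2 / m], and raise
    [exp (y - 2 y ^ 2) <= 1 + y <= exp y] to the power [m]. The lower bound needs [|y| <= 1/2], that
    is [m >= 2 W]. *)
Lemma exp_power_approx (V eps : R) : 0 <= V -> 0 < eps -> exists2 m : nat, (0 < m)%N &
  forall v, cnorm v <= V ->
  expR (- eps) <= cnorm ((1 + v / m%:R) ^+ m) ^+ 2 * expR (- (2 * Re v)) <= expR eps.
Proof.
move=> V0 e0; pose W := 2 * V + V ^+ 2.
have W0 : 0 <= W by rewrite addr_ge0 ?mulr_ge0 ?exprn_ge0.
pose B := Num.max (Num.max (2 * W) 1) ((V ^+ 2 + 2 * W ^+ 2) / eps).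
exists (Num.truncn B).+1 => // v vV; set m := _.+1.
have : B <= m%:R by rewrite ltW// truncnS_gt.
rewrite !ge_max -andbA => /and3P[mW m1 mE].
have m0 : 0 < (m%:R : R) by [].
have mC : (m%:R : R[i]) != 0 by rewrite pnatr_eq0.
pose y := 2 * Re v / m%:R + cnorm v ^+ 2 / m%:R ^+ 2.
have hy : cnorm (1 + v / m%:R) ^+ 2 = 1 + y.
  rewrite -real_complex_nat -real_complexV sqr_cnorm ReD ImD mulrC ReZ ImZ /= /y sqr_cnorm.
  by field; rewrite gt_eqF.
have rv := le_trans (norm_Re_le v) vV; have v0 := cnorm_ge0 v.
have vv : cnorm v ^+ 2 <= V ^+ 2 by rewrite lerXn2r ?nnegrE.
have yW : `|y| <= W / m%:R.
  rewrite /y; apply: le_trans (ler_normD _ _) _; rewrite /W [leRHS]mulrDl; apply: lerD.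
    rewrite normrM normrM ger0_norm// [X in _ * X]ger0_norm ?invr_ge0//.
    by rewrite ler_wpM2r ?invr_ge0// ler_wpM2l.
  rewrite ger0_norm ?divr_ge0 ?sqr_ge0// ?exprn_ge0//; apply: ler_pM; rewrite ?sqr_ge0 ?invr_ge0 ?exprn_ge0//.
  by rewrite lef_pV2 ?posrE ?exprn_gt0// expr2 ler_peMr// ltW.
have W2 : W / m%:R <= 2^-1 by rewrite ler_pdivrMr//; lra.
move: (yW); rewrite ler_norml => /andP[y1 y2].
have y0 : 0 < 1 + y by lra.
have my : m%:R * y = 2 * Re v + cnorm v ^+ 2 / m%:R by rewrite /y; field; rewrite gt_eqF.
have y2W : y ^+ 2 <= (W / m%:R) ^+ 2.
  by rewrite -[y ^+ 2]real_normK ?num_real// lerXn2r ?nnegrE ?divr_ge0.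
have m2y : m%:R * (2 * y ^+ 2) <= 2 * W ^+ 2 / m%:R.
  apply: (@le_trans _ _ (m%:R * (2 * (W / m%:R) ^+ 2))); first by rewrite !ler_wpM2l.
  by rewrite le_eqVlt; apply/orP; left; apply/eqP; field; rewrite gt_eqF.
have mEe : V ^+ 2 / m%:R + 2 * W ^+ 2 / m%:R <= eps.
  by move: mE; rewrite -mulrDl !ler_pdivrMr// [eps * _]mulrC.
have q1 : 0 <= V ^+ 2 / m%:R by rewrite divr_ge0 ?sqr_ge0.
have q2 : 0 <= 2 * W ^+ 2 / m%:R by rewrite divr_ge0 ?mulr_ge0 ?sqr_ge0.
have q3 : cnorm v ^+ 2 / m%:R <= V ^+ 2 / m%:R by rewrite ler_wpM2r ?invr_ge0.
have q4 : 0 <= cnorm v ^+ 2 / m%:R by rewrite divr_ge0 ?sqr_ge0.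
rewrite cnormX -exprM mulnC exprM hy; apply/andP; split.
- have lo : expR (y - 2 * y ^+ 2) <= 1 + y.
    apply: (@le_trans _ _ (expR (y / (1 + y)))).
      rewrite ler_expR ler_pdivlMr//.
      have := sqr_ge0 y; nra.
    rewrite -[leLHS]invrK -expRN -[leRHS]invrK lef_pV2 ?posrE ?invr_gt0 ?expR_gt0//.
    apply: le_trans (expR_ge1Dx _); rewrite le_eqVlt; apply/orP; left; apply/eqP.
    by field; rewrite gt_eqF.
  apply: (@le_trans _ _ (expR (y - 2 * y ^+ 2) ^+ m * expR (- (2 * Re v)))).
    rewrite -expRM_natl -expRD ler_expR mulrBr my; lra.
  by rewrite ler_wpM2r ?expR_ge0// lerXn2r ?nnegrE ?expR_ge0// ltW.
- apply: (@le_trans _ _ (expR y ^+ m * expR (- (2 * Re v)))).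
    by rewrite ler_wpM2r ?expR_ge0// lerXn2r ?nnegrE ?expR_ge0 ?(ltW y0)// expR_ge1Dx.
  by rewrite -expRM_natl -expRD ler_expR my; lra.
Qed.

(** [(a - z) ^ c] is [a ^ c exp (c log (1 - z / a))]. The logarithm is replaced by its Taylor
    polynomial and the exponential by a power, each with error [eps / 2]. The sign of [c] is free,
    so the same lemma serves the inverse. *)
Lemma power_poly_approx (a rho c eps : R) : 0 < rho -> rho < a -> 0 < eps ->
  exists h : {poly R[i]}, forall z, cnorm z <= rho ->
  expR (- eps) <= cnorm h.[z] ^+ 2 * expR (- (2 * c * ln (cnorm (z - a%:C)))) <= expR eps.
Proof.
move=> rho0 ra e0; have a0 : 0 < a by lra.
pose th := rho / a; have th0 : 0 <= th by rewrite divr_ge0 ?ltW.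
have th1 : th < 1 by rewrite ltr_pdivrMr ?mul1r.
(* The summand 1 keeps the division by [C] meaningful when [c = 0]. *)
pose C := 2 * `|c| + 1; have C0 : 0 < C by rewrite ltr_wpDl ?mulr_ge0.
have [|d hd] := @power_small th (eps / 2 / C * (1 - th)) th0 th1.
  by rewrite mulr_gt0 ?subr_gt0// !divr_gt0.
pose L : {poly R[i]} := - \sum_(k < d) (k.+1%:R^-1) *: 'X^(k.+1).
have LE u : L.[u] = - logs d u.
  rewrite hornerN horner_sum; congr (- _); apply: eq_bigr => k _.
  by rewrite hornerZ hornerXn mulrC.
have [V V0 hV] := poly_bounded (c%:C *: L) 1.
have [|m m0 hm] := @exp_power_approx V (eps / 2) V0; first by rewrite divr_gt0.
pose h0 : {poly R[i]} := (1 + m%:R^-1 *: (c%:C *: L)) ^+ m.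
exists ((expR (c * ln a))%:C *: (h0 \Po (a%:C^-1 *: 'X))) => z zr.
pose u := z / a%:C.
have aC : a%:C != 0 by rewrite real_complex_neq0// gt_eqF.
have uth : cnorm u <= th.
  by rewrite /u cnormM cnormV cnorm_real gtr0_norm// ler_wpM2r// invr_ge0 ltW.
have hE : ((expR (c * ln a))%:C *: (h0 \Po (a%:C^-1 *: 'X))).[z] =
    (expR (c * ln a))%:C * (1 + (c%:C * L.[u]) / m%:R) ^+ m.
  rewrite hornerZ horner_comp hornerZ hornerX [a%:C^-1 * z]mulrC -/u /h0.
  by rewrite horner_exp hornerD hornerZ hornerZ hornerC [m%:R^-1 * _]mulrC.
rewrite hE cnormM cnorm_real ger0_norm ?expR_ge0// exprMn -[expR _ ^+ 2]expRM_natl.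
have vV : cnorm (c%:C * L.[u]) <= V.
  by have := hV u; rewrite hornerZ; apply; lra.
have := hm _ vV; set A := cnorm _ ^+ 2; rewrite ReZ.
have u1 : 0 < cnorm (1 - u).
  have := cnormD (1 - u) u; rewrite subrK cnorm1; lra.
have -> : ln (cnorm (z - a%:C)) = ln a + ln (cnorm (1 - u)).
  rewrite -lnM ?posrE//; congr ln.
  rewrite -[X in X * _]gtr0_norm// -cnorm_real -cnormM cnorm_distC; congr cnorm.
  by rewrite /u; field.
have := log_approx_at d th0 th1 uth.
have hd2 : th ^+ d / (1 - th) <= eps / 2 / C by rewrite ler_pdivrMr// subr_gt0.
move=> /le_trans/(_ hd2); rewrite LE ReN; set l := ln _; set r := Re _ => hl.
have cl : `|2 * c * (l + r)| <= eps / 2.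
  rewrite normrM normrM ger0_norm//.
  apply: (@le_trans _ _ (C * (eps / 2 / C))); last by rewrite mulrC divfK// gt_eqF.
  by apply: ler_pM; rewrite ?mulr_ge0// /C lerDl.
move: cl; rewrite ler_norml => /andP[cl1 cl2] /andP[A1 A2].
have -> : expR (2 * (c * ln a)) * A * expR (- (2 * c * (ln a + l))) =
    A * expR (- (2 * (c * - r))) * expR (- (2 * c * (l + r))).
  have -> : - (2 * c * (ln a + l)) = - (2 * (c * ln a)) + (- (2 * (c * - r)) + - (2 * c * (l + r))) by ring.
  rewrite [expR (- (2 * (c * ln a)) + _)]expRD expRN [expR (_ + _)]expRD.
  by field; rewrite gt_eqF// expR_gt0.
have -> : expR (- eps) = expR (- (eps / 2)) * expR (- (eps / 2)).
  by rewrite -expRD -opprD -splitr.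
have -> : expR eps = expR (eps / 2) * expR (eps / 2) by rewrite -expRD -splitr.
by apply/andP; split; apply: ler_pM;
  rewrite ?expR_ge0 ?mulr_ge0 ?expR_ge0 ?sqr_ge0 ?cnorm_ge0 ?ler_expR//; lra.
Qed.

End PowerApproximation.

(** * The Ginibre kernel at the edge *)

Section GinibreEdge.
Context {R : realType}.
Implicit Types (z w : R[i]).

Lemma erfc_lip (M : R) : 0 <= M -> exists2 C : R, 0 <= C &
  forall z w, cnorm z <= M -> cnorm w <= M ->
  cnorm (erfc (z / (Num.sqrt 2)%:C) / 2 - erfc (w / (Num.sqrt 2)%:C) / 2) <= C * cnorm (z - w).
Proof.
move=> M0; have [C C0 hC] := gaussE_lip M0.
exists (Num.sqrt (2 / pi) / 2 * C) => [|z w zM wM]; first by rewrite !mulr_ge0 ?invr_ge0 ?sqrtr_ge0.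
rewrite /erfc !erf_gaussE.
have -> : (1 - (Num.sqrt (2 / pi))%:C * gaussE z) / 2 - (1 - (Num.sqrt (2 / pi))%:C * gaussE w) / 2 =
    (Num.sqrt (2 / pi))%:C / 2 * (gaussE w - gaussE z) by ring.
rewrite !cnormM cnormV cnorm_real cnorm_nat ger0_norm ?sqrtr_ge0// -[leRHS]mulrA.
by rewrite ler_wpM2l ?divr_ge0 ?sqrtr_ge0// cnorm_distC hC.
Qed.

(** A bounded discrepancy between the truncation [n] and [N] does not change the limit: recentred at
    [n], the argument is [n + sqrt n s] with [s = z + w + O(1 / sqrt n)], and [erfc] is Lipschitz on
    discs. In the application [w] is a conjugate. *)
Lemma gammaQ_near (r : R) (d : nat) (eps : R) : 0 <= r -> 0 < eps ->
  exists N0 : nat, forall N n, (N0 <= N)%N -> (N <= n + d)%N -> (n <= N + d)%N ->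
  forall z w, cnorm z <= r -> cnorm w <= r ->
  cnorm (gammaQ n (N%:R + (Num.sqrt N%:R)%:C * (z + w) + z * w) -
         erfc ((z + w) / (Num.sqrt 2)%:C) / 2) <= eps.
Proof.
move=> r0 e0; have e2 : 0 < eps / 2 by rewrite divr_gt0.
pose M := 2 * r + 1; have M0 : 0 <= M by rewrite addr_ge0 ?mulr_ge0.
have [n1 h1] := gammaQ_erfc M0 e2; have [C C0 hC] := erfc_lip M0.
(* Bounds the numerator of [s - (z + w)], using that both [|N - n|] and the difference of the square
   roots are at most [d]. *)
pose B := d%:R * (2 * r) + r ^+ 2 + d%:R.
have B0 : 0 <= B by rewrite !(addr_ge0, mulr_ge0) ?exprn_ge0.
pose D := Num.max B (C * B / (eps / 2)).
have [n2 h2] := @sqrtS_ge_near R D.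
exists (maxn n1 n2.+1 + d)%N => N n nN Nn nNd z w zr wr.
have n1n : (n1 <= n)%N.
  by rewrite -(leq_add2r d) (leq_trans _ Nn)// (leq_trans _ nN)// leq_add2r leq_maxl.
have n2n : (n2 < n)%N.
  by rewrite -(ltn_add2r d) (leq_trans _ Nn)// (leq_trans _ nN)// -addSn leq_add2r leq_maxr.
case: n n1n n2n Nn nNd => // n n1n n2n Nn nNd.
have := h2 n n2n; rewrite ge_max; set q : R := Num.sqrt n.+1%:R => /andP[Bq Cq].
have q0 : 0 < q := sqrtS_gt0 n.
have qq : q * q = n.+1%:R := sqr_sqrtS n.
have q1 : 1 <= q by rewrite -(sqrtr1 R) ler_sqrt ?ler1n// ?ler0n.
set k : R := Num.sqrt N%:R; have k0 : 0 <= k by exact: sqrtr_ge0.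
have kk : k * k = N%:R by rewrite -expr2 sqr_sqrtr.
have dN : `|N%:R - n.+1%:R| <= d%:R :> R.
  have c1 : N%:R <= n.+1%:R + d%:R :> R by rewrite -natrD ler_nat.
  have c2 : n.+1%:R <= N%:R + d%:R :> R by rewrite -natrD ler_nat.
  by rewrite ler_norml; apply/andP; split; lra.
have dk : `|k - q| <= d%:R.
  have kq : 1 <= k + q by lra.
  have : `|k - q| * (k + q) <= d%:R.
    rewrite -[X in _ * X]ger0_norm; last lra.
    have E : (k - q) * (k + q) = N%:R - n.+1%:R by rewrite -kk -qq; ring.
    by rewrite -normrM E.
  apply: le_trans; by rewrite ler_peMr.
have qC : q%:C != 0 by rewrite real_complex_neq0// gt_eqF.
pose s := z + w + ((k - q)%:C * (z + w) + z * w + (N%:R - n.+1%:R)%:C) / q%:C.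
have sE : N%:R + k%:C * (z + w) + z * w = n.+1%:R + q%:C * s.
  have -> : q%:C * s = q%:C * (z + w) + ((k - q)%:C * (z + w) + z * w + (N%:R - n.+1%:R)%:C).
    by rewrite /s; field.
  by rewrite !real_complexB !real_complex_nat; ring.
have zw : cnorm (z + w) <= 2 * r by rewrite (le_trans (cnormD _ _))//; lra.
have ds : cnorm (s - (z + w)) <= B / q.
  rewrite (_ : s - (z + w) = ((k - q)%:C * (z + w) + z * w + (N%:R - n.+1%:R)%:C) / q%:C); last by rewrite /s; ring.
  rewrite cnormM cnormV (cnorm_real q) (gtr0_norm q0) ler_pM2r ?invr_gt0//.
  apply: le_trans (cnormD _ _) _; rewrite cnorm_real lerD//.
  apply: le_trans (cnormD _ _) _; rewrite !cnormM cnorm_real lerD//.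
    by apply: ler_pM; rewrite ?cnorm_ge0.
  by rewrite expr2; apply: ler_pM; rewrite ?cnorm_ge0.
have Bq1 : B / q <= 1 by rewrite ler_pdivrMr// mul1r.
have sM : cnorm s <= M.
  rewrite -(subrK (z + w) s); apply: le_trans (cnormD _ _) _; rewrite /M; lra.
have zwM : cnorm (z + w) <= M by rewrite /M; lra.
rewrite sE; have := h1 n.+1 s n1n sM; have := hC s (z + w) sM zwM.
set X := erfc _ / 2; set Y := erfc _ / 2; set G := gammaQ _ _ => b1 b2.
rewrite (_ : G - Y = (G - X) + (X - Y)); last by ring.
apply: le_trans (cnormD _ _) _; rewrite [leRHS]splitr lerD//.
apply: (le_trans b1); apply: (le_trans (ler_wpM2l C0 ds)).
by move: Cq; rewrite mulrA !ler_pdivrMr// [eps / 2 * q]mulrC.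
Qed.

(** The modulus is in fact [exp (- |z - w| ^ 2 / 2)]. *)
Lemma cnorm_Gker z w : cnorm (Gker z w) <= 1.
Proof.
rewrite /Gker cnorm_cexp -[leRHS]expR0 ler_expR !ReB ReM Re_conj Im_conj /= !sqr_cnorm.
have := sqr_ge0 (Re z - Re w); have := sqr_ge0 (Im z - Im w); rewrite !sqrrB. lra.
Qed.

Definition edge_point (p : R[i]) (N : nat) z : R[i] := p + p * z / (Num.sqrt N%:R)%:C.

Definition edge_phase (N : nat) z : R[i] := cexp (0 +i* (- (Num.sqrt N%:R * Im z))).

Lemma cnorm_edge_phase N z : cnorm (edge_phase N z) = 1.
Proof. by rewrite cnorm_cexp expR0. Qed.

Lemma cont_unimodular_edge_phase N : cont_unimodular (edge_phase N).
Proof.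
split=> [z|z eps e0]; first exact: cnorm_edge_phase.
set k : R := Num.sqrt N%:R; have k0 : 0 <= k by exact: sqrtr_ge0.
pose K := 2 * (k + 1) * expR k; have K0 : 0 < K.
  by rewrite !mulr_gt0 ?expR_gt0// ltr_wpDl.
exists (Num.min 1 (eps / K)) => [|w]; first by rewrite lt_min ltr01 divr_gt0.
rewrite lt_min => /andP[w1 wK].
pose t : R[i] := 0 +i* (- (k * Im (w - z))).
have -> : edge_phase N w - edge_phase N z = edge_phase N z * (cexp t - 1).
  rewrite mulrBr mulr1 /edge_phase -cexpD; congr (cexp _ - _).
  by apply: complex_ext; rewrite ?ReD ?ImD /= ?ImB -/k; ring.
rewrite cnormM cnorm_edge_phase mul1r; apply: le_lt_trans (cexp_sub1 _) _.
have tn : cnorm t <= k * cnorm (w - z).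
  apply: le_trans (cnorm_le_ReIm _) _; rewrite /= normr0 add0r normrN normrM ger0_norm//.
  by rewrite ler_wpM2l// norm_Im_le.
have tk : cnorm t <= k by apply: (le_trans tn); rewrite ler_piMr// ltW.
move: wK; rewrite ltr_pdivlMr// => wK; apply: le_lt_trans wK.
rewrite /K !mulrA ler_pM ?mulr_ge0 ?cnorm_ge0 ?expR_ge0 ?ler_expR//.
have := cnorm_ge0 (w - z); nra.
Qed.

(** The point [p] enters only through [p * conjc p = 1], so the limit is the same all along the
    circle. *)
Lemma edge_product (p : R[i]) N z w : (0 < N)%N -> cnorm p = 1 ->
  N%:R * (edge_point p N z * conjc (edge_point p N w)) =
  N%:R + (Num.sqrt N%:R)%:C * (z + conjc w) + z * conjc w.
Proof.
move=> N0 p1; rewrite /edge_point; case: N N0 => // N _; set k : R := Num.sqrt N.+1%:R.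
have k0 : k%:C != 0 by rewrite real_complex_neq0// gt_eqF// sqrtS_gt0.
have kk : (N.+1%:R : R[i]) = k%:C * k%:C by rewrite -real_complexM sqr_sqrtS real_complex_nat.
have pp : p * conjc p = 1 by rewrite mulcJ p1 expr1n.
rewrite -real_complexV conjcD !conjcM conjcR.
transitivity (N.+1%:R * (p * conjc p) * ((1 + z * (k^-1)%:C) * (1 + conjc w * (k^-1)%:C))); first by ring.
by rewrite pp real_complexV kk; field.
Qed.

Definition ginibre_weight (N : nat) z : R := expR (- (N%:R / 2 * cnorm z ^+ 2)).

Lemma ginibre_weight_sqr N z : ginibre_weight N z ^+ 2 = gaussian N%:R z.
Proof. by rewrite /ginibre_weight -expRM_natl; congr expR; field. Qed.

(** Normalised so that the Gram sums over [j < n] are the Ginibre kernel of size [n] divided by [N];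
    the sizes [N - d] and [N + d] thus share their entries. *)
Definition ginibre_vec (N : nat) z j : R[i] :=
  (ginibre_weight N z / Num.sqrt N%:R)%:C * (ginibre_basis N j).[z].

Lemma ginibre_gram N n z w : (0 < N)%N ->
  \sum_(j < n) ginibre_vec N z j * conjc (ginibre_vec N w j) =
  (ginibre_weight N z * ginibre_weight N w)%:C * cexps n (N%:R * (z * conjc w)).
Proof.
move=> N0; rewrite /cexps mulr_sumr; apply: eq_bigr => j _.
have NR : 0 < (N%:R : R) by rewrite ltr0n.
have k0 : Num.sqrt (N%:R : R) != 0 by rewrite gt_eqF// sqrtr_gt0.
have kk : Num.sqrt (N%:R : R) * Num.sqrt N%:R = N%:R by rewrite -expr2 sqr_sqrtr ?ler0n.
rewrite /ginibre_vec !ginibre_basisE !conjcM !conjcR conjcX.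
set x := Num.sqrt (N%:R ^+ j.+1 / _).
have xx : x * x = N%:R ^+ j.+1 / (j`!)%:R by rewrite -expr2 sqr_sqrtr// ltW// ginibre_coef_gt0.
transitivity ((ginibre_weight N z * ginibre_weight N w * (x * x) / (Num.sqrt N%:R * Num.sqrt N%:R))%:C *
    (z ^+ j * conjc w ^+ j)).
  by rewrite invfM !real_complexM; ring.
rewrite kk xx !exprMn exprS !real_complexM !real_complexV real_complexX !real_complex_nat.
by field; rewrite factC_neq0 pnatr_eq0 -lt0n N0.
Qed.

Lemma ginibre_gram_diag N n z : (0 < N)%N ->
  \sum_(j < n) cnorm (ginibre_vec N z j) ^+ 2 = poisson_cdf n (N%:R * cnorm z ^+ 2).
Proof.
move=> N0; apply: (@complexI R); rewrite (rmorph_sum (real_complex R)).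
transitivity (\sum_(j < n) ginibre_vec N z j * conjc (ginibre_vec N z j)).
  by apply: eq_bigr => j _; rewrite mulcJ.
rewrite ginibre_gram// mulcJ -gammaQ_real /gammaQ -expr2 ginibre_weight_sqr /gaussian.
by rewrite -real_complexN cexp_real real_complexM real_complex_nat.
Qed.

(** Exact at every [N]: the two half weights supply the mean of the diagonal exponents, and its
    difference from the exponent [X] in [gammaQ] is [i sqrt N (Im z - Im w)] plus the exponent of
    [Gker]. The cocycle removes the former. *)
Lemma edge_ginibre_gram (p : R[i]) N n z w : (0 < N)%N -> cnorm p = 1 ->
  edge_phase N z * conjc (edge_phase N w) *
    \sum_(j < n) ginibre_vec N (edge_point p N z) j * conjc (ginibre_vec N (edge_point p N w) j) =
  Gker z w * gammaQ n (N%:R + (Num.sqrt N%:R)%:C * (z + conjc w) + z * conjc w).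
Proof.
move=> N0 p1; rewrite ginibre_gram// edge_product//; set X := _ + z * conjc w.
rewrite mulrA /gammaQ mulrA; congr (_ * _).
rewrite /ginibre_weight -expRD -cexp_real /edge_phase conj_cexp /Gker -!cexpD; congr cexp.
have Ez v : N%:R * cnorm (edge_point p N v) ^+ 2 =
    N%:R + Num.sqrt N%:R * (2 * Re v) + cnorm v ^+ 2.
  have C : v + conjc v = (2 * Re v)%:C.
    by apply: complex_ext; rewrite ?ReD ?ImD ?Re_conj ?Im_conj /=; ring.
  apply: (@complexI R); rewrite (real_complexM N%:R) -mulcJ real_complex_nat edge_product// mulcJ.
  by rewrite C -real_complex_nat -real_complexM -!real_complexD.
have -> : - (N%:R / 2 * cnorm (edge_point p N z) ^+ 2) + - (N%:R / 2 * cnorm (edge_point p N w) ^+ 2) =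
    - (N%:R * cnorm (edge_point p N z) ^+ 2 + N%:R * cnorm (edge_point p N w) ^+ 2) / 2 by ring.
rewrite !Ez /X -real_complex_nat.
by apply: complex_ext; rewrite !ReImE /=; field.
Qed.

End GinibreEdge.

(** * Comparison of the point-charge weight with the Gaussian *)

Section PointCharge.
Context {R : realType}.
Variables (a c : R).
Implicit Types (z w : R[i]) (h q f : {poly R[i]}).

(** The function [|z - a| ^ (2 b)], except at [z = a], where [ln 0 = 0] makes it 1. [Qpot] follows
    the same convention, so [weightE] holds at every point. *)
Definition charge (b : R) z : R := expR (2 * b * ln (cnorm (z - a%:C))).

Lemma weightE N z : (0 < N)%N -> weight a c N z = gaussian N%:R z * charge c z.
Proof.
move=> N0; have NR : (N%:R : R) != 0 by rewrite pnatr_eq0 -lt0n.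
by rewrite /weight /Qpot /gaussian /charge -expRD; congr expR; field.
Qed.

Lemma plane_meas_charge b : plane_meas (charge b).
Proof.
apply: measurableT_comp => //; apply: measurable_funM => //.
apply: (@measurableT_comp _ _ _ _ _ _ (@ln R)) => //.
apply: (@plane_meas_cnorm R (fun z => z - a%:C)).
exact: cplane_measD (cplane_meas_id) (cplane_meas_cst _).
Qed.

Lemma plane_meas_weight N : (0 < N)%N -> plane_meas (weight a c N).
Proof.
move=> N0; rewrite (funext (fun z => weightE z N0)).
by apply: measurable_funM; [exact: plane_meas_gaussian|exact: plane_meas_charge].
Qed.

Lemma weight_ge0 N z : 0 <= weight a c N z.
Proof. exact: expR_ge0. Qed.

Variable P : nat -> nat -> {poly R[i]}.
Hypothesis hP : forall N : nat, (0 < N)%N -> orthonormal_polys a c N (P N).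

Let g0 b z : 0 <= gaussian (b : R) z := expR_ge0 _.

Lemma weight_integrable N q : (0 < N)%N ->
  plane_integrable (fun z => cnorm q.[z] ^+ 2 * weight a c N z).
Proof.
move=> N0; have [sz orth] := hP N0.
exact: wnorm_integrable (weight_ge0 N) (plane_meas_weight N0) sz orth q.
Qed.

Lemma gaussian_integrable N q : (0 < N)%N ->
  plane_integrable (fun z => cnorm q.[z] ^+ 2 * gaussian N%:R z).
Proof.
move=> N0; exact: wnorm_integrable (g0 N%:R) (plane_meas_gaussian _)
  (fun j => size_ginibre_basis j N0) (fun j k => ortho_ginibre_basis j k N0) q.
Qed.

Lemma size_mul_le h q N d : (size h <= d)%N -> (size q <= N)%N -> (size (h * q)%R <= N + d)%N.
Proof.
move=> hd qN; apply: (leq_trans (size_polyMleq _ _)).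
by apply: (leq_trans (leq_pred _)); rewrite addnC leq_add.
Qed.

(** Inside the disc the integrands compare pointwise. Outside, the tail of [h * q] is a small
    multiple of its own norm and is absorbed on the left: [1 - exp (- eps)] is the fraction for
    which absorption costs exactly [exp eps]. *)
Lemma norm_upper h (eps rho : R) d : 0 < eps -> 1 < rho -> (size h <= d)%N ->
  (forall z, cnorm z <= rho ->
    cnorm h.[z] ^+ 2 * expR (- (2 * c * ln (cnorm (z - a%:C)))) <= expR eps) ->
  exists N0 : nat, forall N, (N0 <= N)%N -> (0 < N)%N -> forall q, (size q <= N)%N ->
    wnorm2 (gaussian N%:R) (h * q) <= expR (2 * eps) * wnorm2 (weight a c N) q.
Proof.
(* [poly_tail] bounds the tail by an [N]-dependent factor times a fixed function, whose integral is
   [C]. *)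
move=> e0 r1 hd hh; pose C := wnorm2 (gaussian 1) ('X^(d.+1) : {poly R[i]}).
have C0 : 0 <= C by apply: plane_integral_ge0 => z; rewrite mulr_ge0 ?sqr_ge0.
have eta0 : 0 < 1 - expR (- eps).
  by rewrite subr_gt0 -[ltRHS]expR0 ltr_expR oppr_lt0.
have [N0 hN0] := tail_factor_small d r1 C0 eta0.
exists N0 => N /hN0 [tC Nd] N1 q qN; set f := h * q.
have fN : (size f <= N + d)%N by exact: size_mul_le.
set A := wnorm2 _ f; set B := wnorm2 _ q.
have A0 : 0 <= A by apply: plane_integral_ge0 => z; rewrite mulr_ge0 ?sqr_ge0.
have key : A <= expR eps * B + tail_factor N d rho * A * C.
  have iW := weight_integrable q N1; have iG := gaussian_integrable f N1.
  have i1 := gaussian_integrable 'X^(d.+1) (ltn0Sn 0).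
  rewrite /B /C /wnorm2 -(plane_integralZ (expR eps) iW) -(plane_integralZ (_ * A) i1).
  rewrite -plane_integralD; [|exact: plane_integrableZ|exact: plane_integrableZ].
  apply: le_plane_integral => //.
    by apply: plane_integrableD; exact: plane_integrableZ.
  move=> z; have [zr|zr] := leP (cnorm z) rho.
    apply: ler_wpDr.
      apply: mulr_ge0; first by apply: mulr_ge0 => //; exact: tail_factor_ge0.
      by apply: mulr_ge0 => //; exact: sqr_ge0.
    rewrite weightE// hornerM cnormM exprMn.
    have hc : cnorm h.[z] ^+ 2 <= expR eps * charge c z.
      by have := hh z zr; rewrite expRN ler_pdivrMr ?expR_gt0.
    rewrite [leRHS](_ : _ = expR eps * charge c z * (cnorm q.[z] ^+ 2 * gaussian N%:R z)); last by ring.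
    by rewrite -[leLHS]mulrA; apply: ler_wpM2r => //; rewrite mulr_ge0 ?sqr_ge0.
  apply: ler_wpDl; first by rewrite mulr_ge0 ?expR_ge0// mulr_ge0 ?sqr_ge0 ?weight_ge0.
  exact: poly_tail N1 r1 Nd (leqnn _) fN (ltW zr).
have tA : tail_factor N d rho * A * C <= (1 - expR (- eps)) * A.
  by rewrite mulrAC ler_wpM2r.
have h1 : expR (- eps) * A <= expR eps * B by lra.
have -> : expR (2 * eps) = expR eps * expR eps by rewrite -expRD; congr expR; ring.
rewrite -(ler_pM2l (expR_gt0 (- eps))); apply: (le_trans h1).
by rewrite !mulrA [expR (- eps) * _]mulrC expRxMexpNx_1 mul1r.
Qed.

(** Here the tail is measured by the Gaussian norm on the right, so nothing is absorbed. Outside the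
    disc [|h| ^ 2] and the charge multiply the fixed function of [poly_tail]; together they form the
    weight with [N = 1], integrable by [hP]. *)
Lemma norm_lower h (eps rho : R) d : 0 < eps -> 1 < rho ->
  (forall z, cnorm z <= rho ->
    cnorm h.[z] ^+ 2 * expR (- (2 * - c * ln (cnorm (z - a%:C)))) <= expR eps) ->
  exists N0 : nat, forall N, (N0 <= N)%N -> (0 < N)%N -> forall f, (size f <= N + d)%N ->
    wnorm2 (weight a c N) (h * f) <= expR (2 * eps) * wnorm2 (gaussian N%:R) f.
Proof.
move=> e0 r1 hh; pose C := wnorm2 (weight a c 1) (h * 'X^(d.+1)).
have C0 : 0 <= C by apply: plane_integral_ge0 => z; rewrite mulr_ge0 ?sqr_ge0 ?weight_ge0.
have eta0 : 0 < expR (2 * eps) - expR eps.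
  by rewrite subr_gt0 ltr_expR; lra.
have [N0 hN0] := tail_factor_small d r1 C0 eta0.
exists N0 => N /hN0 [tC Nd] N1 f fN.
set A := wnorm2 (gaussian _) f.
have A0 : 0 <= A by apply: plane_integral_ge0 => z; rewrite mulr_ge0 ?sqr_ge0.
have key : wnorm2 (weight a c N) (h * f) <= expR eps * A + tail_factor N d rho * A * C.
  have iW := weight_integrable (h * f) N1; have iG := gaussian_integrable f N1.
  have i1 := weight_integrable (h * 'X^(d.+1)) (ltn0Sn 0).
  rewrite [in X in X + _]/A /C /wnorm2 -(plane_integralZ (expR eps) iG).
  rewrite -(plane_integralZ (tail_factor N d rho * A) i1).
  rewrite -plane_integralD; [|exact: plane_integrableZ|exact: plane_integrableZ].
  apply: le_plane_integral => //.
    by apply: plane_integrableD; exact: plane_integrableZ.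
  move=> z; rewrite !weightE// !hornerM !cnormM !exprMn.
  have H : cnorm h.[z] ^+ 2 * cnorm f.[z] ^+ 2 * (gaussian N%:R z * charge c z) =
    cnorm h.[z] ^+ 2 * charge c z * (cnorm f.[z] ^+ 2 * gaussian N%:R z) by ring.
  rewrite H; have [zr|zr] := leP (cnorm z) rho.
    apply: ler_wpDr.
      apply: mulr_ge0; first by apply: mulr_ge0 => //; exact: tail_factor_ge0.
      by rewrite !mulr_ge0 ?sqr_ge0 ?expR_ge0 ?cnorm_ge0.
    apply: ler_wpM2r; first by rewrite mulr_ge0 ?sqr_ge0.
    by have := hh z zr; rewrite mulrN mulNr opprK.
  apply: ler_wpDl; first by rewrite mulr_ge0 ?expR_ge0// mulr_ge0 ?sqr_ge0.
  have := poly_tail N1 r1 Nd (leqnn _) fN (ltW zr); rewrite -/A => ht.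
  have hc0 : 0 <= cnorm h.[z] ^+ 2 * charge c z by rewrite mulr_ge0 ?sqr_ge0 ?expR_ge0.
  apply: le_trans (ler_wpM2l hc0 ht) _.
  by rewrite le_eqVlt; apply/orP; left; apply/eqP; ring.
apply: (le_trans key).
have : tail_factor N d rho * A * C <= (expR (2 * eps) - expR eps) * A.
  by rewrite mulrAC ler_wpM2r.
lra.
Qed.

End PointCharge.

(** * Gram matrices *)

Section Gram.
Context {R : realType}.
Implicit Types (x y X Y : nat -> R[i]).

Lemma gram_expand n x y (al be : R[i]) :
  \sum_(j < n) cnorm (al * x j + be * y j) ^+ 2 =
  cnorm al ^+ 2 * \sum_(j < n) cnorm (x j) ^+ 2 +
  cnorm be ^+ 2 * \sum_(j < n) cnorm (y j) ^+ 2 +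
  2 * Re (al * conjc be * \sum_(j < n) x j * conjc (y j)).
Proof.
rewrite !mulr_sumr Re_sum mulr_sumr -!big_split; apply: eq_bigr => j _ /=.
by rewrite !sqr_cnorm !ReImE; ring.
Qed.

Lemma gram_le_mean n x y :
  cnorm (\sum_(j < n) x j * conjc (y j)) <=
  (\sum_(j < n) cnorm (x j) ^+ 2 + \sum_(j < n) cnorm (y j) ^+ 2) / 2.
Proof.
rewrite -big_split /= mulr_suml; apply: le_trans (cnorm_sum _ _ _) _.
apply: ler_sum => j _; rewrite cnormM cnorm_conj.
by have := sqr_ge0 (cnorm (x j) - cnorm (y j)); rewrite sqrrB; lra.
Qed.

(* A positive semidefinite 2x2 matrix has its off-diagonal entry bounded by the
   mean of the diagonal ones. *)
Lemma gram_dist n m x y X Y (delta : R) :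
  (forall al be : R[i], \sum_(j < n) cnorm (al * x j + be * y j) ^+ 2 <=
     \sum_(j < m) cnorm (al * X j + be * Y j) ^+ 2) ->
  \sum_(j < m) cnorm (X j) ^+ 2 - \sum_(j < n) cnorm (x j) ^+ 2 <= delta ->
  \sum_(j < m) cnorm (Y j) ^+ 2 - \sum_(j < n) cnorm (y j) ^+ 2 <= delta ->
  cnorm (\sum_(j < m) X j * conjc (Y j) - \sum_(j < n) x j * conjc (y j)) <= delta.
Proof.
move=> hle; set D := _ - \sum_(j < n) x j * conjc (y j).
have [D0|D0] := eqVneq D 0 => hx hy.
  rewrite D0 cnorm0; apply: le_trans hx; rewrite subr_ge0.
  have c0 : conjc 0 = 0 :> R[i] by apply: complex_ext => //=; rewrite oppr0.
  have := hle 1 0; rewrite !gram_expand cnorm1 cnorm0 c0 !expr1n !expr0n /= !mul1r !mul0r.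
  by rewrite mulr0 !addr0.
have Dn := cnorm_gt0 D0.
(* The unimodular number turning the cross term into [- |D|], which makes the positivity of the
   difference form say the most. *)
pose al : R[i] := - conjc D / (cnorm D)%:C.
have aln : cnorm al = 1.
  by rewrite cnormM cnormN cnorm_conj cnormV cnorm_real gtr0_norm// divff// gt_eqF.
have alD : al * D = (- cnorm D)%:C.
  rewrite /al real_complexN mulrAC mulNr [conjc D * D]mulrC mulcJ real_complexX.
  by field; rewrite real_complex_neq0// gt_eqF.
have := hle al 1; rewrite !gram_expand aln cnorm1 !expr1n !mul1r.
rewrite (_ : conjc 1 = 1 :> R[i]); last by apply: complex_ext => //=; rewrite oppr0.
have : Re (al * \sum_(j < m) X j * conjc (Y j)) - Re (al * \sum_(j < n) x j * conjc (y j)) = - cnorm D.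
  by rewrite -ReB -mulrBr alD.
rewrite !mulr1; lra.
Qed.

(** Replaces any knowledge of the argument of [h1]: nearby nonzero values have nearly equal phases,
    so the unimodular quotient is near 1. *)
Lemma phase_quotient_near (A B : R[i]) : A != 0 -> B != 0 ->
  cnorm ((cnorm A * cnorm B)%:C / (A * conjc B) - 1) <= 2 * cnorm (A - B) / cnorm A.
Proof.
move=> A0 B0; have nA := cnorm_gt0 A0; have nB := cnorm_gt0 B0.
have cB0 : conjc B != 0 by apply: contra_neq B0 => e; apply: cnorm_eq0; rewrite -cnorm_conj e cnorm0.
have -> : (cnorm A * cnorm B)%:C / (A * conjc B) - 1 =
    ((cnorm A - cnorm B)%:C * (cnorm B)%:C + (B - A) * conjc B) / (A * conjc B).
  have : (cnorm B)%:C * (cnorm B)%:C = B * conjc B by rewrite mulcJ -real_complexM.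
  rewrite real_complexB real_complexM => e.
  have -> : ((cnorm A)%:C - (cnorm B)%:C) * (cnorm B)%:C + (B - A) * conjc B =
      (cnorm A)%:C * (cnorm B)%:C - A * conjc B by rewrite mulrBl mulrBl e; ring.
  by field; rewrite A0 cB0.
rewrite cnormM cnormV cnormM cnorm_conj ler_pdivrMr ?mulr_gt0//.
apply: le_trans (cnormD _ _) _; rewrite !cnormM !cnorm_real cnorm_conj (ger0_norm (cnorm_ge0 B)).
have -> : 2 * cnorm (A - B) / cnorm A * (cnorm A * cnorm B) =
    cnorm (A - B) * cnorm B + cnorm (A - B) * cnorm B by field; rewrite gt_eqF.
rewrite [cnorm (B - A)]cnorm_distC lerD2r ler_wpM2r ?cnorm_ge0// ler_norml.
have := cnormD (A - B) B; have := cnormD (B - A) A; rewrite !subrK cnorm_distC.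
by move=> h1 h2; apply/andP; split; lra.
Qed.

End Gram.

(** * Universality at the edge *)

Section EdgeUniversality.
Context {R : realType}.
Variables (a c : R).
Implicit Types (z w : R[i]).

Definition charge_root z : R := expR (c * ln (cnorm (z - a%:C))).

Lemma charge_root_sqr z : charge_root z ^+ 2 = charge a c z.
Proof. by rewrite /charge_root -expRM_natl /charge; congr expR; ring. Qed.

Definition kernel_vec (P : nat -> {poly R[i]}) N z j : R[i] :=
  (ginibre_weight N z * charge_root z / Num.sqrt N%:R)%:C * (P j).[z].

Lemma kernelN_gram (P : nat -> {poly R[i]}) N z w : (0 < N)%N ->
  (N%:R^-1)%:C * kernelN a c N P z w =
  \sum_(j < N) kernel_vec P N z j * conjc (kernel_vec P N w j).
Proof.
move=> N0; have NR : (N%:R : R) != 0 by rewrite pnatr_eq0 -lt0n.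
have kk : Num.sqrt (N%:R : R) * Num.sqrt N%:R = N%:R by rewrite -expr2 sqr_sqrtr ?ler0n.
rewrite /kernelN mulrA -real_complexM mulr_sumr; apply: eq_bigr => j _.
have -> : N%:R^-1 * expR (- (N%:R / 2) * (Qpot a c N z + Qpot a c N w)) =
    (ginibre_weight N z * charge_root z / Num.sqrt N%:R) *
    (ginibre_weight N w * charge_root w / Num.sqrt N%:R).
  have -> : - (N%:R / 2) * (Qpot a c N z + Qpot a c N w) =
      (- (N%:R / 2 * cnorm z ^+ 2) + c * ln (cnorm (z - a%:C))) +
      (- (N%:R / 2 * cnorm w ^+ 2) + c * ln (cnorm (w - a%:C))).
    by rewrite /Qpot; field.
  rewrite !expRD -/(ginibre_weight N z) -/(ginibre_weight N w) -/(charge_root z) -/(charge_root w).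
  have kI : N%:R^-1 = (Num.sqrt N%:R)^-1 * (Num.sqrt N%:R)^-1 :> R by rewrite -invfM kk.
  by rewrite kI; ring.
rewrite /kernel_vec conjcM conjcR.
move: (ginibre_weight N z * _ / _) (ginibre_weight N w * _ / _) => x y.
by rewrite real_complexM; ring.
Qed.

Variables (P : nat -> nat -> {poly R[i]}).
Hypothesis hP : forall N : nat, (0 < N)%N -> orthonormal_polys a c N (P N).
Variables (h1 h2 : {poly R[i]}) (e rho : R) (d : nat).
Hypotheses (e0 : 0 < e)
  (hh1 : forall z, cnorm z <= rho -> expR (- e) <=
    cnorm h1.[z] ^+ 2 * expR (- (2 * c * ln (cnorm (z - a%:C)))) <= expR e)
  (hh2 : forall z, cnorm z <= rho -> expR (- e) <=
    cnorm h2.[z] ^+ 2 * expR (- (2 * - c * ln (cnorm (z - a%:C)))) <= expR e).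

Lemma approx_neq0 z : cnorm z <= rho -> h1.[z] != 0.
Proof.
move=> /hh1/andP[+ _]; apply: contraTneq => ->.
by rewrite cnorm0 expr0n mul0r -ltNge expR_gt0.
Qed.

Lemma charge_ratio z : cnorm z <= rho ->
  expR (- e) <= charge_root z ^+ 2 / cnorm h1.[z] ^+ 2 <= expR e.
Proof.
move=> zr; have := hh1 zr; have h0 := cnorm_gt0 (approx_neq0 zr).
have q0 : 0 < cnorm h1.[z] ^+ 2 by rewrite exprn_gt0.
rewrite charge_root_sqr [expR (- (_ * ln _))]expRN -/(charge a c z).
have C0 : 0 < charge a c z := expR_gt0 _.
move=> /andP[l u]; apply/andP; split.
- by rewrite ler_pdivlMr// expRN ler_pdivrMl ?expR_gt0//; move: u; rewrite ler_pdivrMr.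
- rewrite ler_pdivrMr//; move: l.
  by rewrite ler_pdivlMr// expRN ler_pdivrMl ?expR_gt0.
Qed.

(** [expR e] is the square root of the comparison constant [expR (2 * e)]; the quotient has modulus
    near 1 and undoes the multiplication by [h1]. *)
Definition upper_vec N z j : R[i] :=
  (expR e)%:C * ((charge_root z)%:C / h1.[z]) * ginibre_vec N z j.

Variable N1 : nat.
Hypothesis hN1 : forall N, (N1 <= N)%N -> (0 < N)%N -> forall q : {poly R[i]}, (size q <= N)%N ->
    wnorm2 (gaussian N%:R) (h1 * q) <= expR (2 * e) * wnorm2 (weight a c N) q.
Hypothesis hN2 : forall N, (N1 <= N)%N -> (0 < N)%N -> forall f : {poly R[i]}, (size f <= N + d)%N ->
    wnorm2 (weight a c N) (h2 * f) <= expR (2 * e) * wnorm2 (gaussian N%:R) f.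
Hypotheses (sz1 : (size h1 <= d)%N) (sz2 : (size h2 <= d)%N).

Let g0 b z : 0 <= gaussian (b : R) z := expR_ge0 _.

Lemma kernel_upper N z w : (N1 <= N)%N -> (0 < N)%N -> cnorm z <= rho -> cnorm w <= rho ->
  forall al be : R[i],
  \sum_(j < N) cnorm (al * kernel_vec (P N) N z j + be * kernel_vec (P N) N w j) ^+ 2 <=
  \sum_(j < N + d) cnorm (al * upper_vec N z j + be * upper_vec N w j) ^+ 2.
Proof.
move=> NN N0 zr wr al be; have [sz orth] := hP N0.
have z0 := approx_neq0 zr; have w0 := approx_neq0 wr.
have := kernel_compare (weight_ge0 a c N) (plane_meas_weight a c N0)
  (g0 N%:R) (plane_meas_gaussian _) sz (fun j => size_ginibre_basis j N0)
  orth (fun j k => ortho_ginibre_basis j k N0) (expR_gt0 (2 * e))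
  (fun q qN => size_mul_le sz1 qN) (hN1 NN N0).
pose V z := (ginibre_weight N z * charge_root z / Num.sqrt N%:R)%:C.
(* Dividing the coefficients by the values of [h1] cancels the multiplier on the side of [P N] and
   moves it to the Ginibre side. *)
move=> /(_ (al * V z / h1.[z]) (be * V w / h1.[w]) z w).
set S1 := \sum_(j < N) _; set S2 := _ * _; rewrite (_ : S1 = \sum_(j < N)
    cnorm (al * kernel_vec (P N) N z j + be * kernel_vec (P N) N w j) ^+ 2); last first.
  apply: eq_bigr => j _; congr (cnorm (_ + _) ^+ 2);
    by rewrite mulrA divfK// -mulrA.
rewrite (_ : S2 = \sum_(j < N + d)
    cnorm (al * upper_vec N z j + be * upper_vec N w j) ^+ 2)// /S2 mulr_sumr.
apply: eq_bigr => j _.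
have -> : expR (2 * e) = cnorm (expR e)%:C ^+ 2.
  by rewrite cnorm_real ger0_norm ?expR_ge0// -expRM_natl.
rewrite -exprMn -cnormM; congr (cnorm _ ^+ 2).
by rewrite /upper_vec /ginibre_vec /V !real_complexM; ring.
Qed.

(** In [3 e], the part [2 e] comes from the constant in [upper_vec] and [e] from [charge_ratio]. *)
Lemma upper_diag N z : cnorm z <= rho ->
  \sum_(j < N + d) cnorm (upper_vec N z j) ^+ 2 <=
  expR (3 * e) * \sum_(j < N + d) cnorm (ginibre_vec N z j) ^+ 2.
Proof.
move=> zr; rewrite mulr_sumr; apply: ler_sum => j _.
rewrite /upper_vec cnormM exprMn ler_wpM2r ?sqr_ge0//.
rewrite !cnormM cnormV !cnorm_real !ger0_norm ?expR_ge0// exprMn -expRM_natl.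
have /andP[_] := charge_ratio zr; rewrite -exprVn -exprMn => h.
have -> : 3 * e = 2%:R * e + e by ring.
by rewrite expRD ler_wpM2l ?expR_ge0.
Qed.

(** The comparison is run with second coefficient [0], as the diagonal is all that [gram_dist] asks
    for from below. Starting from size [N - d] keeps [h2 * q] within the degrees of the kernel. *)
Lemma lower_diag N z : (N1 <= N)%N -> (0 < N)%N -> (d <= N)%N -> cnorm z <= rho ->
  \sum_(j < N - d) cnorm (ginibre_vec N z j) ^+ 2 <=
  expR (3 * e) * \sum_(j < N) cnorm (kernel_vec (P N) N z j) ^+ 2.
Proof.
move=> NN N0 dN zr; have [sz orth] := hP N0.
have hsz (q : {poly R[i]}) : (size q <= N - d)%N -> (size (h2 * q)%R <= N)%N.
  by move=> qN; rewrite -[X in (_ <= X)%N](subnK dN) size_mul_le.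
have hn (q : {poly R[i]}) : (size q <= N - d)%N ->
    wnorm2 (weight a c N) (h2 * q) <= expR (2 * e) * wnorm2 (gaussian N%:R) q.
  by move=> qN; apply: hN2 => //; rewrite (leq_trans qN)// (leq_trans (leq_subr _ _)) ?leq_addr.
have := kernel_compare (g0 N%:R) (plane_meas_gaussian _)
  (weight_ge0 a c N) (plane_meas_weight a c N0) (fun j => size_ginibre_basis j N0) sz
  (fun j k => ortho_ginibre_basis j k N0) orth (expR_gt0 (2 * e)) hsz hn.
pose V := (ginibre_weight N z * charge_root z / Num.sqrt N%:R)%:C.
move=> /(_ V 0 z z).
under eq_bigr do rewrite mul0r addr0.
under [in X in _ <= X -> _]eq_bigr do rewrite mul0r addr0.
rewrite -/(kernel_vec (P N) N z _) => hk.
have -> : 3 * e = e + 2 * e by ring.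
rewrite expRD -mulrA -ler_pdivrMl ?expR_gt0// -expRN; apply: le_trans hk.
rewrite mulr_sumr; apply: ler_sum => j _.
have -> : V * (h2.[z] * (ginibre_basis N j).[z]) = (charge_root z)%:C * h2.[z] * ginibre_vec N z j.
  by rewrite /V /ginibre_vec !real_complexM; ring.
rewrite [cnorm (_ * ginibre_vec _ _ _)]cnormM exprMn ler_wpM2r ?sqr_ge0//.
rewrite cnormM cnorm_real ger0_norm ?expR_ge0// exprMn charge_root_sqr mulrC.
by have /andP[] := hh2 zr; rewrite mulrN mulNr opprK.
Qed.

Lemma upper_phase z w : cnorm z <= rho -> cnorm w <= rho ->
  cnorm ((expR e)%:C * ((charge_root z)%:C / h1.[z]) *
    conjc ((expR e)%:C * ((charge_root w)%:C / h1.[w])) - 1) <=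
  (expR (3 * e) - 1) + expR (3 * e) * (2 * cnorm (h1.[z] - h1.[w]) / cnorm h1.[z]).
Proof.
move=> zr wr; have z0 := approx_neq0 zr; have w0 := approx_neq0 wr.
have nz := cnorm_gt0 z0; have nw := cnorm_gt0 w0.
set A := h1.[z] in z0 nz *; set B := h1.[w] in w0 nw *.
pose s := charge_root z / cnorm A; pose t := charge_root w / cnorm B.
have s0 : 0 <= s by rewrite divr_ge0 ?expR_ge0// ltW.
have t0 : 0 <= t by rewrite divr_ge0 ?expR_ge0// ltW.
have /andP[s1 s2] := charge_ratio zr; have /andP[t1 t2] := charge_ratio wr.
rewrite -/A -exprVn -exprMn -/s in s1 s2; rewrite -/B -exprVn -exprMn -/t in t1 t2.
(* The product splits into a modulus [mu] and a unimodular factor. The two factors [expR e] outweigh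
   the possible loss in [s * t], so [1 <= mu]. *)
pose mu := expR e * expR e * (s * t).
have e2 : 0 <= expR e * expR e by rewrite mulr_ge0 ?expR_ge0.
have mu0 : 0 <= mu by apply: mulr_ge0 => //; exact: mulr_ge0.
have muE : mu ^+ 2 = expR (4 * e) * (s ^+ 2 * t ^+ 2).
  have -> : 4 * e = e + e + (e + e) by ring.
  by rewrite !expRD /mu; ring.
have mu1 : 1 <= mu.
  rewrite -(@ler_pXn2r _ 2) ?nnegrE// expr1n muE.
  apply: (@le_trans _ _ (expR (4 * e) * (expR (- e) * expR (- e)))); last first.
    by rewrite ler_wpM2l ?expR_ge0// ler_pM ?expR_ge0.
  rewrite -!expRD -[leLHS]expR0 ler_expR (_ : _ + _ = 2 * e); last by ring.
  by rewrite mulr_ge0// ltW.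
have mu3 : mu <= expR (3 * e).
  rewrite -(@ler_pXn2r _ 2) ?nnegrE ?expR_ge0// muE.
  apply: (@le_trans _ _ (expR (4 * e) * (expR e * expR e))).
    by rewrite ler_wpM2l ?expR_ge0// ler_pM ?sqr_ge0.
  by rewrite -!expRD -expRM_natl ler_expR le_eqVlt; apply/orP; left; apply/eqP; ring.
have cB0 : conjc B != 0 by apply: contra_neq w0 => E; apply: cnorm_eq0; rewrite -cnorm_conj E cnorm0.
pose th := (cnorm A * cnorm B)%:C / (A * conjc B).
have -> : (expR e)%:C * ((charge_root z)%:C / A) * conjc ((expR e)%:C * ((charge_root w)%:C / B)) - 1 =
    (mu - 1)%:C + mu%:C * (th - 1).
  have cV : conjc B^-1 = (conjc B)^-1 by exact: conjc_inv.
  rewrite !conjcM !conjcR cV /th /mu /s /t real_complexB !(real_complexM, real_complexV).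
  by field; rewrite z0 cB0 !real_complex_neq0 ?gt_eqF.
apply: le_trans (cnormD _ _) _; rewrite cnormM !cnorm_real (ger0_norm mu0) ger0_norm ?subr_ge0//.
apply: lerD; first by rewrite lerD2r.
by apply: ler_pM; rewrite ?cnorm_ge0//; exact: phase_quotient_near.
Qed.

End EdgeUniversality.

Theorem theorem1p2 (R : realType) (a c : R) (ha : 1 < a) (hc : -1 < c)
  (P : nat -> nat -> {poly R[i]})
  (hP : forall N : nat, (0 < N)%N -> orthonormal_polys a c N (P N))
  (p : R[i]) (hp : cnorm p = 1) :
  exists g : nat -> R[i] -> R[i],
    (forall N, cont_unimodular (g N)) /\
    forall r : R, 0 < r -> forall eps : R, 0 < eps ->
    exists N0 : nat, forall N : nat, (N0 <= N)%N ->
    forall z w : R[i], cnorm z <= r -> cnorm w <= r ->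
      cnorm (g N z * conjc (g N w) * (N%:R^-1)%:C *
               kernelN a c N (P N) (p + p * z / (Num.sqrt N%:R)%:C)
                                   (p + p * w / (Num.sqrt N%:R)%:C)
             - Gker z w * erfc ((z + conjc w) / (Num.sqrt 2)%:C) / 2) < eps.
Proof.
exists edge_phase; split=> [N|r r0 eps eps0]; first exact: cont_unimodular_edge_phase.
(* The final error is [7 et + et ^ 2]; [e = et / 6] is small enough for [expR (3 * e) <= 1 + et]. *)
pose et := Num.min eps 1 / 20; have et0 : 0 < et by rewrite divr_gt0// lt_min eps0 ltr01.
have et1 : et <= 20^-1 by rewrite /et ler_pdivrMr// mulVf// ge_min lexx orbT.
have ete : et * 20 <= eps by rewrite /et divfK// ge_min lexx.
pose e := et / 6; have e0 : 0 < e by rewrite divr_gt0.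
set T := expR (3 * e).
have T1 : 1 <= T by rewrite -[leLHS]expR0 ler_expR mulr_ge0// ltW.
have Te : T <= 1 + et.
  have h := expR_ge1Dx (- (3 * e)); rewrite expRN -/T in h.
  have h2 : (1 + - (3 * e)) * T <= 1 by rewrite -ler_pdivlMr ?div1r// expR_gt0.
  rewrite /e in h2; nra.
pose rho := (1 + a) / 2; have r1 : 1 < rho by rewrite /rho; lra.
have ra : rho < a by rewrite /rho; lra.
have rho0 : 0 < rho by lra.
have [h1 hh1] := @power_poly_approx R a rho c e rho0 ra e0.
have [h2 hh2] := @power_poly_approx R a rho (- c) e rho0 ra e0.
pose d := (size h1 + size h2)%N.
have sz1 : (size h1 <= d)%N by exact: leq_addr.
have sz2 : (size h2 <= d)%N by exact: leq_addl.
have [N1 hN1] := norm_upper hP e0 r1 sz1 (fun z zr => (andP (hh1 z zr)).2).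
have [N2 hN2] := norm_lower hP d e0 r1 (fun z zr => (andP (hh2 z zr)).2).
have [N3 hN3] := gammaQ_near d (ltW r0) et0.
have pr : cnorm p <= rho by rewrite hp ltW.
have m0 := cnorm_gt0 (approx_neq0 hh1 pr); set m := cnorm h1.[p] in m0.
(* Two values of [h1] near [p] then differ by at most [m et / 4] and have modulus at least [m / 2],
   so [phi] below is bounded by [et]. *)
have [|de de0 hde] := @poly_continuous R h1 p (m * et / 8); first by rewrite divr_gt0// mulr_gt0.
have [N4 hN4] := @sqrtS_ge_near R (Num.max (r / de) (r / (rho - 1))).
exists (maxn (maxn N1 N2) (maxn N3 (maxn N4.+1 d))) => N.
rewrite !geq_max => /andP[/andP[NN1 NN2] /and3P[NN3 NN4 Nd]] z w zr wr.
have N0 : (0 < N)%N := leq_ltn_trans (leq0n _) NN4.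
have := hN4 N.-1; rewrite prednK// -ltnS prednK// => /(_ NN4).
rewrite ge_max; set k : R := Num.sqrt N%:R => /andP[k1 k2].
have k0 : 0 < k by rewrite sqrtr_gt0 ltr0n.
have near v : cnorm v <= r -> cnorm (edge_point p N v - p) <= r / k.
  move=> vr; rewrite /edge_point addrC addKr cnormM cnormM hp mul1r cnormV cnorm_real gtr0_norm//.
  by rewrite ler_pM2r ?invr_gt0.
have rk1 : r / k <= de by rewrite ler_pdivrMr// mulrC -ler_pdivrMr.
have rk2 : r / k <= rho - 1 by rewrite ler_pdivrMr// mulrC -ler_pdivrMr// subr_gt0.
have inrho v : cnorm v <= r -> cnorm (edge_point p N v) <= rho.
  move=> /near vr; rewrite -(subrK p (edge_point p N v)).
  by apply: le_trans (cnormD _ _) _; rewrite hp; lra.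
have hnear v : cnorm v <= r -> cnorm (h1.[edge_point p N v] - h1.[p]) <= m * et / 8.
  by move=> /near vr; apply: hde; exact: le_trans vr rk1.
set ze := edge_point p N z; set we := edge_point p N w.
have zrho : cnorm ze <= rho by exact: inrho.
have wrho : cnorm we <= rho by exact: inrho.
have gram1 (v : R[i]) : 0 <= \sum_(j < N + d) cnorm (ginibre_vec N v j) ^+ 2 <= 1.
  rewrite ginibre_gram_diag// sumr_ge0 => [|j _]; last first.
    by rewrite poisson_mass_ge0// mulr_ge0 ?sqr_ge0.
  by rewrite poisson_cdf_le1// mulr_ge0 ?sqr_ge0.
have gramd v : cnorm v <= r ->
    \sum_(j < N + d) cnorm (ginibre_vec N (edge_point p N v) j) ^+ 2 -
    \sum_(j < N - d) cnorm (ginibre_vec N (edge_point p N v) j) ^+ 2 <= 2 * et.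
  move=> vr; rewrite !ginibre_gram_diag//; set x := _ * _ ^+ 2.
  have X : x%:C = N%:R + k%:C * (v + conjc v) + v * conjc v.
    by rewrite -(edge_product v v N0 hp) mulcJ /x real_complexM real_complex_nat.
  have vr' : cnorm (conjc v) <= r by rewrite cnorm_conj.
  have := hN3 N (N + d)%N NN3 _ _ v _ vr vr'.
  have := hN3 N (N - d)%N NN3 _ _ v _ vr vr'.
  rewrite -X !gammaQ_real; set E := erfc _ / 2 => A1 A2.
  have {}A1 : cnorm ((poisson_cdf (N - d) x)%:C - E) <= et.
    by apply: A1; [rewrite subnK|rewrite (leq_trans (leq_subr _ _)) ?leq_addr].
  have {}A2 : cnorm ((poisson_cdf (N + d) x)%:C - E) <= et.
    by apply: A2 => //; rewrite -addnA leq_addr.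
  apply: (le_trans (ler_norm _)); rewrite -cnorm_real real_complexB.
  rewrite (_ : _ - _ = (poisson_cdf (N + d) x)%:C - E - ((poisson_cdf (N - d) x)%:C - E)); last by ring.
  by apply: le_trans (cnormB _ _) _; rewrite mulrDl mul1r lerD.
have diag v : cnorm v <= r ->
    \sum_(j < N + d) cnorm (upper_vec a c h1 e N (edge_point p N v) j) ^+ 2 -
    \sum_(j < N) cnorm (kernel_vec a c (P N) N (edge_point p N v) j) ^+ 2 <= 4 * et.
  move=> vr; have vrho := inrho v vr.
  have u1 := upper_diag d hh1 N vrho.
  have l1 := lower_diag hP hh2 hN2 sz2 NN2 N0 Nd vrho.
  have := gram1 (edge_point p N v); have := gramd v vr.
  have k00 : 0 <= \sum_(j < N) cnorm (kernel_vec a c (P N) N (edge_point p N v) j) ^+ 2.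
    by rewrite sumr_ge0// => j _; exact: sqr_ge0.
  move: u1 l1 k00; rewrite -/T.
  set U := \sum_(j < _) _; set B1 := \sum_(j < _) _; set B2 := \sum_(j < N - d) _.
  set K := \sum_(j < N) _ => u1 l1 k00 b12 /andP[B10 B11].
  clear -et0 T1 Te u1 l1 k00 b12 B10 B11.
  have TB : T * B1 <= B1 + et by nra.
  have TK : T * K <= K + et * K by nra.
  (* [K] has no a priori bound, which the error [et * K] needs. If [K > 1], the bound [U <= 1 + et]
     is already enough. *)
  have [K1|K1] := leP K 1; last by lra.
  have : et * K <= et by rewrite ler_piMr// ltW.
  lra.
have off := gram_dist (kernel_upper hP hh1 hN1 sz1 NN1 N0 zrho wrho) (diag z zr) (diag w wr).
have S1 : cnorm (\sum_(j < N + d) ginibre_vec N ze j * conjc (ginibre_vec N we j)) <= 1.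
  apply: le_trans (gram_le_mean _ _ _) _; rewrite ler_pdivrMr// mul1r -[2]/(1 + 1).
  by rewrite lerD//; [have /andP[] := gram1 ze|have /andP[] := gram1 we].
have Sup : \sum_(j < N + d) upper_vec a c h1 e N ze j * conjc (upper_vec a c h1 e N we j) =
    (expR e)%:C * ((charge_root a c ze)%:C / h1.[ze]) *
    conjc ((expR e)%:C * ((charge_root a c we)%:C / h1.[we])) *
    \sum_(j < N + d) ginibre_vec N ze j * conjc (ginibre_vec N we j).
  rewrite mulr_sumr; apply: eq_bigr => j _.
  by rewrite /upper_vec [conjc (_ * ginibre_vec _ _ _)]conjcM; ring.
have ph := upper_phase e0 hh1 zrho wrho; rewrite -/T in ph.
have phi : 2 * cnorm (h1.[ze] - h1.[we]) / cnorm h1.[ze] <= et.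
  have nz := hnear z zr; have nw := hnear w wr; rewrite -/ze -/we in nz nw.
  clear -et0 et1 m0 nz nw.
  have mz : m / 2 <= cnorm h1.[ze].
    have := cnormD (h1.[p] - h1.[ze]) h1.[ze]; rewrite subrK -/m cnorm_distC.
    have : m * et / 8 <= m / 2 by nra.
    lra.
  have zw : cnorm (h1.[ze] - h1.[we]) <= m * et / 4.
    rewrite (_ : _ - _ = (h1.[ze] - h1.[p]) - (h1.[we] - h1.[p])); last by ring.
    by apply: le_trans (cnormB _ _) _; lra.
  have mz0 : 0 < cnorm h1.[ze] by lra.
  by rewrite ler_pdivrMr//; nra.
have gq : cnorm (edge_phase N z * conjc (edge_phase N w)) = 1.
  by rewrite cnormM cnorm_conj !cnorm_edge_phase mulr1.
have Gg := edge_ginibre_gram (N + d) z w N0 hp; rewrite -/ze -/we in Gg.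
have wr' : cnorm (conjc w) <= r by rewrite cnorm_conj.
have lim : cnorm (gammaQ (N + d) (N%:R + k%:C * (z + conjc w) + z * conjc w) -
    erfc ((z + conjc w) / (Num.sqrt 2)%:C) / 2) <= et.
  by apply: hN3 => //; rewrite -addnA leq_addr.
rewrite -[p + p * z / _]/ze -[p + p * w / _]/we -mulrA kernelN_gram//.
rewrite Sup in off.
set G := gammaQ _ _ in Gg lim; set E := erfc _ in lim *; set S := \sum_(j < N + d) _ in off S1 Gg Sup *.
set K := \sum_(j < N) _ in off *.
set F := _ * conjc (_ * (_ / _)) in ph off.
set q := _ * conjc (edge_phase N w) in Gg gq *.
clearbody G E S K F q.
(* The three errors: gap between the forms, deviation of the factor of [upper_vec] from 1, and
   convergence of the Ginibre kernel of size [N + d]. *)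
have -> : q * K - Gker z w * E / 2 = - (q * (F * S - K)) + q * ((F - 1) * S) + Gker z w * (G - E / 2).
  by rewrite (mulrBr (Gker z w)) -Gg; ring.
have b1 : cnorm (q * (F * S - K)) <= 4 * et by rewrite cnormM gq mul1r.
have T0 : 0 <= T := le_trans ler01 T1.
have Tet : T - 1 <= et by rewrite lerBlDl.
have b2 : cnorm (q * ((F - 1) * S)) <= et + (1 + et) * et.
  rewrite cnormM gq mul1r cnormM.
  apply: (@le_trans _ _ (cnorm (F - 1) * 1)); first by rewrite ler_wpM2l ?cnorm_ge0.
  rewrite mulr1; apply: (le_trans ph); apply: lerD => //.
  apply: ler_pM => //.
  by rewrite divr_ge0 ?mulr_ge0 ?cnorm_ge0.
have b3 : cnorm (Gker z w * (G - E / 2)) <= et.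
  rewrite cnormM -[leRHS]mul1r.
  by apply: ler_pM; rewrite ?cnorm_ge0// cnorm_Gker.
apply: le_lt_trans (cnormD _ _) _.
apply: (@le_lt_trans _ _ (4 * et + (et + (1 + et) * et) + et)).
  apply: lerD => //; apply: le_trans (cnormD _ _) _; rewrite cnormN.
  exact: lerD.
clear -et0 et1 ete; nra.
Qed.
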